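(* The problem $1|jrp,s=const,p_j=p,r_j|F_{\max}+c_\mathcal{Q}$ is solvable in polynomial time.
   Context: Problem $1|jrp,r_j|c_S+c_\mathcal{Q}$: a set $\mathcal{J}$ of $n$ jobs must be processed non-preemptively on a single machine that processes at most one job at a time. Job $j$ has processing time $p_j>0$ and release date $r_j\ge 0$. There are resources $\mathcal{R}=\{R_1,\dots,R_s\}$, and each job $j$ requires a nonempty subset $R(j)\subseteq\mathcal{R}$. There are nonnegative costs $K_0,K_1,\dots,K_s$. A solution is a pair $(S,\mathcal{Q})$, where $S$ assigns a start time $S_j$ to each job (completion time $C_j=S_j+p_j$), and $\mathcal{Q}=\{(\mathcal{R}_1,t_1),\dots,(\mathcal{R}_q,t_q)\}$ with $t_1<\dots<t_q$ and $\mathcal{R}_\ell\subseteq\mathcal{R}$ (the resources in $\mathcal{R}_\ell$ are replenished at time $t_\ell$). Job $j$ is ready to be started at time $t$ if $R(j)\subseteq\bigcup_{\ell:\,t_\ell\in[r_j,t]}\mathcal{R}_\ell$. The solution is feasible if no two jobs overlap and each job $j$ is ready to be started at $S_j$. The replenishment cost is $c_\mathcal{Q}=\sum_{\ell=1}^q(K_0+\sum_{R_i\in\mathcal{R}_\ell}K_i)$. In $1|jrp,s=const,p_j=p,r_j|F_{\max}+c_\mathcal{Q}$ the number $s$ of resources is a fixed constant (not part of the input), all jobs have the same processing time $p$, and the goal is to minimize $F_{\max}+c_\mathcal{Q}$ with $F_{\max}=\max_j(C_j-r_j)$. *)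

(* Defs.v *)
From mathcomp Require Import all_boot all_order all_algebra.

Set Implicit Arguments.
Unset Strict Implicit.
Unset Printing Implicit Defensive.

Import Order.TTheory GRing.Theory Num.Theory.

(* Model of computation: a random access machine over natural numbers, with
   structured control flow and the logarithmic cost criterion.  Every operation
   is charged the bit lengths of the values and addresses it handles, so that
   time on this machine and on a Turing machine are polynomially related (in
   particular a product has at most as many bits as the multiplication costs,
   hence repeated squaring is paid for).  The registers are the cells with a
   constant address. *)

Definition bitlen (n : nat) : nat := (trunc_log 2 n).+1.

Definition memory := nat -> nat.

Variant binop := Add | Sub | Mul | Div.

(* [Sub] is truncated at 0; [Div] is the Euclidean quotient, 0 for divisor 0. *)
Definition binop_sem (o : binop) : nat -> nat -> nat :=
  match o with Add => addn | Sub => subn | Mul => muln | Div => divn end.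

Inductive expr :=
  | EConst of nat
  | ELoad of expr
  | EOp of binop & expr & expr.

Fixpoint eval (m : memory) (e : expr) : nat :=
  match e with
  | EConst n => n
  | ELoad a => m (eval m a)
  | EOp o e1 e2 => binop_sem o (eval m e1) (eval m e2)
  end.

Fixpoint eval_cost (m : memory) (e : expr) : nat :=
  match e with
  | EConst n => bitlen n
  | ELoad a => eval_cost m a + bitlen (eval m a) + bitlen (m (eval m a))
  | EOp o e1 e2 =>
      eval_cost m e1 + eval_cost m e2 + bitlen (eval m e1) + bitlen (eval m e2)
  end.

Definition update (m : memory) (a v : nat) : memory :=
  fun b => if b == a then v else m b.

Inductive cmd :=
  | CSkip
  | CStore of expr & expr
  | CSeq of cmd & cmd
  | CIf of expr & cmd & cmd
  | CWhile of expr & cmd.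

(* [exec c m t m']: started in memory [m], the program [c] halts in memory [m']
   after time [t].  In tests, 0 is false and everything else is true. *)
Inductive exec : cmd -> memory -> nat -> memory -> Prop :=
  | ExecSkip m : exec CSkip m 1 m
  | ExecStore a e m :
      exec (CStore a e) m
        (eval_cost m a + eval_cost m e + bitlen (eval m a) + bitlen (eval m e))
        (update m (eval m a) (eval m e))
  | ExecSeq c1 c2 m t1 m1 t2 m2 :
      exec c1 m t1 m1 -> exec c2 m1 t2 m2 -> exec (CSeq c1 c2) m (t1 + t2) m2
  | ExecIfTrue e c1 c2 m t m' :
      eval m e != 0 -> exec c1 m t m' ->
      exec (CIf e c1 c2) m (eval_cost m e + t) m'
  | ExecIfFalse e c1 c2 m t m' :
      eval m e = 0 -> exec c2 m t m' ->
      exec (CIf e c1 c2) m (eval_cost m e + t) m'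
  | ExecWhileTrue e c m t1 m1 t2 m2 :
      eval m e != 0 -> exec c m t1 m1 -> exec (CWhile e c) m1 t2 m2 ->
      exec (CWhile e c) m (eval_cost m e + t1 + t2) m2
  | ExecWhileFalse e c m :
      eval m e = 0 -> exec (CWhile e c) m (eval_cost m e) m.

(* A word [w : seq nat] is stored as its length in cell 0, followed by its
   letters; all other cells initially hold 0. *)
Definition load_word (w : seq nat) : memory := nth 0 (size w :: w).

Definition read_word (m : memory) : seq nat := mkseq (fun i => m i.+1) (m 0).

Definition word_size (w : seq nat) : nat := \sum_(x <- w) bitlen x.

(* The length of the output is charged to the running time. *)
Definition computes_in (c : cmd) (w out : seq nat) (t : nat) : Prop :=
  exists (m : memory) (t0 : nat),
    [/\ exec c (load_word w) t0 m, read_word m = out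
      & t = t0 + word_size out].

(* One program and one polynomial bound for all admissible instances [x], under
   every word [w] encoding [x]; the bound is in the bit size of [w]. *)
Definition solvable_in_polynomial_time (In : Type) (Out : In -> Type)
    (admissible : In -> Prop)
    (encodes_in : In -> seq nat -> Prop)
    (encodes_out : forall x : In, Out x -> seq nat -> Prop)
    (is_solution : forall x : In, Out x -> Prop) : Prop :=
  exists (c : cmd) (a d : nat),
    forall (x : In) (w : seq nat), admissible x -> encodes_in x w ->
    exists (y : Out x) (out : seq nat) (t : nat),
      [/\ computes_in c w out t, t <= a * word_size w ^ d + a,
          encodes_out x y out & is_solution x y].

Local Open Scope ring_scope.

Record instance (s : nat) := Instance {
  njobs : nat;
  proc : 'I_njobs -> rat;             (* p_j *)
  release : 'I_njobs -> rat;          (* r_j *)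
  req : 'I_njobs -> {set 'I_s};       (* R(j) *)
  joint_cost : rat;                   (* K_0 *)
  res_cost : 'I_s -> rat              (* K_1, ..., K_s *)
}.
Arguments proc {s} i _.
Arguments release {s} i _.
Arguments req {s} i _.

Definition valid_instance (s : nat) (I : instance s) : Prop :=
  [/\ forall j, 0 < proc I j, forall j, 0 <= release I j,
      forall j, req I j != set0, 0 <= joint_cost I
    & forall i, 0 <= res_cost I i].

Definition equal_proc (s : nat) (I : instance s) : Prop :=
  exists p : rat, forall j, proc I j = p.

Record solution (s n : nat) := Solution {
  start : 'I_n -> rat;                (* S_j *)
  repl : seq ({set 'I_s} * rat)       (* the (R_l, t_l), by increasing t_l *)
}.

Section Schedule.

Variables (s : nat) (I : instance s) (x : solution s (njobs I)).

Definition completion (j : 'I_(njobs I)) : rat := start x j + proc I j.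

Definition ready (j : 'I_(njobs I)) (t : rat) : bool :=
  req I j \subset \bigcup_(q <- repl x | release I j <= q.2 <= t) q.1.

Definition feasible : Prop :=
  [/\ sorted <%R [seq q.2 | q <- repl x],
      forall j k, j != k ->
        (completion j <= start x k) || (completion k <= start x j)
    & forall j, ready j (start x j)].

Definition repl_cost : rat :=
  \sum_(q <- repl x) (joint_cost I + \sum_(i in q.1) res_cost I i).

(* In a feasible solution of a valid instance every flow time is positive, so
   the initial value 0 of the maximum only matters when there are no jobs. *)
Definition Fmax : rat := \big[Num.max/0]_j (completion j - release I j).

Definition Fmax_repl_cost : rat := Fmax + repl_cost.

End Schedule.

Definition optimal (s : nat) (I : instance s) (x : solution s (njobs I)) : Prop :=
  feasible x /\
  forall y : solution s (njobs I),
    feasible y -> Fmax_repl_cost x <= Fmax_repl_cost y.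

(* Nonnegative rationals are encoded by numerator and denominator in binary,
   not necessarily in lowest terms. *)
Definition encodes_rat (q : rat) (w : seq nat) : Prop :=
  exists a b : nat, [/\ (0 < b)%N, q = a%:R / b%:R & w = [:: a; b]].

Definition encode_set (s : nat) (A : {set 'I_s}) : seq nat :=
  [seq nat_of_bool (i \in A) | i <- enum 'I_s].

Definition encodes_instance (s : nat) (I : instance s) (w : seq nat) : Prop :=
  exists (wK0 : seq nat) (wK : 'I_s -> seq nat)
         (wp wr : 'I_(njobs I) -> seq nat),
    [/\ encodes_rat (joint_cost I) wK0,
        forall i, encodes_rat (res_cost I i) (wK i),
        forall j, encodes_rat (proc I j) (wp j),
        forall j, encodes_rat (release I j) (wr j)
      & w = njobs I :: wK0
              ++ flatten [seq wK i | i <- enum 'I_s]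
              ++ flatten [seq wp j ++ wr j ++ encode_set (req I j)
                         | j <- enum 'I_(njobs I)]].

Fixpoint encodes_repl (s : nat) (Q : seq ({set 'I_s} * rat)) (w : seq nat) : Prop :=
  match Q with
  | [::] => w = [::]
  | (A, t) :: Q' =>
      exists wt w' : seq nat,
        [/\ encodes_rat t wt, encodes_repl Q' w' & w = encode_set A ++ wt ++ w']
  end.

Definition encodes_solution (s n : nat) (x : solution s n) (w : seq nat) : Prop :=
  exists (wS : 'I_n -> seq nat) (wQ : seq nat),
    [/\ forall j, encodes_rat (start x j) (wS j),
        encodes_repl (repl x) wQ
      & w = flatten [seq wS j | j <- enum 'I_n] ++ size (repl x) :: wQ].

(* Main.v *)
Require Import Defs.
From mathcomp Require Import all_boot all_order all_algebra.
From mathcomp Require Import fingroup perm zify ring lra.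

(** Moving every replenishment back to the latest release date not after it, and
    merging, changes neither feasibility nor flow times and does not increase
    the cost.  Exchanging two jobs with the same resource set that run against
    the order of their release dates keeps the schedule feasible and does not
    increase [Fmax], so each of the at most [2 ^ s] classes of jobs can be served
    first-in first-out.  Starting jobs as early as possible then makes every
    starting time of the form [r_i + k p].  Hence a partial schedule is described
    by boundedly many numbers in [0 .. n]: the time when the machine becomes
    free, the maximum flow time so far, the number of started jobs, the last
    replenishment of each resource and the last job of each class.  An optimal
    solution is a cheapest path of at most [3 n] moves (start a job, replenish a
    set of resources, stay idle) between such states, and there are at most
    [(n + 1) ^ (6 + s + 2 ^ s)] of them.  After multiplication by a common
    denominator all quantities are natural numbers of polynomial bit length. *)

Set Implicit Arguments.
Unset Strict Implicit.
Unset Printing Implicit Defensive.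
Import Order.TTheory GRing.Theory Num.Theory.

(** * Time bounds for programs *)

(** Early starting is never carried out as a transformation. A given schedule is followed event by
    event through the state graph, and the path only has to stay ahead of it: the machine is free no
    later than the schedule needs it. Conversely, a path that starts all jobs decodes into a
    feasible schedule of at most its cost, so a cheapest path decodes into an optimum. A state has
    no room for the set of started jobs. The order inside a class being fixed, the last started job
    of the class already tells whether another one is new. The maximum flow time fits into three
    digits because it has the form [r_i + k p - r_j]. All dates are scaled and then shifted by one.
    Index 0, standing for no event, gets date 0, strictly before every release date, so a resource
    that was never replenished fails the readiness test of every job without a case distinction. A
    transition is a single closed arithmetic expression whose size depends on [s] only. Its cost is
    therefore a constant times the bit length of a bound [W] on all cells, and the time bound
    reduces to counting steps and bounding [W]. *)

Lemma ltn_bitlen n : n < 2 ^ bitlen n.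
Proof. exact: trunc_log_ltn. Qed.

Lemma bitlen_leP n b : 0 < b -> n < 2 ^ b -> bitlen n <= b.
Proof.
case: n => [|n] b0 nb; first by rewrite /bitlen trunc_log0.
rewrite /bitlen -(ltn_exp2l (trunc_log 2 n.+1) b (isT : 1 < 2)).
by apply: leq_ltn_trans nb; apply: trunc_logP.
Qed.

Lemma bitlen_gt0 n : 0 < bitlen n. Proof. by []. Qed.

Lemma leq_bitlen m n : m <= n -> bitlen m <= bitlen n.
Proof. by move=> mn; apply: bitlen_leP => //; apply: leq_ltn_trans mn (ltn_bitlen n). Qed.

Lemma bitlen_mul m n : bitlen (m * n) <= bitlen m + bitlen n.
Proof. by apply: bitlen_leP => //; rewrite expnD ltn_mul // ltn_bitlen. Qed.

Lemma bitlen_add m n : bitlen (m + n) <= bitlen m + bitlen n.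
Proof.
apply: bitlen_leP => //; rewrite expnD.
have := ltn_bitlen m; have := ltn_bitlen n.
have : 2 <= 2 ^ bitlen m by rewrite /bitlen expnS leq_pmulr // expn_gt0.
have : 2 <= 2 ^ bitlen n by rewrite /bitlen expnS leq_pmulr // expn_gt0.
nia.
Qed.

Lemma bitlen_binop o m n : bitlen (binop_sem o m n) <= bitlen m + bitlen n.
Proof.
case: o => /=; [exact: bitlen_add| |exact: bitlen_mul|].
  by apply: leq_trans (leq_addr _ _); apply: leq_bitlen; apply: leq_subr.
by apply: leq_trans (leq_addr _ _); apply: leq_bitlen; apply: leq_div.
Qed.

Definition bounded (W : nat) (m : memory) := forall a, m a <= W.

(** Intermediate values may exceed [W], but each operator at most adds the bit lengths of its
    operands. Hence length and cost both stay linear in [bitlen W]; the factor 2 pays for computing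
    a subexpression and again for handling its value. *)
Fixpoint expr_weight (e : expr) : nat :=
  match e with
  | EConst n => bitlen n
  | ELoad a => 2 * expr_weight a + 1
  | EOp _ e1 e2 => 2 * (expr_weight e1 + expr_weight e2)
  end.

Lemma expr_weightP W m e : bounded W m ->
  bitlen (eval m e) <= expr_weight e * bitlen W /\
  eval_cost m e <= expr_weight e * bitlen W.
Proof.
move=> bW; elim: e => [n|a [IHv IHc]|o e1 [IHv1 IHc1] e2 [IHv2 IHc2]] /=.
- by split; rewrite leq_pmulr.
- have := leq_bitlen (bW (eval m a)); split; nia.
- have := bitlen_binop o (eval m e1) (eval m e2); split; nia.
Qed.

Fixpoint cmd_weight (c : cmd) : nat :=
  match c with
  | CSkip => 1
  | CStore a e => 2 * (expr_weight a + expr_weight e)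
  | CSeq c1 c2 => cmd_weight c1 + cmd_weight c2
  | CIf e c1 c2 => expr_weight e + (cmd_weight c1 + cmd_weight c2)
  | CWhile e c => expr_weight e + cmd_weight c
  end.

(* Total correctness with time: as long as all cells stay below [W], every
   elementary step costs at most [cmd_weight c * bitlen W], and [k] bounds the
   number of elementary steps. *)
Definition wp (W : nat) (c : cmd) (m : memory) (k : nat) (B : memory -> Prop) :=
  exists t m', [/\ exec c m t m', t <= k * (cmd_weight c * bitlen W), B m'
                 & bounded W m'].

Lemma wp_weaken W c m k k' (B B' : memory -> Prop) :
  k <= k' -> (forall m', bounded W m' -> B m' -> B' m') ->
  wp W c m k B -> wp W c m k' B'.
Proof.
move=> kk BB [t [m' [ex tk Bm bm]]]; exists t, m'; split=> //; last exact: BB.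
by apply: leq_trans tk _; rewrite leq_mul2r kk orbT.
Qed.

Lemma wp_skip W m (B : memory -> Prop) : bounded W m -> B m -> wp W CSkip m 1 B.
Proof. by move=> bm Bm; exists 1, m; split=> //; constructor. Qed.

Lemma bounded_update W m a v : bounded W m -> v <= W -> bounded W (update m a v).
Proof. by move=> bm vW b; rewrite /update; case: ifP. Qed.

Lemma wp_store W a e m (B : memory -> Prop) : bounded W m -> eval m e <= W ->
  B (update m (eval m a) (eval m e)) -> wp W (CStore a e) m 1 B.
Proof.
move=> bm eW Bm; eexists _, _; split; [constructor| |exact: Bm|]; last first.
  exact: bounded_update.
have [] := expr_weightP a bm; have [] := expr_weightP e bm.
by rewrite /cmd_weight; nia.
Qed.

Lemma wp_seq W c1 c2 m k1 k2 (B : memory -> Prop) :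
  wp W c1 m k1 (fun m1 => wp W c2 m1 k2 B) -> wp W (CSeq c1 c2) m (k1 + k2) B.
Proof.
move=> [t1 [m1 [ex1 le1 [t2 [m2 [ex2 le2 Bm2 bm2]]] _]]].
exists (t1 + t2), m2; split=> //; first exact: ExecSeq ex1 ex2.
by rewrite /=; nia.
Qed.

Lemma wp_if W e c1 c2 m k (B : memory -> Prop) : bounded W m ->
  (eval m e != 0 -> wp W c1 m k B) -> (eval m e = 0 -> wp W c2 m k B) ->
  wp W (CIf e c1 c2) m k.+1 B.
Proof.
move=> bm H1 H2; have [_ le] := expr_weightP e bm.
have [e0|e0] := boolP (eval m e == 0).
  have [t [m' [ex tk Bm bm']]] := H2 (eqP e0).
  exists (eval_cost m e + t), m'; split=> //.
    by apply: ExecIfFalse => //; apply/eqP.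
  by rewrite /=; nia.
have [t [m' [ex tk Bm bm']]] := H1 e0.
exists (eval_cost m e + t), m'; split=> //; first exact: ExecIfTrue.
by rewrite /=; nia.
Qed.

(* The input fills the cells from 1 on, so registers cannot have constant
   addresses: they sit just above the input, whose length is in cell 0. *)
Definition reg_addr (r : nat) : expr := EOp Add (ELoad (EConst 0)) (EConst r.+1).
Definition Reg (r : nat) : expr := ELoad (reg_addr r).

(** Truncated subtraction makes the test vanish exactly when the counter reaches the bound. The
    bound is evaluated anew in each round, so an invariant has to fix its value. *)
Definition for_loop (r : nat) (e : expr) (body : cmd) : cmd :=
  CSeq (CStore (reg_addr r) (EConst 0))
       (CWhile (EOp Defs.Sub e (Reg r))
          (CSeq body (CStore (reg_addr r) (EOp Add (Reg r) (EConst 1))))).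

(** Each round costs the body plus one step for the test and one for the increment; the final 2 is
    the initialization and the last, failing test. *)
Lemma wp_for W z r e body m n k (Inv : nat -> memory -> Prop) (B : memory -> Prop) :
  bounded W m -> m 0 = z -> n <= W ->
  Inv 0 (update m (z + r.+1) 0) ->
  (forall i m, i <= n -> Inv i m ->
     [/\ m 0 = z, m (z + r.+1) = i & eval m e = n]) ->
  (forall i m, i < n -> bounded W m -> Inv i m ->
     wp W body m k (fun m' => [/\ m' 0 = z, m' (z + r.+1) = i
                                & Inv i.+1 (update m' (z + r.+1) i.+1)])) ->
  (forall m, bounded W m -> Inv n m -> B m) ->
  wp W (for_loop r e body) m (n * (k + 2) + 2) B.
Proof.
move=> bm m0 nW I0 IE Ib IB; rewrite /for_loop.
set loop := CWhile _ _.
set c1 := CStore _ (EOp _ _ _) in loop *.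
have Hw : cmd_weight loop = expr_weight (EOp Defs.Sub e (Reg r)) +
   (cmd_weight body + cmd_weight c1) by [].
have Hloop : forall d i m, d + i = n -> bounded W m -> Inv i m ->
    wp W loop m (d * (k + 2) + 1) B.
  elim=> [|d IH] i m1 din bm1 Ii.
    rewrite add0n in din; subst i.
    have [z1 r1 e1] := IE n m1 (leqnn _) Ii.
    have [_ le] := expr_weightP (EOp Defs.Sub e (Reg r)) bm1.
    eexists _, m1; split; [apply: ExecWhileFalse| |exact: IB|exact: bm1].
      by rewrite /= z1 r1 e1 subnn.
    rewrite mul0n add0n mul1n Hw; apply: leq_trans le _.
    by rewrite leq_mul2r leq_addr orbT.
  have lin : i < n by lia.
  have [z1 r1 e1] := IE i m1 (ltnW lin) Ii.
  have [_ le] := expr_weightP (EOp Defs.Sub e (Reg r)) bm1.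
  have [t1 [m2 [ex1 le1 [z2 r2 I2] bm2]]] := Ib i m1 lin bm1 Ii.
  have [||t2 [m3 [ex2 le2 I3 bm3]]] :=
    @wp_store W (reg_addr r) (EOp Add (Reg r) (EConst 1)) m2 (Inv i.+1) bm2.
  - by rewrite /= z2 r2; lia.
  - by rewrite /= z2 r2 addn1.
  have [|t3 [m4 [ex3 le3 B4 bm4]]] := IH i.+1 m3 _ bm3 I3; first by lia.
  exists (eval_cost m1 (EOp Defs.Sub e (Reg r)) + (t1 + t2) + t3), m4; split=> //.
    apply: ExecWhileTrue ex3; last exact: ExecSeq ex1 ex2.
    by rewrite /= z1 r1 e1; lia.
  move: le3; rewrite Hw -/c1 in le2 *.
  move: (expr_weight (EOp Defs.Sub e (Reg r))) (cmd_weight c1) (cmd_weight body)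
    (bitlen W) (eval_cost m1 _) le le1 le2 => a b c bw q.
  nia.
have -> : n * (k + 2) + 2 = 1 + (n * (k + 2) + 1) by lia.
apply: wp_seq; apply: wp_store => //=; rewrite m0.
by apply: (Hloop n 0) => //; [rewrite addn0|exact: bounded_update].
Qed.

(** * Positional digits *)

Section Digits.
Variables (N : nat) (N0 : 0 < N).

Lemma sum_digits_lt k f : (forall d, d < k -> f d < N) ->
  \sum_(d < k) f d * N ^ d < N ^ k.
Proof.
elim: k => [|k IH] fN; first by rewrite big_ord0.
rewrite big_ord_recr /= expnS.
have h1 := IH (fun d dk => fN d (leqW dk)).
apply: (@leq_trans ((f k).+1 * N ^ k)); first by rewrite mulSn ltn_add2r.
by rewrite leq_mul2r fN ?orbT.
Qed.

Lemma digit_sum k f i : (forall d, d < k -> f d < N) -> i < k ->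
  (\sum_(d < k) f d * N ^ d) %/ N ^ i %% N = f i.
Proof.
elim: k => [|k IH] fN // ik.
rewrite big_ord_recr /= addnC.
have Ni : 0 < N ^ i by rewrite expn_gt0 N0.
move: ik; rewrite ltnS leq_eqVlt => /predU1P [ik|ik].
  subst k; rewrite divnMDl // divn_small ?addn0 ?modn_small ?fN //.
  by apply: sum_digits_lt => d dk; apply: fN; apply: leqW.
have -> : f k * N ^ k = f k * N ^ (k - i.+1) * N * N ^ i.
  by rewrite -2!mulnA -expnS -expnD; congr (_ * _ ^ _); lia.
rewrite divnMDl // modnMDl IH // => d dk; exact/fN/leqW.
Qed.

Lemma sum_digits k x : x < N ^ k -> \sum_(d < k) x %/ N ^ d %% N * N ^ d = x.
Proof.
elim: k x => [|k IH] x; first by rewrite expn0 big_ord0; case: x.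
rewrite expnS mulnC -ltn_divLR // => xk.
rewrite big_ord_recl /= expn0 divn1 muln1.
under eq_bigr => d _.
  rewrite /bump /= add1n expnS divnMA mulnA mulnAC.
over.
by rewrite -big_distrl /= IH // addnC -divn_eq.
Qed.

End Digits.

Definition bit (A i : nat) : nat := A %/ 2 ^ i %% 2.

Lemma bit_le1 A i : bit A i <= 1.
Proof. by rewrite /bit -ltnS ltn_mod. Qed.

Lemma exists_bit s A : 0 < A < 2 ^ s -> exists2 i, i < s & bit A i != 0.
Proof.
move=> /andP [A0 As].
have [/existsP [i Hi]|/existsPn H] := boolP [exists i : 'I_s, bit A i != 0].
  by exists i.
move: A0; rewrite -(sum_digits (isT : 0 < 2) As) big1 // => i _.
by have := H i; rewrite /bit; case: (_ %% 2).
Qed.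

(** * The state graph *)

Section Search.

Variables (s n P : nat) (rx cls : nat -> nat) (K0 : nat) (K : nat -> nat).

Definition dg (x d : nat) : nat := x %/ n.+1 ^ d %% n.+1.

(* The digits of a state: 0,1: the machine is free from time [rx d0 + d1 * P];
   2,3,4: the maximum flow time so far is [rx d2 + d3 * P - rx d4];
   5: number of jobs started; 6+i: the release index of the last replenishment
   of resource i; 6+s+B: the last started job with resource set B.
   Release indices and jobs are numbered from 1; index 0 means none. *)
Definition ndigits := 6 + s + 2 ^ s.
Definition nstates := n.+1 ^ ndigits.
Definition moves_per_job := 2 ^ s + 1.
Definition nmoves := n.+1 * moves_per_job.

Definition avail x := rx (dg x 0) + dg x 1 * P.
Definition flow x := rx (dg x 2) + dg x 3 * P - rx (dg x 4).
(** For [e <= n] this is the lexicographic order by release date and index: an injective refinement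
    of the order of release dates. *)
Definition key e := rx e * n.+1 + e.

(** The release date needs no test of its own: a job requires some resource, and the first conjunct
    for it implies [rx e <= avail x]. The strict key test enforces the order inside the class and
    keeps a job from being started twice. The last two conjuncts leave room for incrementing the
    digits. *)
Definition sched_ok x e :=
  [&& all (fun i => (bit (cls e) i != 0) ==>
                    (rx e <= rx (dg x (6 + i)) <= avail x)) (iota 0 s),
      all (fun B => (cls e == B) ==> (key (dg x (6 + s + B)) < key e))
          (iota 0 (2 ^ s)),
      dg x 5 < n & dg x 1 < n].
(** Comparing with all resources, not only the replenished ones, makes the dates of replenishments
    strictly increase along a path. The machine time is not consulted; readiness is decided when a
    job is started. *)
Definition repl_ok x e := all (fun i => rx (dg x (6 + i)) < rx e) (iota 0 s).
Definition idle_ok x e := avail x <= rx e.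

(** A move is [e * moves_per_job + A], where [A = 0] starts job [e], [0 < A < 2 ^ s] replenishes the
    set coded by [A] at the release date of [e], and [A = 2 ^ s] idles until that date. A move
    failing its test, such as move 0, changes no digit and costs nothing. *)
Definition job y := y %/ moves_per_job.
Definition kind y := y %% moves_per_job.

Definition is_sched x y := [&& job y != 0, kind y == 0 & sched_ok x (job y)].
Definition is_repl x y :=
  [&& job y != 0, 0 < kind y < 2 ^ s & repl_ok x (job y)].
Definition is_idle x y :=
  [&& job y != 0, kind y == 2 ^ s & idle_ok x (job y)].

Definition raises_flow x y :=
  is_sched x y && (flow x < avail x + P - rx (job y)).

(** A job that raises the maximum flow completes at [avail x + P], which is [rx d0 + (d1 + 1) * P]
    in the old digits [d0] and [d1]; these two and the job become digits 2, 3 and 4. *)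
Definition new_digit x y d :=
  if d == 0 then if is_idle x y then job y else dg x d
  else if d == 1 then
    if is_sched x y then (dg x d).+1 else if is_idle x y then 0 else dg x d
  else if d == 2 then if raises_flow x y then dg x 0 else dg x d
  else if d == 3 then if raises_flow x y then (dg x 1).+1 else dg x d
  else if d == 4 then if raises_flow x y then job y else dg x d
  else if d == 5 then if is_sched x y then (dg x d).+1 else dg x d
  else if d < 6 + s then
    if is_repl x y && (bit (kind y) (d - 6) != 0) then job y else dg x d
  else if is_sched x y && (cls (job y) == d - (6 + s)) then job y else dg x d.

Definition next_state x y := \sum_(d < ndigits) new_digit x y d * n.+1 ^ d.

Definition set_cost A := K0 + \sum_(i < s) bit A i * K i.
Definition move_cost x y := if is_repl x y then set_cost (kind y) else 0.
(** The successor separates a zero flow, which occurs when there are no jobs, from the 0 that marks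
    an unfinished state. *)
Definition final_value x := if dg x 5 == n then (flow x).+1 else 0.

Lemma dg_lt x d : dg x d < n.+1.
Proof. by rewrite ltn_mod. Qed.

Lemma job_lt y : y < nmoves -> job y < n.+1.
Proof. by move=> yY; rewrite /job ltn_divLR // /moves_per_job addn1. Qed.

Lemma new_digit_lt x y d : y < nmoves -> new_digit x y d < n.+1.
Proof.
move=> /job_lt jn; rewrite /new_digit.
have D := dg_lt x.
have S1 : is_sched x y -> dg x 5 < n /\ dg x 1 < n.
  by case/and3P=> _ _ /and4P [].
have S2 : raises_flow x y -> dg x 5 < n /\ dg x 1 < n by case/andP=> /S1.
repeat (case: eqP => [->|_]);
  repeat (case: ifP => //; try (by move=> /S1 []); try (by move=> /S2 [])).
Qed.

Lemma next_lt x y : y < nmoves -> next_state x y < nstates.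
Proof. by move=> yY; apply: sum_digits_lt => // d _; apply: new_digit_lt. Qed.

Lemma dg_next x y d : y < nmoves -> d < ndigits ->
  dg (next_state x y) d = new_digit x y d.
Proof.
by move=> yY dk; rewrite /dg digit_sum // => d' _; apply: new_digit_lt.
Qed.

(** * Cheapest paths by dynamic programming *)

Fixpoint path_cost x ys :=
  if ys is y :: ys' then move_cost x y + path_cost (next_state x y) ys' else 0.

(** In [f y] and in [acc.1] alike, 0 means infinity, so [(0, 0)] is the minimum over no moves. *)
Definition relax (f g : nat -> nat) (acc : nat * nat) y :=
  if (f y != 0) && ((acc.1 == 0) || (f y + g y < acc.1)) then (f y + g y, y)
  else acc.

Lemma relaxP f g k (acc := foldl (relax f g) (0, 0) (iota 0 k)) :
  (forall y, y < k -> f y != 0 -> 0 < acc.1 <= f y + g y) /\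
  (acc.1 != 0 -> [/\ acc.2 < k, f acc.2 != 0 & acc.1 = f acc.2 + g acc.2]).
Proof.
rewrite {}/acc; elim: k => [|k [IH1 IH2]]; first by split.
rewrite -addn1 iotaD foldl_cat /= add0n.
set acc := foldl _ _ _ in IH1 IH2 *; rewrite /relax.
case: ifP => [/andP [fk hk]|hk].
  split=> /= [y|_]; last by rewrite addn1 ltnSn.
  rewrite addn1 ltnS leq_eqVlt => /predU1P [-> _|yk fy]; first by lia.
  have := IH1 y yk fy; lia.
split=> [y|/IH2 [h1 h2 h3]]; last by split=> //; lia.
rewrite addn1 ltnS leq_eqVlt => /predU1P [-> fk|]; last exact: IH1.
by rewrite fk in hk; lia.
Qed.

(* The optimal value (0 stands for infinity) and a first move of an optimal path
   of [l] moves. *)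
Fixpoint entry l x : nat * nat :=
  if l is l'.+1 then
    foldl (relax (fun y => (entry l' (next_state x y)).1) (move_cost x)) (0, 0)
      (iota 0 nmoves)
  else (final_value x, 0).

Lemma entry_bound B C l x : (forall x, final_value x <= B) ->
  (forall x y, move_cost x y <= C) -> (entry l x).1 <= B + l * C.
Proof.
move=> hB hC; elim: l x => [|l IH] x; first by rewrite addn0 hB.
have [_ h] := relaxP (fun y => (entry l (next_state x y)).1) (move_cost x) nmoves.
have [->//|/h [_ _]] := eqVneq (entry l.+1 x).1 0.
rewrite -/(entry l.+1 x) => ->.
by have := IH (next_state x (entry l.+1 x).2); have := hC x (entry l.+1 x).2; lia.
Qed.

Lemma entry_le_path ys x :
  all (fun y => y < nmoves) ys -> final_value (foldl next_state x ys) != 0 ->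
  0 < (entry (size ys) x).1 <= final_value (foldl next_state x ys) + path_cost x ys.
Proof.
elim: ys x => [|y ys IH] x; first by rewrite /= addn0 leqnn lt0n andbT.
case/andP=> yY allY fin.
have /andP [h1 h2] := IH (next_state x y) allY fin.
have [H _] := relaxP (fun y => (entry (size ys) (next_state x y)).1) (move_cost x) nmoves.
have /andP [h3 h4] := H y yY (lt0n_neq0 h1).
by rewrite /= h3 /=; apply: leq_trans h4 _; lia.
Qed.

Lemma entry_step l x (y := (entry l.+1 x).2) : (entry l.+1 x).1 != 0 ->
  [/\ y < nmoves, (entry l (next_state x y)).1 != 0 &
      (entry l.+1 x).1 = (entry l (next_state x y)).1 + move_cost x y].
Proof.
by have [_] := relaxP (fun y => (entry l (next_state x y)).1) (move_cost x) nmoves.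
Qed.

Hypotheses (rx0 : rx 0 = 0) (rx_gt0 : forall e, 0 < e <= n -> 0 < rx e).
Hypothesis (cls_lt : forall e, 0 < e <= n -> 0 < cls e < 2 ^ s).
Hypothesis (P0 : 0 < n -> 0 < P).

Lemma sched_cases x y : is_sched x y ->
  (is_repl x y = false) * (is_idle x y = false).
Proof.
case/and3P=> _ /eqP k0 _; rewrite /is_repl /is_idle k0 /= andbF.
by rewrite [0 == _]eq_sym expn_eq0 /= andbF.
Qed.

Lemma repl_cases x y : is_repl x y ->
  (is_sched x y = false) * (is_idle x y = false).
Proof.
case/and3P=> _ /andP [k0 k1] _; rewrite /is_sched /is_idle.
by rewrite (gtn_eqF k0) (ltn_eqF k1) !andbF.
Qed.

Lemma idle_cases x y : is_idle x y ->
  (is_sched x y = false) * (is_repl x y = false).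
Proof.
move=> H; split; apply/negbTE/negP.
  by move=> /sched_cases []; rewrite H.
by move=> /repl_cases []; rewrite H.
Qed.

Lemma lt_ndigits i : i < s -> 6 + i < ndigits.
Proof. by move=> is_; rewrite /ndigits; lia. Qed.

Lemma new_digit_res x y i : i < s -> new_digit x y (6 + i) =
  if is_repl x y && (bit (kind y) i != 0) then job y else dg x (6 + i).
Proof. by move=> is_; rewrite /new_digit /= ltn_add2l is_ addKn. Qed.

Lemma new_digit_cls x y B : new_digit x y (6 + s + B) =
  if is_sched x y && (cls (job y) == B) then job y else dg x (6 + s + B).
Proof.
by rewrite /new_digit addKn (leq_gtF (leq_addr B (6 + s))).
Qed.

Section Step.
Variables (x y : nat) (yY : y < nmoves).

Let dgE d : d < ndigits -> dg (next_state x y) d = new_digit x y d.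
Proof. exact: dg_next. Qed.

Let resE i : i < s -> dg (next_state x y) (6 + i) =
  if is_repl x y && (bit (kind y) i != 0) then job y else dg x (6 + i).
Proof. by move=> is_; rewrite dgE ?lt_ndigits // new_digit_res. Qed.

Let clsE B : B < 2 ^ s -> dg (next_state x y) (6 + s + B) =
  if is_sched x y && (cls (job y) == B) then job y else dg x (6 + s + B).
Proof. by move=> Bs; rewrite dgE ?ltn_add2l // new_digit_cls. Qed.

Lemma next_sched : is_sched x y ->
  [/\ avail (next_state x y) = avail x + P,
      flow (next_state x y) = maxn (flow x) (avail x + P - rx (job y)),
      dg (next_state x y) 5 = (dg x 5).+1 /\ dg (next_state x y) 1 = (dg x 1).+1,
      forall i, i < s -> dg (next_state x y) (6 + i) = dg x (6 + i)
    & forall B, B < 2 ^ s -> dg (next_state x y) (6 + s + B) =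
        if cls (job y) == B then job y else dg x (6 + s + B)].
Proof.
move=> H; have [nr ni] := sched_cases H.
split; last by move=> B /clsE ->; rewrite H.
- by rewrite /avail !dgE // /new_digit /= H ni mulSn; lia.
- rewrite {1}/flow !dgE // /new_digit /= /raises_flow H /=.
  case: (ltnP (flow x) (avail x + P - rx (job y))) => h //.
  by rewrite mulSn /avail; lia.
- by rewrite !dgE // /new_digit /= H.
- by move=> i /resE ->; rewrite nr.
Qed.

Lemma next_repl : is_repl x y ->
  [/\ avail (next_state x y) = avail x, flow (next_state x y) = flow x,
      dg (next_state x y) 5 = dg x 5 /\ dg (next_state x y) 1 = dg x 1,
      forall i, i < s -> dg (next_state x y) (6 + i) =
        if bit (kind y) i != 0 then job y else dg x (6 + i)
    & forall B, B < 2 ^ s -> dg (next_state x y) (6 + s + B) = dg x (6 + s + B)].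
Proof.
move=> H; have [ns ni] := repl_cases H.
split; last by move=> B /clsE ->; rewrite ns.
- by rewrite /avail !dgE // /new_digit /= ns ni.
- by rewrite /flow !dgE // /new_digit /= /raises_flow ns.
- by rewrite !dgE // /new_digit /= ns ni.
- by move=> i /resE ->; rewrite H.
Qed.

Lemma next_idle : is_idle x y ->
  [/\ avail (next_state x y) = rx (job y), flow (next_state x y) = flow x,
      dg (next_state x y) 5 = dg x 5 /\ dg (next_state x y) 1 = 0,
      forall i, i < s -> dg (next_state x y) (6 + i) = dg x (6 + i)
    & forall B, B < 2 ^ s -> dg (next_state x y) (6 + s + B) = dg x (6 + s + B)].
Proof.
move=> H; have [ns nr] := idle_cases H.
split; last by move=> B /clsE ->; rewrite ns.
- by rewrite /avail !dgE // /new_digit /= ns H addn0.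
- by rewrite /flow !dgE // /new_digit /= /raises_flow ns.
- by rewrite !dgE // /new_digit /= ns H.
- by move=> i /resE ->; rewrite nr.
Qed.

Lemma next_none : is_sched x y = false -> is_repl x y = false ->
  is_idle x y = false -> forall d, d < ndigits -> dg (next_state x y) d = dg x d.
Proof.
move=> ns nr ni d dk; rewrite dgE // /new_digit /raises_flow ns nr ni /=.
by do !case: ifP.
Qed.

End Step.

(** * Soundness: paths describe feasible schedules *)

Implicit Types Js Qs : seq (nat * nat).

(* [Js] lists the started jobs with their starting times, [Qs] the
   replenishments (resource set, release index), both in order of execution. *)
Definition sound x Js Qs :=
  [/\ [/\ size Js = dg x 5, uniq (unzip1 Js) &
       forall e t e' t', (e, t) \in Js -> (e', t') \in Js -> e != e' ->
         (t + P <= t') || (t' + P <= t)],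
      forall e t, (e, t) \in Js ->
        [/\ 0 < e <= n, key e <= key (dg x (6 + s + cls e)),
            rx e <= t /\ t + P <= avail x, t + P <= rx e + flow x &
            forall i, i < s -> bit (cls e) i != 0 ->
            exists A e', [/\ (A, e') \in Qs, bit A i != 0 & rx e <= rx e' <= t]],
      forall i, i < s -> dg x (6 + i) = 0 \/
        exists2 A, (A, dg x (6 + i)) \in Qs & bit A i != 0,
      forall A e, (A, e) \in Qs -> [/\ 0 < A < 2 ^ s, 0 < e <= n &
        exists2 i, i < s & rx e <= rx (dg x (6 + i))]
    & sorted ltn [seq rx q.2 | q <- Qs]].

Definition add_job x y Js := if is_sched x y then rcons Js (job y, avail x) else Js.
Definition add_repl x y Qs := if is_repl x y then rcons Qs (kind y, job y) else Qs.

Lemma sum_add_repl x y Qs : \sum_(q <- add_repl x y Qs) set_cost q.1 =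
  \sum_(q <- Qs) set_cost q.1 + move_cost x y.
Proof.
rewrite /add_repl /move_cost; case: ifP => _; last by rewrite addn0.
by rewrite -cats1 big_cat big_seq1.
Qed.

Lemma dg0 d : dg 0 d = 0.
Proof. by rewrite /dg div0n mod0n. Qed.

Lemma sound0 : sound 0 [::] [::].
Proof. by split=> // i _; left; rewrite dg0. Qed.

Lemma sorted_rcons_ltn (l : seq nat) a :
  sorted ltn l -> {in l, forall b, b < a} -> sorted ltn (rcons l a).
Proof.
case: l => [|b l] //= pl h; rewrite rcons_path pl /=.
by apply: h; apply: mem_last.
Qed.

Lemma sound_next x y Js Qs : y < nmoves -> sound x Js Qs ->
  sound (next_state x y) (add_job x y Js) (add_repl x y Qs).
Proof.
move=> yY [[szJ uJ noJ] HJ HU HQ sQ]; rewrite /add_job /add_repl.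
have jn : job y <= n by have := job_lt yY; rewrite ltnS.
have [Hs|ns] := boolP (is_sched x y).
  have [nr ni] := sched_cases Hs; rewrite nr.
  have [av fl [d5 d1] res cl] := next_sched yY Hs.
  have /and3P [e0 _ /and4P [/allP ok1 /allP ok2 lt5 lt1]] := Hs.
  set e := job y in e0 jn fl cl ok1 ok2 *.
  have e1n : 0 < e <= n by rewrite lt0n e0.
  have /andP [c0 c1] := cls_lt e1n.
  have kc : key (dg x (6 + s + cls e)) < key e.
    by have := ok2 (cls e); rewrite mem_iota add0n c1 eqxx => /(_ isT).
  have oki i : i < s -> bit (cls e) i != 0 ->
      rx e <= rx (dg x (6 + i)) <= avail x.
    by move=> is_ b; have := ok1 i; rewrite mem_iota add0n is_ b => /(_ isT).
  have et : rx e <= avail x.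
    have [i is_ b] := exists_bit (cls_lt e1n).
    by case/andP: (oki i is_ b) => a /(leq_trans a).
  (* The class digit carries the largest key among the started jobs of the class, and the test puts
     it strictly below [key e]. *)
  have eJ t : (e, t) \in Js -> False.
    by move=> /HJ [_ ke _ _ _]; move: kc; rewrite ltnNge ke.
  split=> //.
  - split.
    + by rewrite size_rcons szJ d5.
    + rewrite /unzip1 map_rcons rcons_uniq uJ andbT.
      by apply/negP => /mapP [[e' t] /= h ee]; apply: (eJ t); rewrite ee.
    + move=> e1 t1 e2 t2; rewrite !mem_rcons !inE.
      case/predU1P=> [[-> ->]|h1]; case/predU1P=> [[-> ->]|h2].
      * by rewrite eqxx.
      * by move=> _; have [_ _ [_ ->] _ _] := HJ _ _ h2; rewrite orbT.
      * by move=> _; have [_ _ [_ ->] _ _] := HJ _ _ h1.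
      * exact: noJ h1 h2.
  - move=> e1 t1; rewrite mem_rcons inE => /predU1P [[-> ->]|h].
      split=> //.
      + by rewrite cl // eqxx.
      + by rewrite av.
      + by rewrite fl; lia.
      + move=> i is_ b; have /andP [o1 o2] := oki i is_ b.
        (* A resource never replenished has digit 0, hence date [rx 0 = 0], which cannot reach the
           positive [rx e]. *)
        have [z|[A AQ bA]] := HU i is_.
          by move: o1; rewrite z rx0 leqNgt rx_gt0.
        by exists A, (dg x (6 + i)); rewrite o1 o2.
    have [h1 h2 [h3 h4] h5 h6] := HJ _ _ h; split=> //.
    + have /andP [_ c2] := cls_lt h1; rewrite cl //.
      by case: eqP => // ec; apply: leq_trans (ltnW kc); rewrite -?ec // ec.
    + by rewrite av; lia.
    + by rewrite fl; lia.
  - by move=> i is_; rewrite res //; apply: HU.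
  - move=> A e' /HQ [h1 h2 [i is_ h3]]; split=> //; exists i => //.
    by rewrite res.
have [Hr|nr] := boolP (is_repl x y).
  have [av fl [d5 d1] res cl] := next_repl yY Hr.
  have /and3P [e0 kA /allP ok] := Hr.
  set e := job y in e0 jn ok res *.
  have e1n : 0 < e <= n by rewrite lt0n e0.
  have oki i : i < s -> rx (dg x (6 + i)) < rx e.
    by move=> is_; apply: ok; rewrite mem_iota.
  have [i0 is0 bi0] := exists_bit kA.
  split.
  - by split=> //; rewrite d5.
  - move=> e1 t1 h; have [h1 h2 [h3 h4] h5 h6] := HJ _ _ h; split=> //.
    + by have /andP [_ c2] := cls_lt h1; rewrite cl.
    + by rewrite av.
    + by rewrite fl.
    + move=> i is_ b; have [A [e' [q1 q2 q3]]] := h6 i is_ b.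
      by exists A, e'; rewrite mem_rcons inE q1 orbT.
  - move=> i is_; rewrite res //; case: ifP => b.
      by right; exists (kind y) => //; rewrite mem_rcons inE eqxx.
    have [->|[A AQ bA]] := HU i is_; first by left.
    by right; exists A; rewrite // mem_rcons inE AQ orbT.
  - move=> A e'; rewrite mem_rcons inE => /predU1P [[-> ->]|h].
      by split=> //; exists i0 => //; rewrite res // bi0.
    have [h1 h2 [i is_ h3]] := HQ _ _ h; split=> //; exists i => //.
    rewrite res //; case: ifP => // _.
    by apply: ltnW; apply: leq_ltn_trans h3 (oki i is_).
  - rewrite map_rcons; apply: sorted_rcons_ltn => // b /mapP [[A e'] h ->] /=.
    by have [_ _ [i is_ h3]] := HQ _ _ h; apply: leq_ltn_trans h3 (oki i is_).
(* Idle moves and moves that fail their test record nothing; the only change visible to [sound] is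
   that the machine may become free later. *)
have HJ' : avail x <= avail (next_state x y) -> flow (next_state x y) = flow x ->
    dg (next_state x y) 5 = dg x 5 ->
    (forall i, i < s -> dg (next_state x y) (6 + i) = dg x (6 + i)) ->
    (forall B, B < 2 ^ s -> dg (next_state x y) (6 + s + B) = dg x (6 + s + B)) ->
    sound (next_state x y) Js Qs.
  move=> av fl d5 res cl; split=> //.
  - by split=> //; rewrite d5.
  - move=> e1 t1 h; have [h1 h2 [h3 h4] h5 h6] := HJ _ _ h; split=> //.
    + by have /andP [_ c2] := cls_lt h1; rewrite cl.
    + by split=> //; apply: leq_trans av.
    + by rewrite fl.
  - by move=> i is_; rewrite res //; apply: HU.
  - move=> A e' /HQ [h1 h2 [i is_ h3]]; split=> //; exists i => //.
    by rewrite res.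
have [Hi|ni] := boolP (is_idle x y).
  have [av fl [d5 d1] res cl] := next_idle yY Hi.
  by apply: HJ' => //; rewrite av; case/and3P: Hi.
have same := next_none yY (negbTE ns) (negbTE nr) (negbTE ni).
apply: HJ'; rewrite /avail /flow ?same //.
- by move=> i is_; rewrite same // lt_ndigits.
- by move=> B Bs; rewrite same // ltn_add2l.
Qed.

(** Strictly increasing dates belong to distinct release indices, of which there are [n]. This
    bounds the space needed for the output. *)
Lemma sound_size_repl x Js Qs : sound x Js Qs -> size Qs <= n.
Proof.
move=> [_ _ _ HQ sQ].
have u : uniq [seq q.2 | q <- Qs].
  apply: (@map_uniq _ _ rx); rewrite -map_comp.
  exact: (sorted_uniq ltn_trans ltnn sQ).
rewrite -(size_map snd) -[X in _ <= X](size_iota 1 n); apply: uniq_leq_size => // e.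
move=> /mapP [[A e'] /HQ [_ h _] ->] /=.
by rewrite mem_iota add1n ltnS.
Qed.

(** * Completeness: paths that follow a given schedule *)

Definition move e A := e * moves_per_job + A.

Lemma job_move e A : A < moves_per_job -> job (move e A) = e.
Proof.
by move=> Am; rewrite /job divnMDl ?divn_small ?addn0 //; apply: leq_ltn_trans Am.
Qed.

Lemma kind_move e A : A < moves_per_job -> kind (move e A) = A.
Proof. by move=> Am; rewrite /kind modnMDl modn_small. Qed.

Lemma move_lt e A : e <= n -> A < moves_per_job -> move e A < nmoves.
Proof.
move=> en Am; rewrite /move /nmoves.
apply: (@leq_trans (e.+1 * moves_per_job)); first by rewrite mulSn addnC ltn_add2r.
by rewrite leq_mul2r ltnS en orbT.
Qed.

Section Simulation.
Variables (S : nat -> rat) (F : rat) (G : nat -> nat).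
Local Open Scope ring_scope.

Hypothesis flow_le : forall e, (0 < e <= n)%N -> S e + P%:R - (rx e)%:R <= F.
Hypothesis fifo : forall e e', (0 < e <= n)%N -> (0 < e' <= n)%N ->
  cls e = cls e' -> S e < S e' -> (key e < key e')%N.

(** [esd] and [jsd] are the replenishments and jobs already carried out, [es] and [js] the remaining
    ones by increasing time; [G e] codes the set replenished at the date of [e]. The times [S] are
    not reproduced: [sim_avail] only keeps the machine ahead of them, and [sim_early] ensures that
    waiting for a replenishment already made does not lose this lead. *)
Record simulates x (esd es jsd js : seq nat) : Prop := Simulates {
  sim_res : forall i, (i < s)%N -> dg x (6 + i) = 0%N \/ dg x (6 + i) \in esd;
  sim_bit : forall e i, e \in esd -> (i < s)%N -> bit (G e) i != 0%N ->
    (rx e <= rx (dg x (6 + i)))%N;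
  sim_cls : forall B, (B < 2 ^ s)%N -> dg x (6 + s + B) = 0%N \/
    dg x (6 + s + B) \in jsd /\ cls (dg x (6 + s + B)) = B;
  sim_cnt : [/\ dg x 5 = size jsd, (size jsd + size js)%N = n
              & (dg x 1 <= dg x 5)%N];
  sim_avail : forall e, e \in js -> (avail x)%:R <= S e;
  sim_flow : (flow x)%:R <= F;
  sim_sep : forall e e', e \in esd -> e' \in es -> (rx e < rx e')%N;
  sim_early : forall e e', e \in esd -> e' \in js -> (rx e)%:R <= S e';
  sim_order : forall e e', e \in jsd -> e' \in js -> S e < S e';
  sim_ready : forall e i, e \in js -> (i < s)%N -> bit (cls e) i != 0%N ->
    exists e', [/\ e' \in esd ++ es, bit (G e') i != 0%N, (rx e <= rx e')%N
                 & (rx e')%:R <= S e];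
  sim_dom : [/\ {in esd, forall e, 0 < e <= n}%N,
     {in es, forall e, 0 < e <= n /\ 0 < G e < 2 ^ s}%N,
     {in jsd, forall e, 0 < e <= n}%N & {in js, forall e, 0 < e <= n}%N];
  sim_es : pairwise (fun e e' => (rx e < rx e')%N) es;
  sim_js : pairwise (fun e e' => S e + P%:R <= S e') js
}.

Lemma simulates_repl x esd e es jsd j js :
  simulates x esd (e :: es) jsd (j :: js) -> (rx e)%:R <= S j ->
  is_repl x (move e (G e)) /\
  simulates (next_state x (move e (G e))) (e :: esd) es jsd (j :: js).
Proof.
move=> [res bt cl cnt av fl sep early ord rdy [d1 d2 d3 d4] pes pjs] ej.
have [e1n Ge] := d2 _ (mem_head e es); have /andP [G0 G1] := Ge.
have Gm : (G e < moves_per_job)%N by rewrite /moves_per_job addn1 leqW.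
have /andP [e0 en] := e1n.
have yY := move_lt en Gm.
have ok : is_repl x (move e (G e)).
  rewrite /is_repl job_move // kind_move // -lt0n e0 Ge /=.
  apply/allP => i; rewrite mem_iota add0n => /andP [_ is_].
  have [->|h] := res i is_; first by rewrite rx0 rx_gt0.
  by apply: sep => //; rewrite mem_head.
split=> //; have [av' fl' [d5' d1'] res' cl'] := next_repl yY ok.
rewrite kind_move // in res'; rewrite job_move // in res'.
move: pes pjs => /= /andP [/allP pe pes] pjs.
split=> //.
- move=> i is_; rewrite res' //; case: ifP => _; first by right; rewrite mem_head.
  by have [->|h] := res i is_; [left|right; rewrite inE h orbT].
- move=> e' i; rewrite inE => /predU1P [->|h] is_ b; rewrite res' //.
    by rewrite b.
  case: ifP => _; last exact: bt.
  by apply: ltnW; apply: sep => //; rewrite mem_head.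
- by move=> B Bs; rewrite cl' //; apply: cl.
- by rewrite d5' d1'.
- by move=> e'; rewrite av'; apply: av.
- by rewrite fl'.
- move=> e1 e2; rewrite inE => /predU1P [->|h] h2; first exact: pe.
  by apply: sep => //; rewrite inE h2 orbT.
- move=> e1 e2; rewrite inE => /predU1P [->|h] h2; last exact: early.
  move: h2; rewrite inE => /predU1P [->|h2] //.
  case/andP: pjs => /allP pj _; apply: (le_trans ej).
  by apply: le_trans (pj _ h2); rewrite lerDl ler0n.
- move=> e1 i h1 is_ b; have [e' [q1 q2 q3 q4]] := rdy e1 i h1 is_ b.
  exists e'; split=> //; move: q1; rewrite !mem_cat !inE.
  by case/or3P=> ->; rewrite ?orbT.
- split=> //.
  + by move=> e1; rewrite inE => /predU1P [->|/d1].
  + by move=> e1 h; apply: d2; rewrite inE h orbT.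
Qed.

Lemma simulates_idle x esd es jsd js e :
  simulates x esd es jsd js -> e \in esd -> (avail x <= rx e)%N ->
  [/\ is_idle x (move e (2 ^ s)), avail (next_state x (move e (2 ^ s))) = rx e,
      forall i, (i < s)%N -> dg (next_state x (move e (2 ^ s))) (6 + i) = dg x (6 + i)
    & simulates (next_state x (move e (2 ^ s))) esd es jsd js].
Proof.
move=> [res bt cl [c1 c2 c3] av fl sep early ord rdy [d1 d2 d3 d4] pes pjs] ee ave.
have Gm : (2 ^ s < moves_per_job)%N by rewrite /moves_per_job addn1.
have /andP [e0 en] := d1 e ee.
have yY := move_lt en Gm.
have ok : is_idle x (move e (2 ^ s)).
  by rewrite /is_idle job_move // kind_move // -lt0n e0 eqxx.
have [av' fl' [d5' d1'] res' cl'] := next_idle yY ok.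
rewrite job_move // in av'.
split=> //; split=> //.
- by move=> i is_; rewrite res' //; apply: res.
- by move=> e' i h is_ b; rewrite res' //; apply: bt.
- by move=> B Bs; rewrite cl' //; apply: cl.
- by rewrite d5' d1'.
- by move=> e' h; rewrite av'; apply: early.
- by rewrite fl'.
Qed.

Lemma simulates_sched x esd es jsd j js :
  simulates x esd es jsd (j :: js) ->
  (forall i, (i < s)%N -> bit (cls j) i != 0%N ->
     (rx j <= rx (dg x (6 + i)) <= avail x)%N) ->
  is_sched x (move j 0) /\ simulates (next_state x (move j 0)) esd es (j :: jsd) js.
Proof.
move=> [res bt cl [c1 c2 c3] av fl sep early ord rdy [d1 d2 d3 d4] pes pjs] okj.
have Gm : (0 < moves_per_job)%N by rewrite /moves_per_job addn1.
have j1n := d4 _ (mem_head j js); have /andP [j0 jn] := j1n.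
have yY := move_lt jn Gm.
have /andP [cj0 cj1] := cls_lt j1n.
have ok : is_sched x (move j 0).
  rewrite /is_sched job_move // kind_move // -lt0n j0 /=.
  move: c2 => /= c2.
  apply/and4P; split; [| |lia|lia].
    apply/allP => i; rewrite mem_iota add0n => /andP [_ is_].
    by apply/implyP => b; apply: okj.
  apply/allP => B; rewrite mem_iota add0n => /andP [_ Bs].
  apply/implyP => /eqP cB; have [->|[h hB]] := cl B Bs.
    by rewrite /key rx0; lia.
  apply: fifo => //; [exact: d3|by rewrite hB cB|].
  by apply: ord => //; rewrite mem_head.
split=> //; have [av' fl' [d5' d1'] res' cl'] := next_sched yY ok.
rewrite job_move // in fl' cl'.
have jav : (avail x)%:R <= S j by apply: av; rewrite mem_head.
move: pjs => /= /andP [/allP pj pjs].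
have sub e : e \in js -> e \in j :: js by rewrite inE orbC => ->.
split=> //.
- by move=> i is_; rewrite res' //; apply: res.
- by move=> e' i h is_ b; rewrite res' //; apply: bt.
- move=> B Bs; rewrite cl' //; case: eqP => [<-|_].
    by right; rewrite mem_head.
  by have [->|[h hB]] := cl B Bs; [left|right; rewrite inE h orbT].
- by move: c2 => /=; rewrite d5' d1'; split; lia.
- move=> e' h; rewrite av' natrD; apply: le_trans (pj _ h).
  by rewrite lerD2r.
- rewrite fl' natr_max ge_max fl /=; apply: le_trans (flow_le j1n).
  (* A required resource yields [rx j <= avail x], so the truncated subtraction in the flow is
     exact. *)
  have [i is_ b] := exists_bit (cls_lt j1n).
  have /andP [o1 o2] := okj i is_ b.
  by rewrite natrB; [rewrite natrD !lerD2r|lia].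
- by move=> e1 e2 h1 h2; apply: early => //; apply: sub.
- move=> e1 e2; rewrite inE => /predU1P [->|h] h2; last by apply: ord; rewrite ?sub.
  apply: lt_le_trans (pj _ h2); rewrite ltrDl ltr0n; apply: P0; lia.
- by move=> e1 i h1; apply: rdy; apply: sub.
- split=> //.
  + by move=> e1; rewrite inE => /predU1P [->|/d3].
  + by move=> e1 h; apply: d4; apply: sub.
Qed.

(** The two lists are merged: the next replenishment is made if it is due by the start of the next
    job, otherwise that job is started after at most one idle move, hence two moves per job.
    Replenishments left over after the last job are dropped, which only lowers the cost. *)
Lemma simulates_path k x esd es jsd js : (size es + size js <= k)%N ->
  simulates x esd es jsd js ->
  exists ys, [/\ (size ys <= size es + 2 * size js)%N,
    all (fun y => y < nmoves)%N ys, dg (foldl next_state x ys) 5 = n,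
    (flow (foldl next_state x ys))%:R <= F
  & (path_cost x ys <= \sum_(e <- es) set_cost (G e))%N].
Proof.
elim: k x esd es jsd js => [|k IH] x esd es jsd [|j js] sz sim.
1,3: by exists [::]; have [c1 c2 c3] := sim_cnt sim;
  have := sim_flow sim; rewrite /= in c2 *; split=> //; lia.
  by move: sz => /=; rewrite addnS.
have Qm : (0 < moves_per_job)%N by rewrite /moves_per_job addn1.
have Im : (2 ^ s < moves_per_job)%N by rewrite /moves_per_job addn1.
(* All remaining replenishments come after [S j], so those that make [j] ready have already been
   made. *)
have sched_case : (forall e, e \in es -> S j < (rx e)%:R) ->
  exists ys, [/\ (size ys <= size es + 2 * size (j :: js))%N,
    all (fun y => y < nmoves)%N ys, dg (foldl next_state x ys) 5 = n,
    (flow (foldl next_state x ys))%:R <= F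
  & (path_cost x ys <= \sum_(e <- es) set_cost (G e))%N].
  move=> late.
  have [_ _ _ d4] := sim_dom sim.
  have j1n := d4 _ (mem_head j js); have /andP [j0 jn] := j1n.
  have rj i : (i < s)%N -> bit (cls j) i != 0%N ->
      (rx j <= rx (dg x (6 + i)))%N /\ dg x (6 + i) \in esd.
    move=> is_ b.
    have [e' [q1 q2 q3 q4]] := sim_ready sim (mem_head j js) is_ b.
    have ed : e' \in esd.
      move: q1; rewrite mem_cat => /orP [//|/late].
      by rewrite ltNge q4.
    have := leq_trans q3 (sim_bit sim ed is_ q2) => h; split=> //.
    by have [z|//] := sim_res sim is_; move: h; rewrite z rx0 leqNgt rx_gt0.
  (* At most one idle move brings the machine to a time when [j] is ready. *)
  have [x' [ys0 [szy ally xE cost0 [sim' ok']]]] : exists x' ys0,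
      [/\ (size ys0 <= 1)%N, all (fun y => y < nmoves)%N ys0,
          foldl next_state x ys0 = x', path_cost x ys0 = 0%N
        & simulates x' esd es jsd (j :: js) /\
      forall i, (i < s)%N -> bit (cls j) i != 0%N ->
         (rx j <= rx (dg x' (6 + i)) <= avail x')%N].
    have [i0 is0 b0] := exists_bit (cls_lt j1n).
    pose p (i : 'I_s) := bit (cls j) i != 0%N.
    have p0 : p (Ordinal is0) by [].
    (* The latest among the last replenishments of the resources required by [j] is the only date
       worth waiting for. *)
    case: (arg_maxnP (fun i : 'I_s => rx (dg x (6 + i))) p0) => im pm im_max.
    have [r1 r2] := rj im (ltn_ord im) pm.
    have [le|lt] := leqP (rx (dg x (6 + im))) (avail x).
      exists x, [::]; split=> //; split=> // i is_ b.
      have [-> _] := rj i is_ b; apply: leq_trans le.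
      exact: (im_max (Ordinal is_)).
    have [a1 a2 a3 a4] := simulates_idle sim r2 (ltnW lt).
    have [d1 _ _ _] := sim_dom sim; have /andP [_ en] := d1 _ r2.
    eexists _, [:: _]; split; [by [] | |by []| |split; first exact: a4].
    - by rewrite /= move_lt.
    - by rewrite /= /move_cost (idle_cases a1).2.
    - move=> i is_ b; rewrite a3 // a2.
      by have [-> _] := rj i is_ b; exact: (im_max (Ordinal is_)).
  have [sch sim2] := simulates_sched sim' ok'.
  have [|ys [y1 y2 y3 y4 y5]] := IH _ _ _ _ _ _ sim2; first by move: sz => /=; lia.
  exists (ys0 ++ move j 0 :: ys); split.
  - by rewrite size_cat /= in y1 *; lia.
  - by rewrite all_cat ally /= y2 move_lt.
  - by rewrite foldl_cat xE.
  - by rewrite foldl_cat xE.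
  - have pc l : path_cost x (l ++ move j 0 :: ys) =
        (path_cost x l + path_cost (foldl next_state x l) (move j 0 :: ys))%N.
      elim: l (x) => [|y l IHl] x1 //=.
      by rewrite IHl addnA.
    by rewrite pc cost0 xE /= /move_cost (sched_cases sch).1.
have [es0|e0] := eqVneq es [::].
  by apply: sched_case; rewrite es0.
case: es e0 sz sim sched_case => [//|e es] _ sz sim sched_case.
have [ej|je] := leP (rx e)%:R (S j); last first.
  apply: sched_case => e'; rewrite inE => /predU1P [->//|h].
  have /= /andP [/allP pe _] := sim_es sim.
  by apply: (lt_trans je); rewrite ltr_nat pe.
have [rp sim2] := simulates_repl sim ej.
have [_ d2 _ _] := sim_dom sim.
have [/andP [_ en] /andP [_ Gs]] := d2 _ (mem_head e es).
have [|ys [y1 y2 y3 y4 y5]] := IH _ _ _ _ _ _ sim2; first by move: sz => /=; lia.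
exists (move e (G e) :: ys); split=> //.
- by rewrite /= y2 move_lt //; apply: ltn_trans Im.
- rewrite big_cons /= /move_cost rp kind_move ?leq_add2l //.
  exact: ltn_trans Im.
Qed.

(** Sorting by date and by starting time establishes the initial invariant. The path found has at
    most [n + 2 * n] moves and is padded with the void move 0 to the fixed length for which the
    table is computed. *)
Lemma complete_path : (forall e, (0 < e <= n)%N -> (rx e)%:R <= S e) ->
  (forall e e', (0 < e <= n)%N -> (0 < e' <= n)%N -> e != e' ->
     (S e + P%:R <= S e') || (S e' + P%:R <= S e)) ->
  (forall e, (0 < e <= n)%N -> (G e < 2 ^ s)%N) ->
  (forall e e', (0 < e <= n)%N -> (0 < e' <= n)%N -> G e != 0%N ->
     G e' != 0%N -> e != e' -> rx e != rx e') ->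
  (forall e i, (0 < e <= n)%N -> (i < s)%N -> bit (cls e) i != 0%N ->
    exists e', [/\ (0 < e' <= n)%N, bit (G e') i != 0%N, (rx e <= rx e')%N
                 & (rx e')%:R <= S e]) ->
  0 <= F ->
  exists ys, [/\ size ys = (3 * n)%N,
    all (fun y => y < nmoves)%N ys, dg (foldl next_state 0%N ys) 5 = n
  & (flow (foldl next_state 0 ys) + path_cost 0 ys)%:R <=
    F + (\sum_(e <- iota 1 n | G e != 0%N) set_cost (G e))%:R].
Proof.
move=> rS noov Gs Gne rdy F0.
pose es := sort (fun e e' => rx e <= rx e')%N [seq e <- iota 1 n | G e != 0%N].
pose js := sort (fun e e' => S e <= S e') (iota 1 n).
have esP e : (e \in es) = (0 < e <= n)%N && (G e != 0%N).
  by rewrite mem_sort mem_filter mem_iota add1n ltnS andbC.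
have jsP e : (e \in js) = (0 < e <= n)%N.
  by rewrite mem_sort mem_iota add1n ltnS.
have ues : uniq es by rewrite sort_uniq filter_uniq // iota_uniq.
have ujs : uniq js by rewrite sort_uniq iota_uniq.
have sz_js : size js = n by rewrite size_sort size_iota.
have sz_es : (size es <= n)%N.
  by rewrite size_sort size_filter -[X in (_ <= X)%N](size_iota 1 n) count_size.
have sim : simulates 0 [::] es [::] js.
  split=> //.
  - by move=> i _; left; rewrite dg0.
  - by move=> B _; left; rewrite dg0.
  - by move=> e; rewrite jsP /avail !dg0 rx0 => /rS; apply: le_trans; rewrite ler0n.
  - by rewrite /flow !dg0 rx0.
  - move=> e i; rewrite jsP => h is_ b; have [e' [q1 q2 q3 q4]] := rdy e i h is_ b.
    exists e'; rewrite esP q1; split=> //=.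
    by apply: contraNneq q2 => ->; rewrite /bit div0n.
  - split=> // e; rewrite ?esP ?jsP // => /andP [h1 h2].
    by rewrite h1 lt0n h2 Gs.
  - have : pairwise (fun e e' => (rx e <= rx e')%N) es.
      rewrite -sorted_pairwise; last by move=> a b c; apply: leq_trans.
      by apply: sort_sorted => a b; apply: leq_total.
    move: ues; rewrite uniq_pairwise => u p.
    have : pairwise [rel e e' | (rx e <= rx e')%N && (e != e')] es.
      by rewrite pairwise_relI p.
    apply: (@sub_in_pairwise _ (mem es)); last exact/allP.
    move=> e e'; rewrite !esP => /andP [h1 h2] /andP [h3 h4] /= /andP [h5 h6].
    by rewrite ltn_neqAle h5 Gne.
  - have : pairwise (fun e e' => S e <= S e') js.
      rewrite -sorted_pairwise; last by move=> a b c; apply: le_trans.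
      by apply: sort_sorted => a b; apply: le_total.
    move: ujs; rewrite uniq_pairwise => u p.
    have : pairwise [rel e e' | (S e <= S e') && (e != e')] js.
      by rewrite pairwise_relI p.
    apply: (@sub_in_pairwise _ (mem js)); last exact/allP.
    move=> e e'; rewrite !jsP => h1 h2 /= /andP [h5 h6].
    have /orP [//|] := noov e e' h1 h2 h6.
    have PP : (0 < P)%N by apply: P0; lia.
    by move: PP; rewrite -(ltr_nat rat); lra.
have [ys [y1 y2 y3 y4 y5]] := simulates_path (leqnn _) sim.
have Y0 : (0 < nmoves)%N by rewrite muln_gt0 /moves_per_job addn1.
have step0 x : dg (next_state x 0) 5 = dg x 5 /\ flow (next_state x 0) = flow x.
  have j0 : job 0 = 0%N by rewrite /job div0n.
  have h := @next_none x 0 Y0; rewrite /is_sched /is_repl /is_idle j0 /= in h.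
  by rewrite /flow !(h erefl erefl erefl).
have pad k x : dg (foldl next_state x (nseq k 0%N)) 5 = dg x 5 /\
    flow (foldl next_state x (nseq k 0%N)) = flow x.
  by elim: k x => //= k IHk x; have [-> ->] := IHk (next_state x 0); apply: step0.
have pc0 k x : path_cost x (nseq k 0%N) = 0%N.
  elim: k x => //= k IHk x.
  by rewrite IHk /move_cost /is_repl /job div0n.
have pc x l l' : path_cost x (l ++ l') = (path_cost x l + path_cost (foldl next_state x l) l')%N.
  by elim: l x => [|y l IHl] x1 //=; rewrite IHl addnA.
exists (ys ++ nseq (3 * n - size ys) 0%N); split.
- by rewrite size_cat size_nseq; lia.
- by rewrite all_cat y2 all_nseq Y0 orbT.
- by rewrite foldl_cat (pad _ _).1.
- rewrite foldl_cat (pad _ _).2 pc pc0 addn0 natrD lerD // ler_nat.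
  apply: leq_trans y5 _.
  by rewrite /es (perm_big _ (permEl (perm_sort _ _))) big_filter.
Qed.

End Simulation.

Lemma key_inj e e' : e <= n -> e' <= n -> key e = key e' -> e = e'.
Proof.
move=> en e'n /(congr1 (modn^~ n.+1)).
by rewrite /key !modnMDl !modn_small // ltnS.
Qed.

Lemma leq_key_rx e e' : e' <= n -> key e <= key e' -> rx e <= rx e'.
Proof.
move=> e'n; rewrite /key => h; rewrite -ltnS -(ltn_pmul2r (isT : 0 < n.+1)).
by rewrite mulSn; lia.
Qed.

(** One replenishment of all resources at the last release date, followed by all jobs back to back
    in key order, is feasible. Hence the optimum is finite and the program always has a path to
    follow. *)
Lemma exists_path : exists ys, [/\ size ys = 3 * n,
  all (fun y => y < nmoves) ys & dg (foldl next_state 0 ys) 5 = n].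
Proof.
have [n0|n0] := posnP n; first by exists [::]; rewrite n0 dg0.
have in1n (i : 'I_n) : 0 < i.+1 <= n by rewrite /= ltn_ord.
case: (@arg_maxnP _ (Ordinal n0) xpredT (fun i => key i.+1) isT) => im _ im_max.
pose em := im.+1.
have rx_max e : 0 < e <= n -> rx e <= rx em.
  case: e => [//|e] /= en; apply: leq_key_rx; first exact: in1n im.
  exact: (im_max (Ordinal en)).
(* The position of [e] in key order, counted from 0; it fixes the starting time of [e] after the
   last release date. *)
pose rank e := count (fun e' => key e' < key e) (iota 1 n).
have rank_lt e : rank e <= n.
  by rewrite -[X in _ <= X](size_iota 1 n) count_size.
have rank_mono e e' : key e <= key e' -> rank e <= rank e'.
  by move=> kk; apply: sub_count => e1 /= h; apply: leq_trans h kk.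
have rank_strict e e' : 0 < e <= n -> key e < key e' -> rank e < rank e'.
  move=> e1n kk; rewrite /rank.
  have c1 : count (pred1 e) (iota 1 n) = 1.
    by rewrite count_uniq_mem ?iota_uniq // mem_iota add1n ltnS e1n.
  have dis : count (predI (fun e1 => key e1 < key e) (pred1 e)) (iota 1 n) = 0.
    apply/eqP; rewrite -leqn0 leqNgt -has_count; apply/hasPn => e1 _ /=.
    by apply/negP => /andP [h /eqP ee]; rewrite ee ltnn in h.
  have := count_predUI (fun e1 => key e1 < key e) (pred1 e) (iota 1 n).
  rewrite c1 dis addn0 addn1 => <-.
  by apply: sub_count => e1 /= /orP [h|/eqP ->//]; apply: ltn_trans kk.
pose S e : rat := (rx em + P * rank e)%:R%R.
pose full := \sum_(d < s) 1 * 2 ^ d.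
pose G e := if e == em then full else 0.
have [||||||||ys [h1 h2 h3 _]] := @complete_path S (rx em + P * n + P)%:R%R G.
- move=> e en; rewrite /S -natrD -natrB; last by have := rx_max e en; lia.
  by rewrite ler_nat; have := rank_lt e; nia.
- move=> e e' en e'n _; rewrite ltr_nat ltn_add2l ltn_pmul2l ?P0 // => h.
  by rewrite ltnNge; apply/negP => /rank_mono; rewrite leqNgt h.
- by move=> e en; rewrite ler_nat; apply: leq_trans (rx_max e en) (leq_addr _ _).
- move=> e e' en e'n ee.
  have kk : key e != key e'.
    by apply: contra ee => /eqP /key_inj ->; lia.
  rewrite /S -!natrD !ler_nat.
  have := rank_strict e e' en; have := rank_strict e' e e'n.
  by case: ltngtP kk => // _ _; nia.
- move=> e en; rewrite /G; case: ifP => _; last by rewrite expn_gt0.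
  exact: (@sum_digits_lt 2 s (fun=> 1)).
- move=> e e' _ _; rewrite /G.
  by case: (eqVneq e em) => [->|//] _; case: (eqVneq e' em) => [->|//]; rewrite eqxx.
- move=> e i en is_ _; exists em; split; [exact: in1n im| |exact: rx_max|].
    by rewrite /G eqxx /bit (@digit_sum 2 isT s (fun=> 1)).
  by rewrite ler_nat leq_addr.
- exact: ler0n.
- by exists ys.
Qed.

Lemma entry_neq0 : (entry (3 * n) 0).1 != 0.
Proof.
have [ys [szy ally d5]] := exists_path.
have fy0 : final_value (foldl next_state 0 ys) != 0 by rewrite /final_value d5 eqxx.
by have /andP [] := entry_le_path ally fy0; rewrite szy lt0n.
Qed.

Lemma sound_all x Js Qs e : sound x Js Qs -> dg x 5 = n -> 0 < e <= n ->
  exists t, (e, t) \in Js.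
Proof.
move=> [[szJ uJ _] HJ _ _ _] d5 en.
have sub : {subset unzip1 Js <= iota 1 n}.
  move=> e' /mapP [[e1 t] h ->] /=; have [h1 _ _ _ _] := HJ _ _ h.
  by rewrite mem_iota add1n ltnS.
have [|_ eqi] := uniq_min_size uJ sub; first by rewrite size_iota size_map szJ d5.
have : e \in unzip1 Js by rewrite eqi mem_iota add1n ltnS.
by move=> /mapP [[e1 t] h /= ee]; exists t; rewrite ee.
Qed.

Definition set_of_code A : {set 'I_s} := [set i : 'I_s | bit A i != 0].
Definition code (X : {set 'I_s}) := \sum_(d < s) (d \in X) * 2 ^ d.

(** Membership extended by 0 beyond [s], since the digit lemmas expect a function on all of
    [nat]. *)
Let mem_nat (X : {set 'I_s}) (d : nat) : nat :=
  if insub d is Some i then nat_of_bool ((i : 'I_s) \in X) else 0.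

Let mem_nat_lt X d : mem_nat X d < 2.
Proof. by rewrite /mem_nat; case: insub => // i; case: (_ \in _). Qed.

Let code_sum X : code X = \sum_(d < s) mem_nat X d * 2 ^ d.
Proof. by apply: eq_bigr => d _; rewrite /mem_nat valK. Qed.

Lemma code_lt X : code X < 2 ^ s.
Proof. by rewrite code_sum; apply: (@sum_digits_lt 2 s (mem_nat X)). Qed.

Lemma bit_code X (i : 'I_s) : bit (code X) i = (i \in X).
Proof. by rewrite /bit code_sum (@digit_sum 2 isT s (mem_nat X)) // /mem_nat valK. Qed.

Lemma code_eq0 X : (code X == 0) = (X == set0).
Proof.
apply/eqP/eqP => [c0|->]; last by rewrite /code big1 // => i _; rewrite inE.
apply/setP => i; rewrite inE; have := bit_code X i.
by rewrite c0 /bit div0n; case: (_ \in _).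
Qed.

(** * Rational instances and the integer graph *)

Section Instance.
Local Open Scope ring_scope.
Variables (I : instance s) (D : nat).
Hypotheses (D0 : (0 < D)%N) (nE : n = njobs I) (valid_I : valid_instance I).
Hypothesis scale_proc : forall j, P%:R = proc I j * D%:R.
Hypothesis scale_release :
  forall j : 'I_(njobs I), (rx j.+1)%:R = release I j * D%:R + 1.
Hypothesis cls_req : forall (j : 'I_(njobs I)) (i : 'I_s),
  (bit (cls j.+1) i != 0%N) = (i \in req I j).
Hypothesis scale_joint : K0%:R = joint_cost I * D%:R.
Hypothesis scale_res : forall i : 'I_s, (K i)%:R = res_cost I i * D%:R.

Let D_gt0 : 0 < D%:R :> rat. Proof. by rewrite ltr0n. Qed.
Let D_neq0 : D%:R != 0 :> rat. Proof. by rewrite gt_eqF. Qed.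

Definition event_cost (X : {set 'I_s}) : rat :=
  joint_cost I + \sum_(i in X) res_cost I i.

Lemma set_costE A : (set_cost A)%:R = event_cost (set_of_code A) * D%:R.
Proof.
rewrite /set_cost /event_cost natrD scale_joint mulrDl natr_sum mulr_suml.
congr (_ + _); rewrite [RHS]big_mkcond; apply: eq_bigr => i _.
rewrite inE; have := bit_le1 A i; case: (bit A i) => [|[|//]] _.
  by rewrite mul0n.
by rewrite mul1n scale_res.
Qed.

Lemma mem_bigcup_seq (T : Type) (l : seq T) (p : pred T) (X : T -> {set 'I_s}) i :
  (i \in \bigcup_(q <- l | p q) X q) = has (fun q => p q && (i \in X q)) l.
Proof.
elim: l => [|q l IH]; first by rewrite big_nil inE.
by rewrite big_cons /=; case: (p q); rewrite //= inE IH.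
Qed.

Let in_jobs (j : 'I_(njobs I)) : (0 < j.+1 <= n)%N.
Proof. by rewrite nE ltn_ord. Qed.

(** The predecessors undo the shift by one, the divisions by [D] the scaling. *)
Definition read_solution (st : nat -> nat) (Qs : seq (nat * nat)) :
    solution s (njobs I) :=
  Solution (fun j : 'I_(njobs I) => (st j.+1).-1%:R / D%:R)
    [seq (set_of_code q.1, (rx q.2).-1%:R / D%:R) | q <- Qs].

Lemma read_solutionP x Js Qs st : sound x Js Qs -> dg x 5 = n ->
  (forall e t, (e, t) \in Js -> st e = t) ->
  feasible (read_solution st Qs) /\
  Fmax_repl_cost (read_solution st Qs) <=
    (flow x + \sum_(q <- Qs) set_cost q.1)%:R / D%:R.
Proof.
move=> snd_x d5 stE.
have inJ e : (0 < e <= n)%N -> (e, st e) \in Js.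
  by move=> en; have [t h] := sound_all snd_x d5 en; rewrite (stE _ _ h).
have [[_ _ noJ] HJ _ HQ sQ] := snd_x.
have st1 (j : 'I_(njobs I)) : (st j.+1).-1%:R = (st j.+1)%:R - 1 :> rat.
  have [_ _ [h _] _ _] := HJ _ _ (inJ _ (in_jobs j)).
  have := rx_gt0 (in_jobs j); case: (st j.+1) h => [|t] h h0; first by lia.
  by rewrite -natr1 addrK.
have rx1 e : (0 < e <= n)%N -> (rx e).-1%:R = (rx e)%:R - 1 :> rat.
  by move=> /rx_gt0; case: (rx e) => // t _; rewrite -natr1 addrK.
split.
  split.
  - rewrite /read_solution /= -map_comp.
    have -> : [seq (snd \o (fun q => (set_of_code q.1, (rx q.2).-1%:R / D%:R : rat))) q | q <- Qs]
      = [seq (v.-1)%:R / D%:R | v <- [seq rx q.2 | q <- Qs]].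
      by rewrite -map_comp.
    apply: (@homo_sorted_in _ _ (fun v => 0 < v)%N _ ltn) sQ => //.
      move=> u v; rewrite -!topredE /= => u0 v0 uv.
      by rewrite ltr_pM2r ?invr_gt0 // ltr_nat; lia.
    by apply/allP => v /mapP [[A e] h ->] /=; have [_ /rx_gt0 //] := HQ _ _ h.
  - move=> j k jk; rewrite /completion /= !st1.
    have := noJ _ _ _ _ (inJ _ (in_jobs j)) (inJ _ (in_jobs k)).
    rewrite eqSS => /(_ jk).
    have ov (a b : nat) k' : (a + P <= b)%N ->
        (a%:R - 1) / D%:R + proc I k' <= (b%:R - 1) / D%:R.
      rewrite ler_pdivlMr // mulrDl divfK // -scale_proc -(ler_nat rat) natrD.
      by lra.
    by case/orP=> /ov ->; rewrite ?orbT.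
  - move=> j; rewrite /ready; apply/subsetP => i ij; rewrite mem_bigcup_seq.
    have [_ _ _ _ h] := HJ _ _ (inJ _ (in_jobs j)).
    have [|A [e' [q1 q2 /andP [q3 q4]]]] := h i (ltn_ord i); first by rewrite cls_req.
    apply/hasP; exists (set_of_code A, (rx e').-1%:R / D%:R).
      by apply/mapP; exists (A, e').
    have [_ e'n _] := HQ _ _ q1.
    rewrite /= inE q2 andbT rx1 // st1 ler_pdivlMr // ler_pM2r ?invr_gt0 //.
    rewrite lerD2r ler_nat q4 andbT lerBrDr -scale_release ler_nat //.
rewrite /Fmax_repl_cost natrD mulrDl; apply: lerD.
  apply: bigmax_le => [|j _]; first by rewrite divr_ge0 // ler0n.
  have [_ _ _ h _] := HJ _ _ (inJ _ (in_jobs j)).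
  rewrite ler_pdivlMr // /completion /= mulrBl mulrDl divfK // -scale_proc st1.
  by move: h; rewrite -(ler_nat rat) !natrD scale_release; lra.
rewrite /repl_cost /read_solution /= big_map natr_sum mulr_suml.
by apply: ler_sum => q _; rewrite set_costE mulfK.
Qed.

(** An earlier release and a later start widen the window in which replenishments count. This is the
    readiness half of the exchange argument. *)
Lemma ready_leq (y : solution s (njobs I)) j k t t' : req I j = req I k ->
  release I k <= release I j -> t <= t' -> ready y j t -> ready y k t'.
Proof.
move=> rjk rel tt' /subsetP rd; apply/subsetP => i; rewrite -rjk => /rd.
rewrite !mem_bigcup_seq; apply: sub_has => q /andP [/andP [h1 h2] ->].
by rewrite (le_trans rel h1) (le_trans h2 tt').
Qed.

(* Among the rearrangements of the starting times that keep the schedule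
   feasible without increasing the maximum flow time, one that maximizes the sum
   of the products of keys and starting times serves every class in key order. *)
Lemma fifo_reorder (y : solution s (njobs I)) : feasible y ->
  exists S : 'I_(njobs I) -> rat,
  [/\ forall j k, j != k -> (S j + proc I j <= S k) || (S k + proc I k <= S j),
      forall j, ready y j (S j),
      forall j, S j + proc I j - release I j <= Fmax y
    & forall j k, req I j = req I k -> S j < S k -> (key j.+1 < key k.+1)%N].
Proof.
move=> [_ noov rdy].
have eqp j k : proc I j = proc I k.
  by apply: (mulIf D_neq0); rewrite -!scale_proc.
pose S0 := start y.
(* Only the starting times are permuted among the jobs, so the candidates form a finite set, which
   contains the given schedule. *)
pose OK (f : {perm 'I_(njobs I)}) := [forall j, ready y j (S0 (f j)) &&
  (S0 (f j) + proc I j - release I j <= Fmax y)].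
have OK1 : OK 1%g.
  apply/forallP => j; rewrite perm1 rdy /=.
  exact: (le_bigmax _ (fun j => completion y j - release I j)).
case: (@arg_maxP _ rat {perm 'I_(njobs I)} 1%g OK
  (fun f : {perm 'I_(njobs I)} =>
     \sum_(j : 'I_(njobs I)) (key j.+1)%:R * S0 (f j)) OK1) => f OKf fmax.
have {}OKf j : ready y j (S0 (f j)) /\
    S0 (f j) + proc I j - release I j <= Fmax y.
  by have /forallP /(_ j) /andP := OKf.
exists (S0 \o f); split=> /=; try by move=> j; have [] := OKf j.
  move=> j k jk; have := noov (f j) (f k); rewrite (inj_eq perm_inj) jk => /(_ isT).
  by rewrite /completion (eqp (f j) j) (eqp (f k) k).
move=> j k rjk Sjk; rewrite ltnNge; apply/negP => kk.
have jk : j != k by apply: contraTneq Sjk => ->; rewrite ltxx.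
have {}kk : (key k.+1 < key j.+1)%N.
  rewrite ltn_neqAle kk andbT; apply: contra jk => /eqP /key_inj.
  have /andP [_ jn] := in_jobs j; have /andP [_ kn] := in_jobs k.
  by move=> /(_ kn jn) [] /ord_inj ->.
have rel : release I k <= release I j.
  have /andP [_ jn] := in_jobs j.
  have := leq_key_rx jn (ltnW kk).
  by rewrite -(ler_nat rat) !scale_release lerD2r ler_pM2r.
pose g := (tperm j k * f)%g.
have gE i : g i = f (tperm j k i) by rewrite permM.
(* Here [k] is released no later than [j] but starts after it. Once the starts are swapped, both
   flow times are at most the old flow time of [k]. *)
have OKg : OK g.
  apply/forallP => i; rewrite gE; case: tpermP => [->|->|_ _].
  - have [r1 f1] := OKf j; have [r2 f2] := OKf k.
    rewrite (ready_leq _ _ (ltW Sjk) r1) //=.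
    by apply: le_trans f2; rewrite (eqp j k); lra.
  - have [r1 f1] := OKf j; have [r2 f2] := OKf k.
    rewrite (ready_leq rjk rel (lexx _) r1) //=.
    by apply: le_trans f2; lra.
  - by have [-> ->] := OKf i.
(* With [S = S0 \o f], the swap increases the sum by [(key j.+1 - key k.+1) * (S k - S j) > 0],
   against the choice of [f]. *)
suff : ~~ (\sum_(i : 'I_(njobs I)) (key i.+1)%:R * S0 (g i) <=
  \sum_(i : 'I_(njobs I)) (key i.+1)%:R * S0 (f i)) by move=> /negP; apply; apply: (fmax g OKg).
rewrite -ltNge.
rewrite (bigD1 j) //= (bigD1 k) /=; last by rewrite eq_sym.
rewrite [X in _ < X](bigD1 j) //= [X in _ < _ + X](bigD1 k) /=; last by rewrite eq_sym.
rewrite !gE tpermL tpermR.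
set r1 := \sum_(i | _) _; set r2 := \sum_(i | _) _.
have -> : r2 = r1.
  by apply: eq_bigr => i /andP [h1 h2]; rewrite gE tpermD // eq_sym.
move: kk; rewrite -(ltr_nat rat) -subr_gt0 => kk.
by rewrite /= -subr_gt0 in Sjk; have := mulr_gt0 kk Sjk; lra.
Qed.

Lemma event_cost_ge0 X : 0 <= event_cost X.
Proof. by have [_ _ _ h1 h2] := valid_I; rewrite addr_ge0 // sumr_ge0. Qed.

(** Merging does not pay more: covering a nonempty set takes at least one event, hence one joint
    cost, and every resource of the set is paid for by some event that contains it. *)
Lemma event_cost_cover (T : Type) (l : seq T) (U : T -> {set 'I_s}) X :
  X != set0 -> (forall i, i \in X -> has (fun q => i \in U q) l) ->
  event_cost X <= \sum_(q <- l) event_cost (U q).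
Proof.
have [_ _ _ J0 r0] := valid_I.
elim: l X => [|q l IH] X X0 cov.
  by have /set0Pn [i /cov] := X0.
rewrite big_cons; have [XU|XU] := boolP (X :\: U q == set0).
  have h : event_cost X <= event_cost (U q).
    rewrite lerD2l (big_setID (U q)) /= (eqP XU) big_set0 addr0.
    rewrite [leRHS](big_setID X) /= setIC lerDl.
    by apply: sumr_ge0 => i _; apply: r0.
  by apply: (le_trans h); rewrite lerDl sumr_ge0 // => q' _; apply: event_cost_ge0.
have := IH _ XU; set c := event_cost (_ :\: _) => h.
apply: (@le_trans _ _ (event_cost (U q) + c)); last first.
  rewrite lerD2l; apply: h => i; rewrite inE => /andP [iU iX].
  by have /orP [h|//] := cov i iX; rewrite h in iU.
rewrite /c /event_cost (big_setID (U q)) /=.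
have : \sum_(i in X :&: U q) res_cost I i <= \sum_(i in U q) res_cost I i.
  rewrite [leRHS](big_setID X) /= setIC lerDl.
  by apply: sumr_ge0 => i _; apply: r0.
by lra.
Qed.

(** The sum has at most one term. It is used for the release indices to which one replenishment can
    be moved back. *)
Lemma sum_unique_le (l : seq nat) (p : pred nat) (c : rat) : 0 <= c -> uniq l ->
  {in l &, forall e e', p e -> p e' -> e = e'} -> \sum_(e <- l | p e) c <= c.
Proof.
move=> c0; elim: l => [|e l IH] /=; first by rewrite big_nil.
case/andP=> el ul un; rewrite big_cons; case: ifP => pe; last first.
  by apply: IH => // e1 e2 h1 h2; apply: un; rewrite inE ?h1 ?h2 orbT.
rewrite big_seq_cond big1 ?addr0 // => e' /andP [h pe'].
have ee' := un e e' (mem_head _ _) _ pe pe'.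
by move: el; rewrite ee' ?h // inE h orbT.
Qed.

(** Replenishments with the same last release index [e] are merged into [U e]. Those before the
    first release date have no such index and disappear, since no job can use them. Among equal
    release dates the largest key decides, so that an index is determined by its date. *)
Lemma complete_solution (y : solution s (njobs I)) : feasible y ->
  exists ys, [/\ size ys = (3 * n)%N, all (fun y => y < nmoves)%N ys,
    dg (foldl next_state 0%N ys) 5 = n
  & (flow (foldl next_state 0 ys) + path_cost 0 ys)%:R <= Fmax_repl_cost y * D%:R].
Proof.
move=> fy; have [S [noov rdy fl fifo]] := fifo_reorder fy.
have jobP e : (0 < e <= n)%N -> exists j : 'I_(njobs I), e = j.+1.
  by case: e => // e en; rewrite nE /= in en; exists (Ordinal en).
pose Sx e : rat := if insub e.-1 is Some j then S j * D%:R + 1 else 0.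
have SxE (j : 'I_(njobs I)) : Sx j.+1 = S j * D%:R + 1 by rewrite /Sx /= valK.
pose tau (q : {set 'I_s} * rat) := q.2 * D%:R + 1.
(* [last_rel q e]: [e] is the latest release index not after [q], to which [q]
   can be moved back without delaying any job. *)
pose last_rel q e := ((rx e)%:R <= tau q) &&
  all (fun e' => ((rx e')%:R <= tau q) ==> (key e' <= key e)%N) (iota 1 n).
pose U e := [set i : 'I_s | has (fun q => last_rel q e && (i \in q.1)) (repl y)].
pose G e := code (U e).
have last_key q e e' : last_rel q e -> (0 < e' <= n)%N ->
    (rx e')%:R <= tau q -> (key e' <= key e)%N.
  move=> /andP [_ /allP h] e'n t'; have := h e'.
  by rewrite mem_iota add1n ltnS e'n t' => /(_ isT).
have Gne e : G e != 0%N -> exists2 q, q \in repl y & last_rel q e.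
  rewrite code_eq0 => /set0Pn [i]; rewrite inE => /hasP [q h1 /andP [h2 _]].
  by exists q.
have ready_ex e i : (0 < e <= n)%N -> (i < s)%N -> bit (cls e) i != 0%N ->
    exists e', [/\ (0 < e' <= n)%N, bit (G e') i != 0%N, (rx e <= rx e')%N
                 & (rx e')%:R <= Sx e].
  move=> /jobP [j ->] is_; rewrite -[i]/(nat_of_ord (Ordinal is_)) cls_req.
  move: (rdy j) => /subsetP rj /rj; rewrite mem_bigcup_seq.
  move=> /hasP [q qy /andP [/andP [q1 q2] iq]].
  have pj : (rx j.+1)%:R <= tau q by rewrite scale_release lerD2r ler_pM2r.
  case: (@arg_maxnP _ j (fun k : 'I_(njobs I) => (rx k.+1)%:R <= tau q)
          (fun k => key k.+1) pj) => k pk kmax.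
  have lk : last_rel q k.+1.
    rewrite /last_rel pk; apply/allP => e'; rewrite mem_iota add1n ltnS.
    by move=> /jobP [k' ->]; apply/implyP; apply: kmax.
  exists k.+1; split=> //.
  - by rewrite bit_code inE eqb0 negbK; apply/hasP; exists q; rewrite ?lk.
  - have /andP [_ kn] := in_jobs k; apply: leq_key_rx kn _.
    exact: last_key lk (in_jobs j) pj.
  - by apply: (le_trans pk); rewrite SxE lerD2r ler_pM2r.
have FD0 : 0 <= Fmax y * D%:R by rewrite mulr_ge0 ?bigmax_ge_id ?ltW.
have [||||||||ys [h1 h2 h3 h4]] := @complete_path Sx (Fmax y * D%:R) G.
- move=> e /jobP [j ->]; rewrite SxE scale_release (scale_proc j).
  have := fl j; rewrite -(ler_pM2r D_gt0) mulrBl mulrDl; lra.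
- move=> e e' /jobP [j ->] /jobP [k ->] cc; rewrite !SxE ltrD2r ltr_pM2r //.
  by apply: fifo; apply/setP => i; rewrite -!cls_req cc.
- move=> e en; have [i is_ b] := exists_bit (cls_lt en).
  have [e' [_ _ r1 r2]] := ready_ex e i en is_ b.
  by apply: le_trans r2; rewrite ler_nat.
- move=> e e' /jobP [j ->] /jobP [k ->]; rewrite eqSS => /noov h.
  rewrite !SxE; have {}h : (S j * D%:R + P%:R <= S k * D%:R) ||
     (S k * D%:R + P%:R <= S j * D%:R).
    by rewrite {1}(scale_proc j) (scale_proc k) -!mulrDl !ler_pM2r.
  by case/orP: h => h; apply/orP; [left|right]; lra.
- by move=> e _; apply: code_lt.
(* If the dates agree, each of the two indices bounds the key of the other, so the indices
   coincide. *)
- move=> e e' en e'n /Gne [q _ /andP [q1 q2]] /Gne [q' _ /andP [q1' q2']] ee.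
  apply: contra ee => /eqP rr; apply/eqP.
  have l1 : last_rel q e by rewrite /last_rel q1.
  have l2 : last_rel q' e' by rewrite /last_rel q1'.
  have k1 := last_key q e e' l1 e'n; rewrite -rr in k1.
  have k2 := last_key q' e' e l2 en; rewrite rr in k2.
  apply: key_inj; [lia|lia|apply/eqP].
  by rewrite eqn_leq k1 // k2.
- exact: ready_ex.
- exact: FD0.
exists ys; split=> //; apply: (le_trans h4).
rewrite /Fmax_repl_cost mulrDl lerD2l natr_sum.
have costG e : G e != 0%N -> (set_cost (G e))%:R <=
    (\sum_(q <- repl y | last_rel q e) event_cost q.1) * D%:R.
  move=> Ge; rewrite set_costE ler_pM2r //.
  have -> : set_of_code (G e) = U e.
    by apply/setP => i; rewrite [LHS]inE bit_code eqb0 negbK.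
  rewrite -big_filter; apply: event_cost_cover; first by rewrite -code_eq0.
  move=> i; rewrite inE => /hasP [q h5 /andP [h6 h7]].
  by apply/hasP; exists q; rewrite ?mem_filter ?h6.
apply: (le_trans (ler_sum _ costG)).
rewrite -mulr_suml ler_pM2r //.
apply: (@le_trans _ _ (\sum_(e <- iota 1 n)
   \sum_(q <- repl y | last_rel q e) event_cost q.1)).
  rewrite big_mkcond; apply: ler_sum => e _; case: ifP => // _.
  by apply: sumr_ge0 => q _; apply: event_cost_ge0.
(* With the sum over replenishments outside, each original event is charged at most once, as its
   last release index is unique. *)
rewrite (exchange_big_dep xpredT) //=; apply: ler_sum => q _.
apply: sum_unique_le; [exact: event_cost_ge0|exact: iota_uniq|].
move=> e e'; rewrite !mem_iota !add1n !ltnS => en e'n l1 l2.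
have /andP [t1 _] := l1; have /andP [t2 _] := l2.
apply: key_inj; [lia|lia|apply/eqP].
by rewrite eqn_leq (last_key _ _ _ l1 e'n t2) (last_key _ _ _ l2 en t1).
Qed.

(** The table value bounds the decoded schedule from above and, through [complete_solution], every
    feasible schedule from below. The successor in [final_value] occurs on both sides and
    cancels. *)
Lemma optimal_read_solution x Js Qs st : sound x Js Qs -> final_value x != 0%N ->
  (entry (3 * n) 0).1 = (final_value x + \sum_(q <- Qs) set_cost q.1)%N ->
  (forall e t, (e, t) \in Js -> st e = t) ->
  optimal (read_solution st Qs).
Proof.
move=> snd fin val stE.
have d5 : dg x 5 = n by apply/eqP; apply: contraNT fin => h; rewrite /final_value (negbTE h).
have [fs cs] := read_solutionP snd d5 stE; split=> // y fy.
have [ys [szy ally d5y le]] := complete_solution fy.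
apply: (le_trans cs); rewrite ler_pdivrMr //; apply: le_trans le.
have fy0 : final_value (foldl next_state 0%N ys) != 0%N.
  by rewrite /final_value d5y eqxx.
have := entry_le_path ally fy0; rewrite szy val => /andP [_].
rewrite /final_value d5 d5y eqxx !addSn ltnS => h.
by rewrite ler_nat.
Qed.

End Instance.
End Search.

(** * Expressions of the program *)

Local Coercion EConst : nat >-> expr.
Declare Scope expr_scope.
Delimit Scope expr_scope with X.
Notation "a + b" := (EOp Add a%X b%X) : expr_scope.
Notation "a - b" := (EOp Defs.Sub a%X b%X) : expr_scope.
Notation "a * b" := (EOp Mul a%X b%X) : expr_scope.
Notation "a / b" := (EOp Div a%X b%X) : expr_scope.
Notation "$[ a ]" := (ELoad a%X) (at level 2, format "$[ a ]") : expr_scope.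
Bind Scope expr_scope with expr.

(** Truth values are numbers, so a whole transition is one expression without branching commands.
    Both operands and both branches are always evaluated, also where the value is then multiplied by
    0. *)
Definition EAnd (a b : expr) : expr := a * b.
Definition ELt (a b : expr) : expr := b - a.
Definition ELe (a b : expr) : expr := 1%N - (a - b).
Definition EEq (a b : expr) : expr := EAnd (ELe a b) (ELe b a).
Definition ECond (c a b : expr) : expr :=
  (1%N - (1%N - c)) * a + (1%N - c) * b.
Definition EImp (a b : expr) : expr := ECond a b 1%N.
Definition EMod (a b : expr) : expr := a - (a / b) * b.
Definition EAll (f : nat -> expr) (k : nat) : expr :=
  foldr (fun i c => EAnd (f i) c) (EConst 1) (iota 0 k).
Definition ESum (f : nat -> expr) (k : nat) : expr :=
  foldr (fun i c => EOp Add (f i) c) (EConst 0) (iota 0 k).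
Definition EPow (a : expr) (k : nat) : expr := iter k (EOp Mul a) (EConst 1).

Section EvalLemmas.
Variable m : memory.
Local Notation holds e := (eval m e != 0).

Lemma holds_and a b : holds (EAnd a b) = holds a && holds b.
Proof. by rewrite /= muln_eq0 negb_or. Qed.

Lemma holds_lt a b : holds (ELt a b) = (eval m a < eval m b).
Proof. by rewrite /= subn_eq0 -ltnNge. Qed.

Lemma holds_le a b : holds (ELe a b) = (eval m a <= eval m b).
Proof. by rewrite /=; lia. Qed.

Lemma holds_eq a b : holds (EEq a b) = (eval m a == eval m b).
Proof. by rewrite holds_and !holds_le eqn_leq. Qed.

Lemma eval_cond c a b : eval m (ECond c a b) = if holds c then eval m a else eval m b.
Proof.
rewrite /=; case: (eval m c) => [|k] /=; first by rewrite !subn0 subnn mul0n mul1n.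
by rewrite subSS sub0n subn0 mul1n mul0n addn0.
Qed.

Lemma holds_imp a b : holds (EImp a b) = holds a ==> holds b.
Proof. by rewrite /EImp eval_cond; case: (holds a). Qed.

Lemma eval_mod a b : eval m (EMod a b) = eval m a %% eval m b.
Proof. by rewrite /= {1}(divn_eq (eval m a) (eval m b)) addKn. Qed.

Lemma holds_all f k : holds (EAll f k) = all (fun i => holds (f i)) (iota 0 k).
Proof. by rewrite /EAll; elim: (iota 0 k) => //= i l <-; rewrite muln_eq0 negb_or. Qed.

Lemma eval_sum f k : eval m (ESum f k) = \sum_(i < k) eval m (f i).
Proof.
rewrite -(big_mkord xpredT (fun i => eval m (f i))) /index_iota subn0 /ESum.
elim: (iota 0 k) => [|i l IH]; first by rewrite big_nil.
by rewrite big_cons /= IH.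
Qed.

Lemma eval_pow a k : eval m (EPow a k) = eval m a ^ k.
Proof. by elim: k => //= k ->; rewrite expnS. Qed.

End EvalLemmas.

Section Program.
Variable s : nat.
Local Open Scope expr_scope.

Definition e_n : expr := $[1%N].
Definition e_N : expr := e_n + 1%N.
Definition e_D : expr := Reg 0.
Definition e_P : expr := Reg 1.
Definition e_idx : expr := Reg 2.
Definition e_x : expr := Reg 3.
Definition e_y : expr := Reg 4.
Definition e_j : expr := Reg 5.
Definition e_len : expr := Reg 6.

(** Cell 1 holds the number of jobs, cells 2 and 3 the joint cost, the next [2 * s] cells the
    resource costs. The record of a job has [4 + s] cells: numerator and denominator of its
    processing time, the same for its release date, and the bits of its resource set. *)
Definition e_rec (e : expr) : expr := (4 + 2 * s)%N + (e - 1%N) * (4 + s)%N.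
Definition e_rx (e : expr) : expr :=
  ECond e ($[e_rec e + 2%N] * (e_D / $[e_rec e + 3%N]) + 1%N) 0%N.
Definition e_cls (e : expr) : expr :=
  ESum (fun i => $[e_rec e + (4 + i)%N] * (2 ^ i)%N) s.
Definition e_K0 : expr := $[2%N] * (e_D / $[3%N]).
Definition e_K (i : nat) : expr := $[(4 + 2 * i)%N] * (e_D / $[(5 + 2 * i)%N]).

Definition e_dg (d : nat) : expr := EMod (e_x / EPow e_N d) e_N.
Definition e_bit (A : expr) (i : nat) : expr := EMod (A / (2 ^ i)%N) 2%N.
Definition e_avail : expr := e_rx (e_dg 0) + e_dg 1 * e_P.
Definition e_flow : expr := e_rx (e_dg 2) + e_dg 3 * e_P - e_rx (e_dg 4).
Definition e_key (e : expr) : expr := e_rx e * e_N + e.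
Definition e_job : expr := e_y / (moves_per_job s).
Definition e_kind : expr := EMod e_y (moves_per_job s).

Definition e_sched : expr :=
  EAnd e_job (EAnd (EEq e_kind 0%N) (
  EAnd (EAll (fun i => EImp (e_bit (e_cls e_job) i)
          (EAnd (ELe (e_rx e_job) (e_rx (e_dg (6 + i))))
                (ELe (e_rx (e_dg (6 + i))) e_avail))) s) (
  EAnd (EAll (fun B => EImp (EEq (e_cls e_job) B)
          (ELt (e_key (e_dg (6 + s + B))) (e_key e_job))) (2 ^ s)) (
  EAnd (ELt (e_dg 5) e_n) (ELt (e_dg 1) e_n))))).
Definition e_repl : expr :=
  EAnd e_job (EAnd (EAnd e_kind (ELt e_kind (2 ^ s)%N))
    (EAll (fun i => ELt (e_rx (e_dg (6 + i))) (e_rx e_job)) s)).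
Definition e_idle : expr :=
  EAnd e_job (EAnd (EEq e_kind (2 ^ s)%N) (ELe e_avail (e_rx e_job))).
Definition e_raise : expr :=
  EAnd e_sched (ELt e_flow (e_avail + e_P - e_rx e_job)).

Definition e_new (d : nat) : expr :=
  if d == 0 then ECond e_idle e_job (e_dg d)
  else if d == 1 then
    ECond e_sched (e_dg d + 1%N) (ECond e_idle 0%N (e_dg d))
  else if d == 2 then ECond e_raise (e_dg 0) (e_dg d)
  else if d == 3 then ECond e_raise (e_dg 1 + 1%N) (e_dg d)
  else if d == 4 then ECond e_raise e_job (e_dg d)
  else if d == 5 then ECond e_sched (e_dg d + 1%N) (e_dg d)
  else if d < 6 + s then
    ECond (EAnd e_repl (e_bit e_kind (d - 6))) e_job (e_dg d)
  else ECond (EAnd e_sched (EEq (e_cls e_job) (d - (6 + s))%N)) e_job (e_dg d).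

Definition e_next : expr := ESum (fun d => e_new d * EPow e_N d) (ndigits s).
Definition e_set_cost : expr := e_K0 + ESum (fun i => e_bit e_kind i * e_K i) s.
Definition e_cost : expr := ECond e_repl e_set_cost 0%N.
Definition e_final : expr := ECond (EEq (e_dg 5) e_n) (e_flow + 1%N) 0%N.

Section Eval.
Variable (w : seq nat) (D P : nat).
Local Open Scope nat_scope.

Definition cell a := load_word w a.
Definition rec_addr e := 4 + 2 * s + (e - 1) * (4 + s).
Definition rx_of e :=
  if e == 0 then 0 else cell (rec_addr e + 2) * (D %/ cell (rec_addr e + 3)) + 1.
Definition cls_of e := \sum_(i < s) cell (rec_addr e + (4 + i)) * 2 ^ i.
Definition K0_of := cell 2 * (D %/ cell 3).
Definition K_of i := cell (4 + 2 * i) * (D %/ cell (5 + 2 * i)).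

Local Notation n := (cell 1).
Local Notation z := (size w).

Definition holds_data (m : memory) :=
  [/\ forall a, a <= z -> m a = cell a, m (z + 1) = D & m (z + 2) = P].

Variables (m : memory) (x y : nat).
Hypothesis size_w : z = 3 + 2 * s + n * (4 + s).
Hypothesis data_m : holds_data m.

Lemma eval_cell a : a <= z -> m a = cell a.
Proof. by case: data_m => h _ _; apply: h. Qed.

Lemma mem0 : m 0 = z.
Proof. by rewrite eval_cell. Qed.

Lemma eval_n : eval m e_n = n.
Proof. by rewrite /= eval_cell // size_w; lia. Qed.

Lemma eval_N : eval m e_N = n.+1.
Proof. by rewrite /e_N -[LHS]/(eval m e_n + 1) eval_n addn1. Qed.

Lemma eval_Reg r : eval m (Reg r) = m (z + r.+1).
Proof. by rewrite /= mem0. Qed.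

Lemma eval_D : eval m e_D = D.
Proof. by rewrite eval_Reg; case: data_m. Qed.

Lemma eval_P : eval m e_P = P.
Proof. by rewrite eval_Reg; case: data_m. Qed.

Lemma rec_addr_le e k : 0 < e <= n -> k < 4 + s -> rec_addr e + k <= z.
Proof. by rewrite size_w /rec_addr => en ks; nia. Qed.

Lemma eval_rx e : eval m e <= n -> eval m (e_rx e) = rx_of (eval m e).
Proof.
move=> en; rewrite /e_rx eval_cond /rx_of; case: eqP => //= e0.
have e1n : 0 < eval m e <= n by lia.
have ->: m (m 0 + 1) = D by rewrite mem0; case: data_m.
have h2 : rec_addr (eval m e) + 2 <= z by apply: rec_addr_le.
have h3 : rec_addr (eval m e) + 3 <= z by apply: rec_addr_le.
by rewrite -/(rec_addr (eval m e)) !eval_cell.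
Qed.

Lemma eval_cls e : 0 < eval m e <= n -> eval m (e_cls e) = cls_of (eval m e).
Proof.
move=> en; rewrite /e_cls eval_sum; apply: eq_bigr => i _ /=.
have h : rec_addr (eval m e) + (4 + i) <= z by apply: rec_addr_le; rewrite // ltn_add2l.
by rewrite -/(rec_addr (eval m e)) eval_cell.
Qed.

Lemma eval_K0 : eval m e_K0 = K0_of.
Proof.
rewrite /e_K0 -[LHS]/(m 2 * (eval m e_D %/ m 3)) eval_D !eval_cell //; rewrite size_w; lia.
Qed.

Lemma eval_K i : i < s -> eval m (e_K i) = K_of i.
Proof.
move=> is_.
rewrite /e_K -[LHS]/(m (4 + 2 * i) * (eval m e_D %/ m (5 + 2 * i))) eval_D.
by rewrite !eval_cell //; rewrite size_w; lia.
Qed.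

Hypothesis mx : m (z + 4) = x.

Lemma eval_dg d : eval m (e_dg d) = dg n x d.
Proof.
rewrite /e_dg eval_mod -[eval m (_ / _)%X]/(eval m e_x %/ eval m (EPow e_N d)).
by rewrite eval_pow eval_N eval_Reg mx.
Qed.

Lemma dg_le d : dg n x d <= n.
Proof. by rewrite -ltnS dg_lt. Qed.

Lemma eval_rx_dg d : eval m (e_rx (e_dg d)) = rx_of (dg n x d).
Proof. by rewrite eval_rx eval_dg ?dg_le. Qed.

Lemma eval_bit A i : eval m (e_bit A i) = bit (eval m A) i.
Proof. by rewrite /e_bit eval_mod. Qed.

Lemma eval_avail : eval m e_avail = avail n P rx_of x.
Proof.
rewrite -[LHS]/(eval m (e_rx (e_dg 0)) + eval m (e_dg 1) * eval m e_P).
by rewrite eval_rx_dg eval_dg eval_P.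
Qed.

Lemma eval_flow : eval m e_flow = flow n P rx_of x.
Proof.
rewrite -[LHS]/(eval m (e_rx (e_dg 2)) + eval m (e_dg 3) * eval m e_P
  - eval m (e_rx (e_dg 4))).
by rewrite !eval_rx_dg eval_dg eval_P.
Qed.

Lemma eval_key e : eval m e <= n -> eval m (e_key e) = key n rx_of (eval m e).
Proof.
by move=> en; rewrite -[LHS]/(eval m (e_rx e) * eval m e_N + eval m e) eval_rx // eval_N.
Qed.

Lemma eval_final : eval m e_final = final_value n P rx_of x.
Proof.
rewrite /e_final eval_cond holds_eq eval_dg eval_n /final_value.
by rewrite -[eval m (_ + _)%X]/(eval m e_flow + 1) eval_flow addn1.
Qed.

Hypotheses (my : m (z + 5) = y) (y_lt : y < nmoves s n).

Lemma eval_job : eval m e_job = job s y.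
Proof. by rewrite -[LHS]/(eval m e_y %/ moves_per_job s) eval_Reg my. Qed.

Lemma eval_kind : eval m e_kind = kind s y.
Proof. by rewrite /e_kind eval_mod eval_Reg my. Qed.

Let job_le : job s y <= n.
Proof. by rewrite -ltnS job_lt. Qed.

Lemma eval_rx_job : eval m (e_rx e_job) = rx_of (job s y).
Proof. by rewrite eval_rx eval_job. Qed.

Lemma eval_cls_job : job s y != 0 -> eval m (e_cls e_job) = cls_of (job s y).
Proof. by move=> j0; rewrite eval_cls eval_job // lt0n j0 job_le. Qed.

Lemma holds_sched : (eval m e_sched != 0) = is_sched s n P rx_of cls_of x y.
Proof.
rewrite /e_sched 2!holds_and eval_job /is_sched.
case: (boolP (job s y != 0)) => // j0; rewrite !andTb.
rewrite holds_eq eval_kind; congr (_ && _).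
rewrite !holds_and !holds_all /sched_ok; congr [&& _, _, _ & _].
- apply: eq_all => i; rewrite holds_imp eval_bit eval_cls_job // holds_and.
  by rewrite !holds_le eval_rx_job eval_rx_dg eval_avail.
- apply: eq_all => B; rewrite holds_imp holds_eq eval_cls_job // holds_lt.
  by rewrite !eval_key ?eval_dg ?eval_job ?dg_le.
- by rewrite holds_lt eval_dg eval_n.
- by rewrite holds_lt eval_dg eval_n.
Qed.

Lemma holds_repl : (eval m e_repl != 0) = is_repl s n rx_of x y.
Proof.
rewrite /e_repl !holds_and eval_job eval_kind holds_lt eval_kind holds_all.
rewrite /is_repl lt0n; congr [&& _, _ & _].
by apply: eq_all => i; rewrite holds_lt eval_rx_dg eval_rx_job.
Qed.

Lemma holds_idle : (eval m e_idle != 0) = is_idle s n P rx_of x y.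
Proof.
by rewrite /e_idle 2!holds_and eval_job holds_eq eval_kind holds_le eval_avail eval_rx_job.
Qed.

Lemma holds_raise : (eval m e_raise != 0) = raises_flow s n P rx_of cls_of x y.
Proof.
rewrite /e_raise holds_and holds_sched holds_lt eval_flow.
by rewrite -[eval m (_ - _)%X]/(eval m e_avail + eval m e_P - eval m (e_rx e_job))
  eval_avail eval_P eval_rx_job.
Qed.

Lemma eval_succ_dg d : eval m (e_dg d + 1)%X = (dg n x d).+1.
Proof. by rewrite -[LHS]/(eval m (e_dg d) + 1) eval_dg addn1. Qed.

Lemma eval_new d : eval m (e_new d) = new_digit s n P rx_of cls_of x y d.
Proof.
rewrite /e_new /new_digit.
do 6 (case: ifP => _; first by rewrite ?eval_cond ?holds_idle ?holds_sched ?holds_raise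
  ?eval_succ_dg ?eval_job ?eval_dg).
case: ifP => _.
  by rewrite eval_cond holds_and holds_repl eval_bit eval_kind eval_job eval_dg.
rewrite eval_cond holds_and holds_sched eval_job eval_dg holds_eq.
case: (boolP (is_sched _ _ _ _ _ _ _)) => // /and3P [j0 _ _].
by rewrite eval_cls_job.
Qed.

Lemma eval_next : eval m e_next = next_state s n P rx_of cls_of x y.
Proof.
rewrite /e_next eval_sum; apply: eq_bigr => d _.
by rewrite -[LHS]/(eval m (e_new d) * eval m (EPow e_N d)) eval_new eval_pow eval_N.
Qed.

Lemma eval_cost_move : eval m e_cost = move_cost s n rx_of K0_of K_of x y.
Proof.
rewrite /e_cost eval_cond holds_repl /move_cost; case: ifP => // _.
rewrite -[LHS]/(eval m e_K0 + eval m (ESum (fun i => e_bit e_kind i * e_K i)%X s)).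
rewrite eval_K0 eval_sum; congr (_ + _); apply: eq_bigr => i _.
by rewrite -[LHS]/(eval m (e_bit e_kind i) * eval m (e_K i)) eval_bit eval_kind eval_K.
Qed.

End Eval.
End Program.

(** * The program *)

Section Commands.
Variable s : nat.
Local Open Scope expr_scope.

(* Memory above the input of length [z]: registers at [z + 1 .. z + 7], the
   output buffer at [z + 8 ..], and at [2 * z + 8] the table of values and moves,
   two cells for each entry. *)
Definition buf_addr (e : expr) : expr := $[0%N] + 8%N + e.
Definition tab_addr (e : expr) : expr := $[0%N] + $[0%N] + 8%N + 2%N * e.

Definition e_M : expr := EPow e_N (ndigits s).
Definition e_Y : expr := e_N * (moves_per_job s).
Definition e_L : expr := 3%N * e_n.

Definition EProd (f : nat -> expr) (k : nat) : expr :=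
  foldr (fun i c => EOp Mul (f i) c) (EConst 1) (iota 0 k).

(** The common denominator is simply the product of all denominators in the input, and [P] is taken
    from the record of the first job. *)
Definition c_scale : cmd :=
  CSeq (CStore (reg_addr 0) ($[3%N] * EProd (fun i => $[(5 + 2 * i)%N]) s))
  (CSeq (for_loop 5 e_n (CStore (reg_addr 0)
     (e_D * ($[e_rec s (e_j + 1%N) + 1%N] * $[e_rec s (e_j + 1%N) + 3%N]))))
  (CStore (reg_addr 1) ($[(4 + 2 * s)%N] * (e_D / $[(5 + 2 * s)%N])))).

(** Entry [(l + 1) * M + x] of the table stands for state [x] with [l + 1] moves to go; replacing
    [x] by the next state and subtracting [M] gives the corresponding entry with [l] moves to go. *)
Definition e_prev : expr := $[tab_addr (e_idx - e_x - e_M + e_next s)].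
Definition e_cur : expr := $[tab_addr e_idx].
Definition e_better : expr :=
  EAnd e_prev (ECond e_cur (ELt (e_prev + e_cost s) e_cur) 1%N).

Definition c_relax : cmd :=
  CIf e_better (CSeq (CStore (tab_addr e_idx) (e_prev + e_cost s))
                     (CStore (tab_addr e_idx + 1%N) e_y)) CSkip.

(** The layers are filled by increasing number of moves to go. Cells not yet written hold 0, which
    already is the infinite value needed to begin a minimum. *)
Definition c_table : cmd :=
  for_loop 2 ((e_L + 1%N) * e_M)
    (CSeq (CStore (reg_addr 3) (EMod e_idx e_M))
    (CIf (ELt e_idx e_M) (CStore (tab_addr e_idx) (e_final s))
         (for_loop 4 e_Y c_relax))).

(** The buffer has the layout of an encoded solution: [2 * n] cells for the starting times, then the
    number of replenishments, then [s + 2] cells for each of them. The count also serves as the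
    write position. *)
Definition e_cnt : expr := $[buf_addr (2%N * e_n)].
Definition e_slot (i : nat) : expr :=
  buf_addr (2%N * e_n + 1%N + (s + 2)%N * e_cnt + i).

Fixpoint c_bits (k : nat) : cmd :=
  if k is k'.+1 then CSeq (c_bits k') (CStore (e_slot k') (e_bit (e_kind s) k'))
  else CSkip.

Definition c_start_job : cmd :=
  CIf (e_sched s)
    (CSeq (CStore (buf_addr (2%N * (e_job s - 1%N))) (e_avail s - 1%N))
          (CStore (buf_addr (2%N * (e_job s - 1%N) + 1%N)) e_D)) CSkip.

(** The count is increased last because the addresses of the slot depend on it. *)
Definition c_replenish : cmd :=
  CIf (e_repl s)
    (CSeq (c_bits s)
    (CSeq (CStore (e_slot s) (e_rx s (e_job s) - 1%N))
    (CSeq (CStore (e_slot s.+1) e_D)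
          (CStore (buf_addr (2%N * e_n)) (e_cnt + 1%N))))) CSkip.

Definition c_follow : cmd :=
  CSeq (CStore (reg_addr 3) 0%N)
  (for_loop 2 e_L
    (CSeq (CStore (reg_addr 4) $[tab_addr ((e_L - e_idx) * e_M + e_x) + 1%N])
    (CSeq c_start_job (CSeq c_replenish (CStore (reg_addr 3) (e_next s)))))).

(** The result is copied over the input only now, since the input is read until the end of the walk.
    Cell 0 is written last because the registers are addressed relative to it. *)
Definition c_output : cmd :=
  CSeq (CStore (reg_addr 6) (2%N * e_n + 1%N + (s + 2)%N * e_cnt))
  (CSeq (for_loop 5 e_len (CStore (e_j + 1%N) $[buf_addr e_j]))
        (CStore 0%N e_len)).

Definition c_solve : cmd := CSeq c_scale (CSeq c_table (CSeq c_follow c_output)).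

End Commands.

Lemma eval_prod m f k : eval m (EProd f k) = \prod_(i < k) eval m (f i).
Proof.
rewrite -(big_mkord xpredT (fun i => eval m (f i))) /index_iota subn0 /EProd.
elim: (iota 0 k) => [|i l IH]; first by rewrite big_nil.
by rewrite big_cons /= IH.
Qed.

Lemma eval_load m a : eval m (ELoad a) = m (eval m a). Proof. by []. Qed.

Lemma eval_add m a b : eval m (EOp Add a b) = eval m a + eval m b.
Proof. by []. Qed.

Lemma update_eq m a v : update m a v a = v.
Proof. by rewrite /update eqxx. Qed.

Lemma update_neq m a v b : b != a -> update m a v b = m b.
Proof. by rewrite /update => /negbTE ->. Qed.

(** * Correctness and step count of the program *)

Section Correct.
Variables (s : nat) (w : seq nat) (W : nat).
Local Notation n := (cell w 1).
Local Notation z := (size w).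

Definition D_upto k := cell w 3 * (\prod_(i < s) cell w (5 + 2 * i)) *
  \prod_(j < k) (cell w (rec_addr s j.+1 + 1) * cell w (rec_addr s j.+1 + 3)).
Definition D_of := D_upto n.
Definition P_of := if n == 0 then 0 else cell w (4 + 2 * s) * (D_of %/ cell w (5 + 2 * s)).

Local Notation D := D_of.
Local Notation P := P_of.
Local Notation rx := (rx_of s w D).
Local Notation cls := (cls_of s w).
Local Notation K0 := (K0_of w D).
Local Notation K := (K_of w D).
Local Notation data := (holds_data w D P).
Local Notation M := (nstates s n).
Local Notation Y := (nmoves s n).
Local Notation L := (3 * n).
Local Notation entry := (entry s n P rx cls K0 K).
Local Notation next_state := (next_state s n P rx cls).
Local Notation move_cost := (move_cost s n rx K0 K).

Hypothesis size_w : z = 3 + 2 * s + n * (4 + s).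
Hypothesis cell_le : forall a, cell w a <= W.
Hypothesis D_le : forall k, k <= n -> D_upto k <= W.
Hypothesis P_le : P <= W.
Hypothesis idx_le : (L + 1) * M <= W.
Hypothesis Y_le : Y <= W.
Hypothesis entry_le : forall l x x' y, l <= L -> (entry l x).1 + move_cost x' y <= W.
Hypothesis avail_le : forall x, avail n P rx x <= W.
Hypothesis rx_le : forall e, e <= n -> rx e <= W.

Hypothesis cls_lt : forall e, 0 < e <= n -> 0 < cls e < 2 ^ s.
Hypothesis P_gt0 : 0 < n -> 0 < P.

Lemma z_le : z <= W. Proof. exact: (cell_le 0). Qed.

Lemma n_le_z : n < z. Proof. by rewrite size_w; nia. Qed.

Lemma cell_out a : z < a -> cell w a = 0.
Proof. by move=> za; rewrite /cell /load_word nth_default. Qed.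

Lemma wp_scale : wp W (c_scale s) (load_word w) (1 + (n * (1 + 2) + 2 + 1))
  (fun m => data m /\ forall a, z + 8 <= a -> m a = 0).
Proof.
have nz := n_le_z; have zW := z_le.
have bd : bounded W (load_word w) by move=> a; apply: cell_le.
have mE a : load_word w a = cell w a by [].
apply: wp_seq; apply: wp_store => //.
  rewrite -[eval _ _]/(cell w 3 * eval (load_word w) (EProd _ s)) eval_prod.
  by have := D_le (leq0n n); rewrite /D_upto big_ord0 muln1.
set v := eval _ (_ * _)%X; have vE : v = D_upto 0.
  rewrite /v /D_upto big_ord0 muln1.
  by rewrite -[eval _ _]/(cell w 3 * eval (load_word w) (EProd _ s)) eval_prod.
have -> : eval (load_word w) (reg_addr 0) = z + 1 by [].
rewrite {}vE {v}; set m1 := update _ _ _.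
have bm1 : bounded W m1 by apply: bounded_update => //; apply: D_le.
have m1z : m1 0 = z by rewrite /m1 update_neq //; lia.
apply: wp_seq; apply: (@wp_for W z 5 e_n _ m1 n 1
  (fun i m => [/\ forall a, a <= z -> m a = cell w a, m (z + 1) = D_upto i,
     m (z + 6) = i & forall a, z < a -> a != z + 1 -> a != z + 6 -> m a = 0])) => //.
- split.
  + by move=> a az; rewrite /m1 !update_neq //; lia.
  + by rewrite /m1 update_neq ?update_eq //; lia.
  + by rewrite update_eq.
  + by move=> a az a1 a6; rewrite /m1 !update_neq // mE cell_out.
- move=> i m i_le [h1 h2 h3 h4]; split=> //; first by rewrite h1.
  by rewrite /= h1 //; lia.
- move=> i m i_lt bm [h1 h2 h3 h4].
  have m0 : m 0 = z by rewrite h1.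
  have a1 : rec_addr s i.+1 + 1 <= z by apply: rec_addr_le => //; lia.
  have a3 : rec_addr s i.+1 + 3 <= z by apply: rec_addr_le => //; lia.
  set e := (e_D * _)%X.
  have eE : eval m e = D_upto i.+1.
    have r1 : eval m (e_rec s (e_j + 1%N)) = rec_addr s i.+1.
      by rewrite /= m0 h3 addn1.
    rewrite -[LHS]/(m (m 0 + 1) * (m (eval m (e_rec s (e_j + 1%N)) + 1) *
      m (eval m (e_rec s (e_j + 1%N)) + 3))) r1 m0 h2 !h1 //.
    by rewrite /D_upto big_ord_recr [RHS]mulnA.
  apply: wp_store; rewrite ?eE ?D_le //= m0.
  split.
  + by rewrite update_neq //; lia.
  + by rewrite update_neq //; lia.
  + split.
    * by move=> a az; rewrite !update_neq ?h1 //; lia.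
    * by rewrite update_neq ?update_eq //; lia.
    * by rewrite update_eq.
    * by move=> a az b1 b6; rewrite !update_neq ?h4.
- move=> m bm [h1 h2 h3 h4].
  have m0 : m 0 = z by rewrite h1.
  set e := (_ * _)%X; have eE : eval m e = P.
    (* Without jobs the cell [5 + 2 * s] is the register [z + 2], which is still 0, and division by
       0 gives 0 as [P_of] demands. *)
    rewrite /= m0 h2 /P_of -/D_of; have [n0|n0] := eqVneq n 0.
      have z1 : 5 + 2 * s = z + 2 by rewrite size_w n0; lia.
      by rewrite z1 (h4 (z + 2)) ?divn0 ?muln0 //; lia.
    by rewrite !h1 // size_w; nia.
  apply: wp_store; rewrite ?eE //= m0; split.
  + split; [|by rewrite update_neq //; lia|by rewrite update_eq].
    by move=> a az; rewrite !update_neq ?h1 //; lia.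
  + by move=> a az; rewrite update_neq ?h4 //; lia.
Qed.

Definition tab_cell i := 2 * z + 8 + 2 * i.
Definition entry_at i := entry (i %/ M) (i %% M).

Lemma M_gt0 : 0 < M. Proof. by rewrite expn_gt0. Qed.

Lemma entry_atE l x : x < M -> entry_at (l * M + x) = entry l x.
Proof.
move=> xM; rewrite /entry_at divnMDl ?M_gt0 // modnMDl.
by rewrite divn_small // modn_small // addn0.
Qed.

Lemma eval_M m : data m -> eval m (e_M s) = M.
Proof. by move=> dm; rewrite /e_M eval_pow (eval_N size_w dm). Qed.

Lemma eval_Y m : data m -> eval m (e_Y s) = Y.
Proof.
by move=> dm; rewrite -[LHS]/(eval m e_N * moves_per_job s) (eval_N size_w dm).
Qed.

Lemma eval_L m : data m -> eval m e_L = L.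
Proof. by move=> dm; rewrite -[LHS]/(3 * eval m e_n) (eval_n size_w dm). Qed.

Lemma eval_tab_addr m e : data m -> eval m (tab_addr e) = tab_cell (eval m e).
Proof.
by move=> dm; rewrite /= (mem0 dm) /tab_cell; lia.
Qed.

Lemma data_update m a v : data m -> z + 3 <= a -> data (update m a v).
Proof.
move=> [h1 h2 h3] az; split; rewrite ?update_neq //; try lia.
by move=> b bz; rewrite update_neq ?h1 //; lia.
Qed.

(* The first [k] entries of the table are final, and entry [k] holds [acc]. *)
Definition filling k (acc : nat * nat) m :=
  [/\ data m, m (z + 3) = k,
      forall i, i < k -> m (tab_cell i) = (entry_at i).1 /\
                         m (tab_cell i).+1 = (entry_at i).2,
      m (tab_cell k) = acc.1 /\ m (tab_cell k).+1 = acc.2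
    & forall a, z + 8 <= a -> (a < tab_cell 0) || (tab_cell k.+1 <= a) -> m a = 0].

Lemma filling_reg k acc m a v : filling k acc m -> z + 4 <= a < z + 8 ->
  filling k acc (update m a v).
Proof.
rewrite /filling /tab_cell => [[dm h1 h2 h3 h4] az]; split.
- by apply: data_update => //; lia.
- by rewrite update_neq //; lia.
- by move=> i ik; have [<- <-] := h2 i ik; rewrite !update_neq //; lia.
- by case: h3 => <- <-; rewrite !update_neq //; lia.
- by move=> b b1 b2; rewrite update_neq ?h4 //; lia.
Qed.

Lemma filling_value k acc m v : filling k acc m ->
  filling k (v, acc.2) (update m (tab_cell k) v).
Proof.
rewrite /filling /tab_cell => [[dm h1 h2 h3 h4]]; split.
- by apply: data_update => //; lia.
- by rewrite update_neq //; lia.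
- by move=> i ik; have [<- <-] := h2 i ik; rewrite !update_neq //; lia.
- by case: h3 => h5 h6; rewrite update_eq update_neq //; lia.
- by move=> b b1 b2; rewrite update_neq ?h4 //; lia.
Qed.

Lemma filling_move k acc m v : filling k acc m ->
  filling k (acc.1, v) (update m (tab_cell k).+1 v).
Proof.
rewrite /filling /tab_cell => [[dm h1 h2 h3 h4]]; split.
- by apply: data_update => //; lia.
- by rewrite update_neq //; lia.
- by move=> i ik; have [<- <-] := h2 i ik; rewrite !update_neq //; lia.
- by case: h3 => h5 h6; rewrite update_eq update_neq //; lia.
- by move=> b b1 b2; rewrite update_neq ?h4 //; lia.
Qed.

Lemma filling_next k m : filling k (entry_at k) m ->
  filling k.+1 (0, 0) (update m (z + 3) k.+1).
Proof.
rewrite /filling /tab_cell => [[dm h1 h2 h3 h4]]; split.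
- by apply: data_update => //; lia.
- by rewrite update_eq.
- move=> i; rewrite ltnS leq_eqVlt => /predU1P [->|ik].
    by case: h3 => <- <-; rewrite !update_neq //; lia.
  by have [<- <-] := h2 i ik; rewrite !update_neq //; lia.
- by rewrite !update_neq ?h4 //; lia.
- by move=> b b1 b2; rewrite update_neq ?h4 //; lia.
Qed.

Lemma wp_relax l x y m (k := l.+1 * M + x)
    (f := fun y => (entry l (next_state x y)).1) acc :
  l < L -> x < M -> y < Y -> bounded W m -> filling k acc m ->
  m (z + 4) = x -> m (z + 5) = y ->
  wp W (c_relax s) m 3 (fun m' =>
    [/\ filling k (relax f (move_cost x) acc y) m', m' (z + 4) = x & m' (z + 5) = y]).
Proof.
move=> lL xM yY bm fm mx my; have [dm mk tab [cur1 cur2] _] := fm.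
have nx := next_lt P rx cls x yY.
have prevE : eval m (e_prev s) = f y.
  rewrite /e_prev eval_load eval_tab_addr //.
  rewrite -[eval m _]/(eval m e_idx - eval m e_x - eval m (e_M s) + eval m (e_next s)).
  rewrite (eval_next size_w dm mx my yY) eval_M // !(eval_Reg dm) mk mx.
  have -> : k - x - M = l * M by rewrite /k addnK mulSn addKn.
  have [|-> _] := tab (l * M + next_state x y); last by rewrite entry_atE.
  by rewrite /k mulSn; lia.
have curE : eval m e_cur = acc.1.
  rewrite /e_cur eval_load eval_tab_addr // (eval_Reg dm) mk.
  exact: cur1.
have costE := eval_cost_move size_w dm mx my yY.
have newE : eval m (e_prev s + e_cost s)%X = f y + move_cost x y.
  by rewrite -[LHS]/(eval m (e_prev s) + eval m (e_cost s)) prevE costE.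
have condE : (eval m (e_better s) != 0) =
    (f y != 0) && ((acc.1 == 0) || (f y + move_cost x y < acc.1)).
  rewrite /e_better holds_and prevE eval_cond curE.
  rewrite (fun_if (fun v => v != 0)) holds_lt newE curE.
  by case: (acc.1 == 0).
have addrE : eval m (tab_addr e_idx) = tab_cell k.
  by rewrite eval_tab_addr // (eval_Reg dm) mk.
apply: wp_if => //.
  rewrite condE => cond; rewrite /relax cond.
  have -> : 2 = 1 + 1 by [].
  apply: wp_seq; apply: wp_store => //; first by rewrite newE entry_le // ltnW.
  rewrite addrE newE.
  have fm1 := filling_value (f y + move_cost x y) fm.
  set m1 := update _ _ _ in fm1 *; have [dm1 mk1 _ _ _] := fm1.
  have m1x : m1 (z + 4) = x by rewrite /m1 update_neq // /tab_cell; lia.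
  have m1y : m1 (z + 5) = y by rewrite /m1 update_neq // /tab_cell; lia.
  have yE : eval m1 e_y = y by rewrite (eval_Reg dm1).
  have aE : eval m1 (tab_addr e_idx + 1%N)%X = (tab_cell k).+1.
    rewrite -[LHS]/(eval m1 (tab_addr e_idx) + 1) eval_tab_addr //.
    by rewrite (eval_Reg dm1) mk1 addn1.
  have bm1 : bounded W m1.
    by apply: bounded_update => //; rewrite entry_le // ltnW.
  apply: wp_store => //; first by rewrite yE; apply: leq_trans (ltnW yY) Y_le.
  rewrite aE yE; split.
  - exact: (filling_move y fm1).
  - by rewrite update_neq // /tab_cell; lia.
  - by rewrite update_neq // /tab_cell; lia.
move=> e0; apply: (@wp_weaken W _ _ 1 2 (fun m' =>
  [/\ filling k (relax f (move_cost x) acc y) m', m' (z + 4) = x & m' (z + 5) = y])) => //.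
apply: wp_skip => //; split=> //.
have : (eval m (e_better s) != 0) = false by rewrite e0.
by rewrite condE /relax => ->.
Qed.

Definition table_steps := (L + 1) * M * (1 + (Y * (3 + 2) + 2).+1 + 2) + 2.

Lemma wp_table m : bounded W m -> data m -> (forall a, z + 8 <= a -> m a = 0) ->
  wp W (c_table s) m table_steps (filling ((L + 1) * M) (0, 0)).
Proof.
move=> bm dm m0; have Mp := M_gt0.
apply: (@wp_for W z 2 _ _ m ((L + 1) * M) _ (fun k m => filling k (0, 0) m)) => //.
- exact: mem0 dm.
- split=> //.
  + by apply: data_update => //; lia.
  + by rewrite update_eq.
  + by rewrite !update_neq ?m0 // /tab_cell; lia.
  + by move=> a az _; rewrite update_neq ?m0 //; lia.
- move=> k m1 _ [dm1 mk _ _ _]; split; [exact: mem0 dm1|by []|].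
  rewrite -[LHS]/((eval m1 e_L + 1) * eval m1 (e_M s)).
  by rewrite eval_L // eval_M.
- move=> k m1 kM bm1 fm1; have [dm1 mk _ _ _] := fm1.
  set x := k %% M; have xM : x < M by rewrite ltn_mod.
  have xE : eval m1 (EMod e_idx (e_M s)) = x.
    by rewrite eval_mod (eval_Reg dm1) mk eval_M.
  apply: wp_seq; apply: wp_store => //.
    by rewrite xE; apply: leq_trans (ltnW xM) (leq_trans _ idx_le); nia.
  rewrite xE; have -> : eval m1 (reg_addr 3) = z + 4 by rewrite /= (mem0 dm1).
  have {}fm1 : filling k (0, 0) (update m1 (z + 4) x) by apply: filling_reg => //; lia.
  have {}bm1 : bounded W (update m1 (z + 4) x).
    apply: bounded_update => //.
    by apply: leq_trans (ltnW xM) (leq_trans _ idx_le); nia.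
  have mx : update m1 (z + 4) x (z + 4) = x by rewrite update_eq.
  set m2 := update _ _ _ in fm1 bm1 mx *.
  have [dm2 mk2 _ _ _] := fm1.
  have aE : eval m2 (tab_addr e_idx) = tab_cell k.
    by rewrite eval_tab_addr // (eval_Reg dm2) mk2.
  have idxE : eval m2 e_idx = k by rewrite (eval_Reg dm2) mk2.
  have done_ m' : filling k (entry_at k) m' -> [/\ m' 0 = z, m' (z + 3) = k &
      filling k.+1 (0, 0) (update m' (z + 3) k.+1)].
    move=> fm'; have [dm' mk' _ _ _] := fm'.
    by split; [exact: mem0 dm'|by []|exact: filling_next].
  apply: wp_if => //.
    rewrite holds_lt idxE eval_M // => kM'.
    apply: (@wp_weaken W _ _ 1 _ (filling k (entry_at k))).
    - by lia.
    - by move=> m' _ /done_.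
    have fE := eval_final size_w dm2 mx.
    have xk : x = k by rewrite /x modn_small.
    have entryE : entry_at k = (final_value n P rx x, 0).
      by rewrite -[k]/(0 * M + k) entry_atE // xk.
    apply: wp_store => //.
      rewrite fE; have := @entry_le 0 x 0 0 (leq0n _).
      by apply: leq_trans; rewrite leq_addr.
    by rewrite aE fE entryE; exact: (filling_value _ fm1).
  move=> e0; have Mk : M <= k.
    by rewrite leqNgt -idxE -(eval_M dm2) -holds_lt e0.
  have [l kE] : exists l, k = l.+1 * M + x.
    have := divn_eq k M; have : 0 < k %/ M by rewrite divn_gt0.
    by case: (k %/ M) => // l _ ->; exists l.
  have lL : l < L.
    have : l.+1 * M < (L + 1) * M by lia.
    by rewrite ltn_pmul2r //; lia.
  set f := fun y => (entry l (next_state x y)).1.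
  apply: (@wp_for W z 4 _ _ m2 Y 3 (fun y m' =>
    [/\ filling k (foldl (relax f (move_cost x)) (0, 0) (iota 0 y)) m',
        m' (z + 4) = x & m' (z + 5) = y])) => //.
  + exact: mem0 dm2.
  + split; [|by rewrite update_neq //; lia|by rewrite update_eq].
    by apply: filling_reg => //; lia.
  + move=> y m' _ [fm' mx' my']; have [dm' _ _ _ _] := fm'.
    by split; [exact: mem0 dm'|by []|exact: eval_Y].
  + move=> y m' yY bm' [fm' mx' my']; rewrite kE in fm'.
    apply: wp_weaken (wp_relax lL xM yY bm' fm' mx' my') => //.
    move=> m3 bm3; rewrite -kE => [[fm3 mx3 my3]].
    have [dm3 _ _ _ _] := fm3; split; [exact: mem0 dm3|by []|split].
    * have -> : iota 0 y.+1 = iota 0 y ++ [:: y] by rewrite -[y.+1]addn1 iotaD.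
      rewrite foldl_cat /=.
      by apply: filling_reg => //; lia.
    * by rewrite update_neq //; lia.
    * by rewrite update_eq.
  + move=> m' _ [fm' _ _]; apply: done_.
    suff -> : entry_at k = foldl (relax f (move_cost x)) (0, 0) (iota 0 Y) by [].
    by rewrite kE entry_atE.
Qed.

Definition buf_cell i := z + 8 + i.
Definition slot c i := buf_cell (2 * n + 1 + (s + 2) * c + i).
Definition full_table m := forall i, i < (L + 1) * M ->
  m (tab_cell i) = (entry_at i).1 /\ m (tab_cell i).+1 = (entry_at i).2.

Definition buffer (Js Qs : seq (nat * nat)) m :=
  [/\ forall e t, (e, t) \in Js ->
        m (buf_cell (2 * (e - 1))) = t.-1 /\ m (buf_cell (2 * (e - 1) + 1)) = D,
      m (buf_cell (2 * n)) = size Qs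
    & forall c, c < size Qs -> let q := nth (0, 0) Qs c in
        [/\ forall i, i < s -> m (slot c i) = bit q.1 i,
            m (slot c s) = (rx q.2).-1 & m (slot c s.+1) = D]].

Definition walking k x y m :=
  [/\ data m, full_table m, m (z + 3) = k, m (z + 4) = x & m (z + 5) = y].

Lemma rx_of_gt0 e : 0 < e <= n -> 0 < rx e.
Proof. by rewrite /rx_of; case: e => //= e _; rewrite addn1. Qed.

Lemma eval_buf_addr m e : data m -> eval m (buf_addr e) = buf_cell (eval m e).
Proof. by move=> dm; rewrite /= (mem0 dm). Qed.

(** Up to [n] replenishments fit into the [z] cells between the start of the buffer and the table,
    because their encoding together with the starting times is no longer than the input. *)
Lemma slot_lt c i : c < n -> i < s + 2 -> slot c i < tab_cell 0.
Proof.
move=> cn i_s; rewrite /slot /buf_cell /tab_cell size_w.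
have : (s + 2) * c.+1 <= (s + 2) * n by rewrite leq_mul2l cn orbT.
by rewrite mulnS; lia.
Qed.

Lemma slot_mono c c' i : c' < c -> i < s + 2 -> slot c' i < slot c 0.
Proof.
move=> cc i_s; rewrite /slot /buf_cell.
have : (s + 2) * c'.+1 <= (s + 2) * c by rewrite leq_mul2l cc orbT.
by rewrite mulnS; lia.
Qed.

Lemma walking_update k x y m a v : walking k x y m -> buf_cell 0 <= a < tab_cell 0 ->
  walking k x y (update m a v).
Proof.
rewrite /walking /buf_cell /tab_cell => [[dm ft mk mx my]] az; split.
- by apply: data_update => //; lia.
- move=> i ik; have [<- <-] := ft i ik.
  by rewrite /tab_cell; rewrite !update_neq //; lia.
- by rewrite update_neq //; lia.
- by rewrite update_neq //; lia.
- by rewrite update_neq //; lia.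
Qed.

Lemma wp_start_job k x y Js Qs m : bounded W m -> walking k x y m -> y < Y ->
  sound s n P rx cls x Js Qs -> buffer Js Qs m ->
  wp W (c_start_job s) m 3
    (fun m' => walking k x y m' /\ buffer (add_job s n P rx cls x y Js) Qs m').
Proof.
move=> bm wm yY snd [bJ bc bQ]; have [dm ft mk mx my] := wm.
have jn : job s y <= n by rewrite -ltnS job_lt.
have sch := holds_sched size_w dm mx my yY.
have jE : eval m (e_job s) = job s y by rewrite (eval_job _ dm my).
have snd' := sound_next erefl rx_of_gt0 cls_lt P_gt0 yY snd.
have nz := n_le_z.
apply: wp_if => //; last first.
  move=> e0; apply: (@wp_weaken W _ _ 1 2 (fun m' => walking k x y m' /\
     buffer (add_job s n P rx cls x y Js) Qs m')) => //.
  have : (eval m (e_sched s) != 0) = false by rewrite e0.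
  by rewrite sch /add_job => ->; apply: wp_skip.
rewrite sch => hs; rewrite /add_job hs in snd' *.
have /and3P [j0 _ _] := hs.
set e := job s y in jE j0 jn snd' *.
have avE := eval_avail size_w dm mx.
have a1E : eval m (buf_addr (2%N * (e_job s - 1%N))) = buf_cell (2 * (e - 1)).
  by rewrite eval_buf_addr // -[eval m _]/(2 * (eval m (e_job s) - 1)) jE.
have v1E : eval m (e_avail s - 1%N)%X = (avail n P rx x).-1.
  by rewrite -[LHS]/(eval m (e_avail s) - 1) avE subn1.
have v1W : (avail n P rx x).-1 <= W by apply: leq_trans (leq_pred _) (avail_le _).
have -> : 2 = 1 + 1 by [].
apply: wp_seq; apply: wp_store => //; first by rewrite v1E.
rewrite a1E v1E.
have wm1 : walking k x y (update m (buf_cell (2 * (e - 1))) (avail n P rx x).-1).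
  by apply: walking_update => //; rewrite /buf_cell /tab_cell; rewrite size_w; nia.
have bm1 := bounded_update (buf_cell (2 * (e - 1))) bm v1W.
set m1 := update _ _ _ in wm1 bm1 *; have [dm1 _ _ _ my1] := wm1.
have jE1 : eval m1 (e_job s) = e by rewrite (eval_job _ dm1 my1).
have a2E : eval m1 (buf_addr (2%N * (e_job s - 1%N) + 1%N)) = buf_cell (2 * (e - 1) + 1).
  by rewrite eval_buf_addr // -[eval m1 _]/(2 * (eval m1 (e_job s) - 1) + 1) jE1.
apply: wp_store => //; first by rewrite (eval_D dm1) D_le.
rewrite a2E (eval_D dm1); split.
  by apply: walking_update => //; rewrite /buf_cell /tab_cell; rewrite size_w; nia.
split.
- move=> e' t; rewrite mem_rcons inE => /predU1P [[-> ->]|h].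
    by rewrite update_eq /m1 update_neq ?update_eq // /buf_cell; lia.
  have ee : e' != e.
    have [[_ u _] _ _ _ _] := snd'; move: u; rewrite /unzip1 map_rcons rcons_uniq.
    case/andP=> /mapP en _; apply/eqP => ee; apply: en.
    by exists (e', t).
  have [[_ _ _] HJ _ _ _] := snd; have [e'n _ _ _ _] := HJ _ _ h.
  have [<- <-] := bJ _ _ h.
  by rewrite /m1 !update_neq // /buf_cell; lia.
- by rewrite /m1 !update_neq // /buf_cell; lia.
- move=> c cQ /=; have [h1 h2 h3] := bQ c cQ.
  split=> [i is_||]; [rewrite -h1 //|rewrite -h2|rewrite -h3];
    by rewrite /m1 !update_neq // /slot /buf_cell; lia.
Qed.

Lemma wp_bits k0 x y m c k : bounded W m -> walking k0 x y m -> y < Y ->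
  m (buf_cell (2 * n)) = c -> c < n -> k <= s ->
  wp W (c_bits s k) m k.+1 (fun m' =>
    (forall a, ~~ (slot c 0 <= a < slot c k) -> m' a = m a) /\
    forall i, i < k -> m' (slot c i) = bit (kind s y) i).
Proof.
move=> bm wm yY mc cn; elim: k => [|k IH] ks; first by apply: wp_skip.
have -> : k.+2 = k.+1 + 1 by rewrite addn1.
apply: wp_seq; apply: wp_weaken (IH (ltnW ks)) => // m1 bm1 [fr h].
have [dm ft mk mx my] := wm.
have nc a : a < slot c 0 -> m1 a = m a by move=> ac; apply: fr; rewrite leqNgt ac.
have s0 : slot c 0 = z + 8 + (2 * n + 1 + (s + 2) * c) by rewrite /slot /buf_cell addn0.
have dm1 : data m1.
  have [d1 d2 d3] := dm; split.
  - by move=> a az; rewrite nc ?d1 //; lia.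
  - by rewrite nc //; lia.
  - by rewrite nc //; lia.
have my1 : m1 (z + 5) = y by rewrite nc //; lia.
have cE : eval m1 e_cnt = c.
  rewrite /e_cnt eval_load eval_buf_addr // -[eval m1 _]/(2 * eval m1 e_n).
  by rewrite (eval_n size_w dm1) nc // /buf_cell; lia.
have aE : eval m1 (e_slot s k) = slot c k.
  rewrite /e_slot eval_buf_addr //.
  rewrite -[eval m1 _]/(2 * eval m1 e_n + 1 + (s + 2) * eval m1 e_cnt + k).
  by rewrite (eval_n size_w dm1) cE.
have vE : eval m1 (e_bit (e_kind s) k) = bit (kind s y) k.
  by rewrite eval_bit (eval_kind _ dm1 my1).
apply: wp_store => //.
  by rewrite vE; apply: leq_trans (bit_le1 _ _) (leq_trans _ z_le); rewrite size_w.
rewrite aE vE; split.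
- move=> a; rewrite negb_and -!ltnNge => ac; rewrite update_neq ?fr //.
    by move: ac; rewrite /slot /buf_cell; lia.
  by move: ac; rewrite /slot /buf_cell; lia.
- move=> i; rewrite ltnS leq_eqVlt => /predU1P [->|ik]; first by rewrite update_eq.
  by rewrite update_neq ?h // /slot /buf_cell; lia.
Qed.

Lemma wp_replenish k x y Js Qs m : bounded W m -> walking k x y m -> y < Y ->
  (forall e t, (e, t) \in Js -> 0 < e <= n) -> buffer Js Qs m ->
  size (add_repl s n rx x y Qs) <= n ->
  wp W (c_replenish s) m (s + 5)
    (fun m' => walking k x y m' /\ buffer Js (add_repl s n rx x y Qs) m').
Proof.
move=> bm wm yY Jn [bJ bc bQ] szQ; have [dm ft mk mx my] := wm.
have jn : job s y <= n by rewrite -ltnS job_lt.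
have rp := holds_repl size_w dm mx my yY.
have nz := n_le_z.
rewrite addnS; apply: wp_if => //; last first.
  move=> e0; apply: (@wp_weaken W _ _ 1 _ (fun m' => walking k x y m' /\
     buffer Js (add_repl s n rx x y Qs) m')) => //; first by lia.
  have : (eval m (e_repl s) != 0) = false by rewrite e0.
  by rewrite rp /add_repl => ->; apply: wp_skip.
rewrite rp /add_repl => hr; rewrite /add_repl hr size_rcons in szQ; rewrite hr.
set c := size Qs in bc bQ szQ.
have s0 : slot c 0 = z + 8 + (2 * n + 1 + (s + 2) * c) by rewrite /slot /buf_cell addn0.
have sl i : slot c i = slot c 0 + i by rewrite /slot /buf_cell; lia.
have sT : slot c s.+1 < tab_cell 0 by apply: slot_lt => //; lia.
have -> : s + 4 = s.+1 + (1 + (1 + 1)) by lia.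
apply: wp_seq; apply: wp_weaken (wp_bits bm wm yY bc szQ (leqnn s)) => // m1 bm1 [fr bits].
have fr1 a : a < slot c 0 -> m1 a = m a by move=> ac; apply: fr; rewrite leqNgt ac.
have wm1 : walking k x y m1.
  have [d1 d2 d3] := dm; split; try (by rewrite fr1 //; lia).
  - split; try (by rewrite fr1 //; lia).
    by move=> a az; rewrite fr1 ?d1 //; lia.
  - move=> i ik; have [<- <-] := ft i ik.
    have : slot c s < tab_cell i by move: sT; rewrite sl (sl s) /tab_cell; lia.
    by move=> h; rewrite !fr //; lia.
have cnt m' : data m' -> m' (buf_cell (2 * n)) = c ->
    forall i, eval m' e_cnt = c /\ eval m' (e_slot s i) = slot c i.
  move=> dm' mc i; have cE : eval m' e_cnt = c.
    rewrite /e_cnt eval_load eval_buf_addr // -[eval m' _]/(2 * eval m' e_n).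
    by rewrite (eval_n size_w dm').
  split=> //; rewrite /e_slot eval_buf_addr //.
  rewrite -[eval m' _]/(2 * eval m' e_n + 1 + (s + 2) * eval m' e_cnt + i).
  by rewrite (eval_n size_w dm') cE.
have [dm1 _ _ mx1 my1] := wm1.
have mc1 : m1 (buf_cell (2 * n)) = c by rewrite fr1 // /buf_cell; lia.
have [_ a1E] := cnt m1 dm1 mc1 s.
have v1E : eval m1 (e_rx s (e_job s) - 1%N)%X = (rx (job s y)).-1.
  rewrite -[LHS]/(eval m1 (e_rx s (e_job s)) - 1) (eval_rx_job size_w dm1 my1 yY).
  by rewrite subn1.
have v1W : (rx (job s y)).-1 <= W by apply: leq_trans (leq_pred _) (rx_le jn).
apply: wp_seq; apply: wp_store => //; first by rewrite v1E.
rewrite a1E v1E.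
have wm2 : walking k x y (update m1 (slot c s) (rx (job s y)).-1).
  by apply: walking_update => //; move: sT; rewrite !(sl s) !(sl s.+1) /buf_cell; lia.
have bm2 := bounded_update (slot c s) bm1 v1W.
set m2 := update _ _ _ in wm2 bm2 *; have [dm2 _ _ _ my2] := wm2.
have mc2 : m2 (buf_cell (2 * n)) = c.
  by rewrite /m2 update_neq // sl /buf_cell; lia.
have [_ a2E] := cnt m2 dm2 mc2 s.+1.
apply: wp_seq; apply: wp_store => //; first by rewrite (eval_D dm2) D_le.
rewrite a2E (eval_D dm2).
have wm3 : walking k x y (update m2 (slot c s.+1) D).
  by apply: walking_update => //; move: sT; rewrite !(sl s.+1) /buf_cell; lia.
have bm3 := bounded_update (slot c s.+1) bm2 (D_le (leqnn n)).
set m3 := update _ _ _ in wm3 bm3 *; have [dm3 _ _ _ my3] := wm3.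
have mc3 : m3 (buf_cell (2 * n)) = c.
  by rewrite /m3 update_neq // sl /buf_cell; lia.
have [cE _] := cnt m3 dm3 mc3 0.
have v3E : eval m3 (e_cnt + 1%N)%X = c.+1.
  by rewrite -[LHS]/(eval m3 e_cnt + 1) cE addn1.
have a3E : eval m3 (buf_addr (2%N * e_n)) = buf_cell (2 * n).
  by rewrite eval_buf_addr // -[eval m3 _]/(2 * eval m3 e_n) (eval_n size_w dm3).
apply: wp_store => //; first by rewrite v3E; apply: leq_trans z_le; lia.
rewrite v3E a3E; split.
  by apply: walking_update => //; rewrite /buf_cell /tab_cell; rewrite size_w; nia.
have fr4 a : a < slot c 0 -> a != buf_cell (2 * n) ->
    update m3 (buf_cell (2 * n)) c.+1 a = m a.
  move=> ac an; rewrite update_neq // /m3 update_neq; last by rewrite sl; lia.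
  by rewrite /m2 update_neq; [rewrite fr1|rewrite sl; lia].
split.
- move=> e t h; have [<- <-] := bJ _ _ h; have en := Jn _ _ h.
  by rewrite !fr4 // /buf_cell; lia.
- by rewrite update_eq size_rcons.
- move=> c'; rewrite size_rcons ltnS leq_eqVlt => /predU1P [->|cc] /=; last first.
    rewrite nth_rcons cc; have [h1 h2 h3] := bQ c' cc.
    have sc := fun i => @slot_mono c c' i cc.
    have sb i : slot c' i != buf_cell (2 * n) by rewrite /slot /buf_cell; lia.
    split=> [i is_||]; [rewrite -h1 //|rewrite -h2|rewrite -h3];
      by rewrite fr4 ?sc //; lia.
  rewrite nth_rcons ltnn eqxx /=.
  split=> [i is_||].
  + rewrite update_neq; last by rewrite sl /buf_cell; lia.
    rewrite /m3 update_neq; last by rewrite !(sl i) (sl s.+1); lia.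
    by rewrite /m2 update_neq ?bits // (sl i) (sl s); lia.
  + rewrite update_neq; last by rewrite sl /buf_cell; lia.
    rewrite /m3 update_neq; last by rewrite (sl s) (sl s.+1); lia.
    by rewrite /m2 update_eq.
  + rewrite update_neq; last by rewrite sl /buf_cell; lia.
    by rewrite /m3 update_eq.
Qed.

Definition follow_steps := 1 + (L * (1 + (3 + (s + 5 + 1)) + 2) + 2).

Definition solved m := exists x Js Qs,
  [/\ data m, sound s n P rx cls x Js Qs, buffer Js Qs m,
      final_value n P rx x != 0
    & (entry L 0).1 = final_value n P rx x + \sum_(q <- Qs) set_cost s K0 K q.1].

Lemma wp_follow m : bounded W m -> filling ((L + 1) * M) (0, 0) m ->
  wp W (c_follow s) m follow_steps solved.
Proof.
move=> bm [dm mk tab _ zero]; have Mp := M_gt0; have nz := n_le_z; have zW := z_le.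
have L_le : L <= W by apply: leq_trans idx_le; nia.
have M_le : M <= W by apply: leq_trans idx_le; nia.
apply: wp_seq; apply: wp_store => //=; rewrite (mem0 dm).
set m1 := update _ _ _.
have bm1 : bounded W m1 by apply: bounded_update.
have dm1 : data m1 by apply: data_update => //; lia.
(* Along the walk, the value of the current entry plus the replenishment cost paid so far remains
   the optimal value. The entry stays nonzero, so the stored move is a genuine minimizer. *)
apply: (@wp_for W z 2 e_L _ m1 L (1 + (3 + (s + 5 + 1))) (fun l m => exists x Js Qs,
  [/\ exists y, walking l x y m, sound s n P rx cls x Js Qs, buffer Js Qs m,
      x < M /\ (entry (L - l) x).1 != 0
    & (entry L 0).1 = (entry (L - l) x).1 + \sum_(q <- Qs) set_cost s K0 K q.1])) => //.
- exact: mem0 dm1.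
- exists 0, [::], [::]; split.
  + exists (m1 (z + 5)); split.
    * by apply: data_update => //; lia.
    * move=> i ik; have [<- <-] := tab i ik.
      by rewrite /m1 !update_neq // /tab_cell; lia.
    * by rewrite update_eq.
    * by rewrite /m1 update_neq ?update_eq //; lia.
    * by rewrite update_neq //; lia.
  + exact: sound0.
  + split=> //.
    rewrite /m1 !update_neq ?zero // /buf_cell /tab_cell; rewrite ?size_w; nia.
  + by rewrite subn0; split=> //; apply: (entry_neq0 _ _ erefl rx_of_gt0 cls_lt P_gt0).
  + by rewrite subn0 big_nil addn0.
- move=> l m2 _ [x [Js [Qs [[y [d2 _ k2 _ _]] _ _ _ _]]]].
  by split; [exact: mem0 d2|by []|exact: eval_L].
- move=> l m2 lL bm2 [x [Js [Qs [[y0 wm2] snd bf [xM ne] val]]]].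
  have [dm2 ft2 mk2 mx2 _] := wm2.
  have LE : L - l = (L - l.+1).+1 by lia.
  rewrite LE in ne val; set y := (entry (L - l.+1).+1 x).2.
  have [yY ne' stepE] := entry_step ne; rewrite -/y in yY ne' stepE.
  have yE : eval m2 $[tab_addr ((e_L - e_idx) * e_M s + e_x) + 1%N]%X = y.
    rewrite eval_load eval_add eval_tab_addr //.
    rewrite -[eval m2 _]/((eval m2 e_L - eval m2 e_idx) * eval m2 (e_M s) + eval m2 e_x).
    rewrite eval_L // eval_M // !(eval_Reg dm2) mk2 mx2 addn1.
    have [|_ ->] := ft2 ((L - l) * M + x); last by rewrite entry_atE // LE.
    have : (L - l) * M <= L * M by rewrite leq_mul2r; lia.
    by rewrite mulnDl; lia.
  apply: wp_seq; apply: wp_store => //.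
    by rewrite yE; apply: leq_trans (ltnW yY) Y_le.
  rewrite yE; have -> : eval m2 (reg_addr 4) = z + 5 by rewrite /= (mem0 dm2).
  have bm3 := bounded_update (z + 5) bm2 (leq_trans (ltnW yY) Y_le).
  have wm3 : walking l x y (update m2 (z + 5) y).
    split.
    + by apply: data_update => //; lia.
    + move=> i ik; have [<- <-] := ft2 i ik.
      by rewrite !update_neq // /tab_cell; lia.
    + by rewrite update_neq //; lia.
    + by rewrite update_neq //; lia.
    + by rewrite update_eq.
  have bf3 : buffer Js Qs (update m2 (z + 5) y).
    case: bf => h1 h2 h3; split.
    + move=> e t /h1 [<- <-]; rewrite !update_neq // /buf_cell; lia.
    + by rewrite update_neq // /buf_cell; lia.
    + move=> c /h3 [q1 q2 q3]; split=> [i is_||].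
      * by rewrite update_neq ?q1 // /slot /buf_cell; lia.
      * by rewrite update_neq ?q2 // /slot /buf_cell; lia.
      * by rewrite update_neq ?q3 // /slot /buf_cell; lia.
  have snd' := sound_next erefl rx_of_gt0 cls_lt P_gt0 yY snd.
  apply: wp_seq; apply: wp_weaken (wp_start_job bm3 wm3 yY snd bf3) => // m4 bm4 [wm4 bf4].
  have Jn e t : (e, t) \in add_job s n P rx cls x y Js -> 0 < e <= n.
    by have [_ HJ _ _ _] := snd' => /HJ [].
  apply: wp_seq.
  apply: wp_weaken (wp_replenish bm4 wm4 yY Jn bf4 (sound_size_repl snd')) => //.
  move=> m5 bm5 [wm5 bf5]; have [dm5 ft5 mk5 mx5 my5] := wm5.
  have nE := eval_next size_w dm5 mx5 my5 yY.
  have nM := next_lt P rx cls x yY.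
  apply: wp_store => //; first by rewrite nE; apply: leq_trans (ltnW nM) M_le.
  rewrite nE; have -> : eval m5 (reg_addr 3) = z + 4 by rewrite /= (mem0 dm5).
  split.
  + by rewrite update_neq ?(mem0 dm5) //; lia.
  + by rewrite update_neq //; lia.
  exists (next_state x y), (add_job s n P rx cls x y Js), (add_repl s n rx x y Qs).
  split=> //.
  + exists y; split.
    * by apply: data_update; [apply: data_update => //; lia|lia].
    * move=> i ik; have [<- <-] := ft5 i ik.
      by rewrite !update_neq // /tab_cell; lia.
    * by rewrite update_eq.
    * by rewrite update_neq ?update_eq //; lia.
    * by rewrite !update_neq //; lia.
  + case: bf5 => h1 h2 h3; split.
    * move=> e t /h1 [<- <-]; rewrite !update_neq // /buf_cell; lia.
    * by rewrite !update_neq // /buf_cell; lia.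
    * move=> c /h3 [q1 q2 q3]; split=> [i is_||].
      -- by rewrite !update_neq ?q1 // /slot /buf_cell; lia.
      -- by rewrite !update_neq ?q2 // /slot /buf_cell; lia.
      -- by rewrite !update_neq ?q3 // /slot /buf_cell; lia.
  + by rewrite sum_add_repl val stepE; lia.
- move=> m2 _ [x [Js [Qs [[y [d2 _ _ _ _]] snd bf [xM ne] val]]]].
  by exists x, Js, Qs; rewrite subnn in ne val.
Qed.

Lemma wp_output m Js Qs : bounded W m -> data m -> buffer Js Qs m -> size Qs <= n ->
  wp W (c_output s) m (1 + (z * (1 + 2) + 2 + 1)) (fun m' =>
    read_word m' = mkseq (fun i => m (buf_cell i)) (2 * n + 1 + (s + 2) * size Qs)).
Proof.
move=> bm dm [_ bc _] szQ; set len := 2 * n + 1 + _.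
have len_z : len <= z.
  have : (s + 2) * size Qs <= (s + 2) * n by rewrite leq_mul2l szQ orbT.
  by rewrite size_w /len; nia.
have zW := z_le; have m0 := mem0 dm.
have lenE : eval m (2%N * e_n + 1%N + (s + 2)%N * e_cnt)%X = len.
  rewrite -[LHS]/(2 * eval m e_n + 1 + (s + 2) * eval m e_cnt) (eval_n size_w dm).
  rewrite /e_cnt eval_load eval_buf_addr // -[eval m (_ * _)%X]/(2 * eval m e_n).
  by rewrite (eval_n size_w dm) bc.
apply: wp_seq; apply: wp_store => //; first by rewrite lenE; lia.
rewrite lenE; have -> : eval m (reg_addr 6) = z + 7 by rewrite /= m0.
set m1 := update _ _ _.
have bm1 : bounded W m1 by apply: bounded_update => //; lia.
have m1z : m1 0 = z by rewrite /m1 update_neq //; lia.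
apply: wp_seq.
apply: (@wp_weaken W _ _ (len * (1 + 2) + 2) _ (fun m2 => [/\ m2 0 = z,
    m2 (z + 7) = len & forall k, k < len -> m2 k.+1 = m (buf_cell k)])); first by lia.
  move=> m2 bm2 [z2 l2 h2].
  have lE : eval m2 e_len = len by rewrite /= z2.
  apply: wp_store => //; first by rewrite lE; lia.
  rewrite lE /=; rewrite /read_word update_eq; apply/eq_in_map => i.
  by rewrite mem_iota => /andP [_ il]; rewrite update_neq ?h2.
apply: (@wp_for W z 5 _ _ m1 len 1 (fun i m2 => [/\ m2 0 = z, m2 (z + 7) = len,
    m2 (z + 6) = i, forall k, m2 (buf_cell k) = m (buf_cell k)
  & forall k, k < i -> m2 k.+1 = m (buf_cell k)])) => //.
- by lia.
- split=> //.
  + by rewrite update_neq //; lia.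
  + by rewrite /m1 update_neq ?update_eq //; lia.
  + by rewrite update_eq.
  + by move=> k; rewrite /m1 !update_neq // /buf_cell; lia.
- by move=> i m2 _ [h1 h2 h3 _ _]; split=> //; rewrite /= h1.
- move=> i m2 il bm2 [h1 h2 h3 h4 h5].
  have vE : eval m2 $[buf_addr e_j]%X = m (buf_cell i) by rewrite /= h1 h3 h4.
  have aE : eval m2 (e_j + 1%N)%X = i.+1 by rewrite /= h1 h3 addn1.
  apply: wp_store => //; rewrite vE // aE; split.
  + by rewrite update_neq.
  + by rewrite update_neq //; lia.
  + split.
    * by rewrite !update_neq //; lia.
    * by rewrite !update_neq //; lia.
    * by rewrite update_eq.
    * by move=> k; rewrite !update_neq ?h4 // /buf_cell; lia.
    * move=> k; rewrite ltnS leq_eqVlt => /predU1P [->|ki].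
        by rewrite update_neq ?update_eq //; lia.
      by rewrite !update_neq ?h5 //; lia.
- by move=> m2 _ [h1 h2 _ _ h5].
Qed.

Definition solve_steps := 1 + (n * (1 + 2) + 2 + 1) +
  (table_steps + (follow_steps + (1 + (z * (1 + 2) + 2 + 1)))).

Lemma wp_solve : wp W (c_solve s) (load_word w) solve_steps (fun m' =>
  exists m x Js Qs, [/\ bounded W m, sound s n P rx cls x Js Qs, buffer Js Qs m,
    final_value n P rx x != 0 /\
    (entry L 0).1 = final_value n P rx x + \sum_(q <- Qs) set_cost s K0 K q.1
  & read_word m' = mkseq (fun i => m (buf_cell i)) (2 * n + 1 + (s + 2) * size Qs)]).
Proof.
apply: wp_seq; apply: wp_weaken wp_scale => // m1 bm1 [dm1 zero1].
apply: wp_seq; apply: wp_weaken (wp_table bm1 dm1 zero1) => // m2 bm2 fm2.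
apply: wp_seq; apply: wp_weaken (wp_follow bm2 fm2) => // m3 bm3.
move=> [x [Js [Qs [dm3 snd bf fin val]]]].
apply: wp_weaken (wp_output bm3 dm3 bf (sound_size_repl snd)) => // m4 bm4 rd.
by exists m3, x, Js, Qs.
Qed.

End Correct.

(** * Decoding the input, size bounds and encoding the output *)

Lemma size_flatten_block (T : eqType) (l : seq T) (f : T -> seq nat) c :
  (forall x, size (f x) = c) -> size (flatten [seq f x | x <- l]) = size l * c.
Proof. by move=> fc; elim: l => //= x l IH; rewrite size_cat fc IH mulSn. Qed.

Lemma nth_flatten_block k (f : 'I_k -> seq nat) c r (j : 'I_k) t :
  (forall j, size (f j) = c) -> t < c ->
  nth 0 (flatten [seq f j | j <- enum 'I_k] ++ r) (j * c + t) = nth 0 (f j) t.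
Proof.
move=> fc tc; rewrite -[in RHS](nth_ord_enum j j).
have jl : j < size (enum 'I_k) by rewrite size_enum_ord.
move: (enum 'I_k) (nat_of_ord j) jl => l; elim: l => [|x l IH] [|i] //= il.
  by rewrite mul0n add0n -catA nth_cat fc tc.
rewrite -catA nth_cat fc mulSn -addnA ltnNge leq_addr /= addKn.
exact: IH.
Qed.

Lemma mkseq_add (T : Type) (f : nat -> T) a b :
  mkseq f (a + b) = mkseq f a ++ mkseq (fun i => f (a + i)) b.
Proof. by rewrite /mkseq iotaD map_cat add0n -[X in iota X b]addn0 iotaDl -map_comp. Qed.

Lemma mkseq_flatten (T : Type) (f : nat -> T) k c :
  mkseq f (k * c) = flatten (mkseq (fun j => mkseq (fun t => f (j * c + t)) c) k).
Proof.
elim: k => [|k IH]; first by rewrite mul0n.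
rewrite -[in RHS]addn1 mkseq_add flatten_cat -IH /= cats0 addn0.
by rewrite mulSn addnC mkseq_add.
Qed.

Lemma map_enum_ord (T : Type) (f : nat -> T) k : [seq f (val j) | j <- enum 'I_k] = mkseq f k.
Proof. by rewrite map_comp val_enum_ord. Qed.

Lemma encodes_ratP q u : encodes_rat q u ->
  [/\ size u = 2, 0 < nth 0 u 1 & q = ((nth 0 u 0)%:R / (nth 0 u 1)%:R)%R].
Proof. by move=> [a [b [b0 -> ->]]]. Qed.

Lemma leq_expn2r a b k : a <= b -> a ^ k <= b ^ k.
Proof. by move=> ab; case: k => // k; rewrite leq_exp2r. Qed.

Section Decode.
Variables (s : nat) (I : instance s) (w : seq nat).
Hypotheses (valid_I : valid_instance I) (equal_I : equal_proc I).
Hypothesis enc_I : encodes_instance I w.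
Local Notation n := (cell w 1).
Local Notation z := (size w).

Lemma decode : [/\ n = njobs I, z = 3 + 2 * s + n * (4 + s),
  0 < cell w 3 /\ joint_cost I = ((cell w 2)%:R / (cell w 3)%:R)%R,
  forall i : 'I_s, 0 < cell w (5 + 2 * i) /\
    res_cost I i = ((cell w (4 + 2 * i))%:R / (cell w (5 + 2 * i))%:R)%R
  & forall j : 'I_(njobs I), let r := rec_addr s j.+1 in
    [/\ 0 < cell w (r + 1) /\ proc I j = ((cell w r)%:R / (cell w (r + 1))%:R)%R,
        0 < cell w (r + 3) /\
        release I j = ((cell w (r + 2))%:R / (cell w (r + 3))%:R)%R
      & forall i : 'I_s, cell w (r + (4 + i)) = (i \in req I j)]].
Proof.
have [wK0 [wK [wp [wr [eK0 eK ep er wE]]]]] := enc_I.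
have [sK0 pK0 qK0] := encodes_ratP eK0.
have sK i : size (wK i) = 2 by have [] := encodes_ratP (eK i).
set blk := fun j => wp j ++ wr j ++ encode_set (req I j) in wE.
have sblk j : size (blk j) = 4 + s.
  have [h1 _ _] := encodes_ratP (ep j); have [h2 _ _] := encodes_ratP (er j).
  by rewrite !size_cat h1 h2 size_map size_enum_ord.
have sKf : size (flatten [seq wK i | i <- enum 'I_s]) = 2 * s.
  by rewrite (size_flatten_block _ sK) size_enum_ord mulnC.
have nI : n = njobs I by rewrite /cell /load_word wE.
have cell_w a : cell w a.+1 = nth 0 w a by [].
have c2 : cell w 2 = nth 0 wK0 0 by rewrite cell_w wE /= nth_cat sK0.
have c3 : cell w 3 = nth 0 wK0 1 by rewrite cell_w wE /= nth_cat sK0.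
have cR k : cell w (4 + k) = nth 0 (flatten [seq wK i | i <- enum 'I_s] ++
    flatten [seq blk j | j <- enum 'I_(njobs I)]) k.
  by case: eK0 wE => a [b [_ _ ->]] /= ->.
have cK (i : 'I_s) t : t < 2 -> cell w (4 + 2 * i + t) = nth 0 (wK i) t.
  by move=> t2; rewrite -addnA cR mulnC nth_flatten_block.
have cJ (j : 'I_(njobs I)) t : t < 4 + s ->
    cell w (rec_addr s j.+1 + t) = nth 0 (blk j) t.
  move=> ts; have -> : rec_addr s j.+1 + t = 4 + (2 * s + (j * (4 + s) + t)).
    by rewrite /rec_addr subn1 /=; lia.
  rewrite cR nth_cat sKf ltnNge leq_addr /= addKn.
  by rewrite -[X in nth 0 X _]cats0 (nth_flatten_block [::] j sblk ts).
split=> //.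
- by rewrite nI {1}wE /= !size_cat sK0 sKf (size_flatten_block _ sblk) size_enum_ord; lia.
- by rewrite c2 c3.
- move=> i; have [_ h1 h2] := encodes_ratP (eK i).
  have e1 : cell w (5 + 2 * i) = nth 0 (wK i) 1 by rewrite -(cK i 1) //; congr cell; lia.
  have e0 : cell w (4 + 2 * i) = nth 0 (wK i) 0 by rewrite -(cK i 0) // addn0.
  by rewrite e0 e1.
- move=> j r; have [sp h1 h2] := encodes_ratP (ep j).
  have [sr h3 h4] := encodes_ratP (er j).
  have c0 : cell w r = nth 0 (wp j) 0.
    by rewrite -[r]addn0 cJ // /blk nth_cat sp.
  have c1 : cell w (r + 1) = nth 0 (wp j) 1 by rewrite cJ // /blk nth_cat sp.
  have c4 : cell w (r + 2) = nth 0 (wr j) 0 by rewrite cJ // /blk !nth_cat sp sr.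
  have c5 : cell w (r + 3) = nth 0 (wr j) 1 by rewrite cJ // /blk !nth_cat sp sr.
  rewrite c0 c1 c4 c5; split=> // i.
  rewrite cJ ?ltn_add2l // /blk -[4 + i]/(2 + (2 + i)).
  rewrite nth_cat sp ltnNge leq_addr addKn nth_cat sr ltnNge leq_addr addKn.
  by rewrite (nth_map i) ?size_enum_ord // nth_ord_enum.
Qed.


Lemma size_cells : z = 3 + 2 * s + n * (4 + s). Proof. by have [] := decode. Qed.

Local Notation D := (D_of s w).
Local Notation P := (P_of s w).
Local Notation rx := (rx_of s w D).
Local Notation cls := (cls_of s w).
Local Notation K0 := (K0_of w D).
Local Notation K := (K_of w D).

Lemma D_of_gt0 : 0 < D.
Proof.
have [nI _ [h0 _] hK hJ] := decode.
rewrite !muln_gt0 h0 /=; apply/andP; split; apply: prodn_gt0 => i.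
  by have [] := hK i.
have iI : i < njobs I by rewrite -nI.
by have [[h1 _] [h3 _] _] := hJ (Ordinal iI); rewrite muln_gt0 h1.
Qed.

Lemma scale_div q a b : 0 < b -> b %| D -> q = (a%:R / b%:R)%R :> rat ->
  ((a * (D %/ b))%N%:R = q * D%:R :> rat)%R.
Proof.
move=> b0 bD ->.
have -> : (D%:R = (D %/ b)%:R * b%:R :> rat)%R by rewrite -natrM divnK.
have b1 : (b%:R != 0 :> rat)%R by rewrite pnatr_eq0 -lt0n.
by rewrite natrM mulrA mulrAC divfK.
Qed.

Lemma dvdn_job (j : 'I_(njobs I)) :
  cell w (rec_addr s j.+1 + 1) %| D /\ cell w (rec_addr s j.+1 + 3) %| D.
Proof.
have [nI _ _ _ _] := decode.
have jn : j < n by rewrite nI.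
have dj : cell w (rec_addr s j.+1 + 1) * cell w (rec_addr s j.+1 + 3) %| D.
  by rewrite /D_of /D_upto (bigD1 (Ordinal jn)) //= dvdn_mull // dvdn_mulr.
by split; apply: dvdn_trans dj; [apply: dvdn_mulr|apply: dvdn_mull].
Qed.

Lemma scale_joint_of : (K0%:R = joint_cost I * D%:R :> rat)%R.
Proof.
have [_ _ [h0 h1] _ _] := decode; apply: scale_div => //.
by rewrite /D_of /D_upto -mulnA dvdn_mulr.
Qed.

Lemma scale_res_of (i : 'I_s) : ((K i)%:R = res_cost I i * D%:R :> rat)%R.
Proof.
have [_ _ _ hK _] := decode; have [h0 h1] := hK i; apply: scale_div => //.
rewrite /D_of /D_upto (bigD1 i) //= -!mulnA dvdn_mull // dvdn_mulr //.
Qed.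

Lemma scale_release_of (j : 'I_(njobs I)) :
  ((rx j.+1)%:R = release I j * D%:R + 1 :> rat)%R.
Proof.
have [_ _ _ _ hJ] := decode; have [_ [h0 h1] _] := hJ j.
by rewrite /rx_of /= natrD (scale_div h0 _ h1) //; have [] := dvdn_job j.
Qed.

(** [P] comes from the first record; equality of the processing times carries it over to all
    jobs. *)
Lemma scale_proc_of (j : 'I_(njobs I)) : (P%:R = proc I j * D%:R :> rat)%R.
Proof.
have [nI _ _ _ hJ] := decode; have [p pE] := equal_I.
have n0 : 0 < njobs I by apply: leq_ltn_trans (ltn_ord j).
have [[h0 h1] _ _] := hJ (Ordinal n0); have [d _] := dvdn_job (Ordinal n0).
rewrite pE -(pE (Ordinal n0)) /P_of nI gtn_eqF //.
rewrite /= /rec_addr subnn mul0n addn0 addn1 in h0 h1 d.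
exact: scale_div h1.
Qed.

Lemma cls_code (j : 'I_(njobs I)) : cls j.+1 = code (req I j).
Proof.
have [_ _ _ _ hJ] := decode; have [_ _ h] := hJ j.
by apply: eq_bigr => i _; rewrite h.
Qed.

Lemma cls_of_req (j : 'I_(njobs I)) (i : 'I_s) :
  (bit (cls j.+1) i != 0) = (i \in req I j).
Proof. by rewrite cls_code bit_code eqb0 negbK. Qed.

Lemma cls_of_lt e : 0 < e <= n -> 0 < cls e < 2 ^ s.
Proof.
have [nI _ _ _ _] := decode; case: e => //= e; rewrite nI => en.
have [_ _ hr _ _] := valid_I.
by rewrite (cls_code (Ordinal en)) code_lt lt0n code_eq0 hr.
Qed.

Lemma P_of_gt0 : 0 < n -> 0 < P.
Proof.
have [nI _ _ _ _] := decode; rewrite nI => n0; have [hp _ _ _ _] := valid_I.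
rewrite -(ltr_nat rat) (scale_proc_of (Ordinal n0)) mulr_gt0 ?hp //.
by rewrite ltr0n D_of_gt0.
Qed.

(** * Polynomial bounds on values and steps *)

Local Notation Om := (word_size w).

Lemma size_le_word (u : seq nat) : size u <= word_size u.
Proof.
rewrite /word_size; elim: u => [|x u IH]; first by rewrite big_nil.
by rewrite big_cons /=; have := bitlen_gt0 x; lia.
Qed.

Lemma cell_le_pow a : cell w a <= 2 ^ Om.
Proof.
case: a => [|a]; first by apply: leq_trans (size_le_word w) (ltnW (ltn_expl _ _)).
rewrite /cell /load_word /=; have [aw|aw] := ltnP a z; last by rewrite nth_default.
apply: leq_trans (ltnW (ltn_bitlen _)) _; rewrite leq_exp2l //.
by rewrite /word_size (big_rem _ (mem_nth 0 aw)) /= leq_addr.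
Qed.

(** The common denominator is a product of [1 + s + 2 * n] input numbers, each at most [2 ^ Om], and
    [n <= Om]. All other quantities are bounded by constant powers of this number. *)
Definition magnitude := 2 ^ (Om * (1 + s + 2 * Om)).
Local Notation X := magnitude.

Lemma prod_le_exp k (f : nat -> nat) c : (forall i, f i <= c) ->
  \prod_(i < k) f i <= c ^ k.
Proof.
move=> fc; elim: k => [|k IH]; first by rewrite big_ord0.
by rewrite big_ord_recr /= expnSr leq_mul.
Qed.

Lemma n_lt_z : n < z. Proof. by rewrite size_cells; nia. Qed.

Lemma D_upto_le k : k <= n -> D_upto s w k <= X.
Proof.
move=> kn; have kz := leq_trans kn (ltnW n_lt_z); have zO := size_le_word w.
apply: (@leq_trans (2 ^ Om * (2 ^ Om) ^ s * (2 ^ Om * 2 ^ Om) ^ k)).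
  apply: leq_mul; [apply: leq_mul; first exact: cell_le_pow|].
    by apply: (prod_le_exp _ (fun i => cell_le_pow (5 + 2 * i))).
  apply: (@prod_le_exp k (fun j => cell w (rec_addr s j.+1 + 1) *
    cell w (rec_addr s j.+1 + 3))) => j.
  by apply: leq_mul; apply: cell_le_pow.
by rewrite -expnD -!expnM -!expnD leq_exp2l //; nia.
Qed.

Lemma word_size_gt0 : 0 < Om.
Proof. by apply: leq_trans (size_le_word w); rewrite size_cells. Qed.

Lemma leq_pow_X : 2 ^ Om <= X.
Proof. by rewrite leq_exp2l // leq_pmulr. Qed.

Lemma X_ge2 : 2 <= X.
Proof.
by apply: leq_trans leq_pow_X; rewrite -[X in X <= _]expn1 leq_exp2l // word_size_gt0.
Qed.

Lemma cell_le_X a : cell w a <= X.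
Proof. exact: leq_trans (cell_le_pow a) leq_pow_X. Qed.

Lemma n_lt_X : n < X.
Proof. exact: leq_trans n_lt_z (cell_le_X 0). Qed.

Lemma leq_X_exp i j : i <= j -> X ^ i <= X ^ j.
Proof. by move=> ij; rewrite leq_pexp2l // (leq_trans _ X_ge2). Qed.

Lemma scaled_le a b : cell w a * (D %/ cell w b) <= X ^ 2.
Proof.
rewrite -mulnn leq_mul ?cell_le_X //.
exact: leq_trans (leq_div _ _) (D_upto_le (leqnn n)).
Qed.

Lemma rx_of_le e : rx e <= X ^ 3.
Proof.
rewrite /rx_of; case: eqP => // _.
have := scaled_le (rec_addr s e + 2) (rec_addr s e + 3); have := X_ge2.
by rewrite (expnS X 2); nia.
Qed.

Lemma P_of_le : P <= X ^ 2.
Proof. by rewrite /P_of; case: ifP => // _; apply: scaled_le. Qed.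

Lemma time_le e k : k <= n -> rx e + k * P <= X ^ 4.
Proof.
move=> kn; have h1 := rx_of_le e; have h2 := P_of_le; have h3 := X_ge2.
have h4 : k * P <= X ^ 3.
  by rewrite (expnS X 2) leq_mul //; apply: leq_trans kn (ltnW n_lt_X).
by rewrite (expnS X 3); nia.
Qed.

Lemma dg_le_n x d : dg n x d <= n. Proof. by rewrite -ltnS dg_lt. Qed.

Lemma final_value_le x : final_value n P rx x <= X ^ 5.
Proof.
rewrite /final_value; case: ifP => // _; have h3 := X_ge2.
have : flow n P rx x <= X ^ 4.
  by apply: leq_trans (leq_subr _ _) _; apply: time_le; apply: dg_le_n.
have : 0 < X ^ 4 by rewrite expn_gt0 (leq_trans _ h3).
by rewrite (expnS X 4); nia.
Qed.

Lemma s_lt_X : s.+1 <= X ^ s.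
Proof.
apply: leq_trans (ltn_expl s (isT : 1 < 2)) _.
by rewrite leq_expn2r ?X_ge2.
Qed.

Lemma move_cost_le x y : move_cost s n rx K0 K x y <= X ^ (s + 2).
Proof.
rewrite /move_cost; case: ifP => // _; rewrite /set_cost expnD.
apply: (@leq_trans (s.+1 * X ^ 2)); last by rewrite leq_mul2r s_lt_X orbT.
rewrite mulSn leq_add ?scaled_le // -[X in _ <= X * _](card_ord s) -sum_nat_const.
apply: leq_sum => i _; rewrite -[X in _ <= X]mul1n.
by rewrite leq_mul ?bit_le1 ?scaled_le.
Qed.

Lemma entry_cost_le l x x' y : l <= 3 * n ->
  (entry s n P rx cls K0 K l x).1 + move_cost s n rx K0 K x' y <= X ^ (s + 7).
Proof.
move=> lL; have h3 := X_ge2.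
have h1 := entry_bound cls l x final_value_le move_cost_le.
have h2 := move_cost_le x' y.
have h4 : l * X ^ (s + 2) <= X ^ (s + 5).
  have -> : s + 5 = 3 + (s + 2) by lia.
  rewrite (expnD X 3) leq_mul2r; apply/orP; right.
  by have := n_lt_X; rewrite !expnS expn0; nia.
have h5 : X ^ 5 <= X ^ (s + 5) by apply: leq_X_exp; lia.
have h6 : X ^ (s + 2) <= X ^ (s + 5) by apply: leq_X_exp; lia.
have -> : s + 7 = 2 + (s + 5) by lia.
apply: (@leq_trans (2 * 2 * X ^ (s + 5))); first by lia.
by rewrite (expnD X 2) -mulnn leq_mul2r leq_mul ?orbT.
Qed.

Lemma nstates_le : nstates s n <= X ^ ndigits s.
Proof. by rewrite leq_expn2r // n_lt_X. Qed.

(** The exponent covers both [s + 7], for the values in the table, and [3 + ndigits s], for its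
    indices. *)
Definition value_bound := X ^ (s + 7 + ndigits s + 3).

Lemma leq_value_bound i v : v <= X ^ i -> i <= s + 7 + ndigits s + 3 -> v <= value_bound.
Proof. by move=> vX ik; apply: leq_trans vX (leq_X_exp ik). Qed.

Lemma table_le : (3 * n + 1) * nstates s n <= X ^ (3 + ndigits s).
Proof.
rewrite expnD leq_mul ?nstates_le //.
by have := n_lt_X; have := X_ge2; rewrite !expnS expn0; nia.
Qed.

Lemma nmoves_le : nmoves s n <= X ^ (s + 2).
Proof.
rewrite addn2 expnS expnSr leq_mul ?n_lt_X //.
have h : 2 ^ s <= X ^ s by rewrite leq_expn2r ?X_ge2.
have h1 : 0 < 2 ^ s by rewrite expn_gt0.
rewrite /moves_per_job; apply: (@leq_trans (X ^ s * 2)); first by lia.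
by rewrite leq_mul2l X_ge2 orbT.
Qed.

(** The product comes from the table: [3 * n + 1 <= 4 * Om] layers, each of whose entries takes
    [5 * nmoves s n + 6] steps. The remaining summands generously cover scaling, the walk and the
    output. *)
Definition steps_coef := 4 * (5 * moves_per_job s + 6) + 3 * s + 70.

Lemma solve_steps_le : solve_steps s w <= steps_coef * Om ^ (ndigits s + 2).
Proof.
have nz := n_lt_z; have zO := size_le_word w; have O0 := word_size_gt0.
have M_le : nstates s n <= Om ^ ndigits s.
  by apply: leq_expn2r; apply: leq_trans nz zO.
have Y_le : nmoves s n <= Om * moves_per_job s.
  by rewrite leq_mul2r (leq_trans nz zO) orbT.
rewrite /solve_steps /table_steps /follow_steps /steps_coef expnD.
have q1 : 0 < Om ^ ndigits s by rewrite expn_gt0 O0.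
have L_le : 3 * n + 1 <= 4 * Om by lia.
have t1 : (3 * n + 1) * nstates s n * (1 + (nmoves s n * (3 + 2) + 2).+1 + 2) <=
    4 * Om * Om ^ ndigits s * (Om * (5 * moves_per_job s + 6)).
  apply: leq_mul; first exact: leq_mul.
  by move: (moves_per_job s) Y_le => a; nia.
have t2 : 3 * n * (1 + (3 + (s + 5 + 1)) + 2) <= Om * (3 * s + 36) by nia.
have OO : Om <= Om ^ 2 by rewrite -mulnn leq_pmulr.
have Oq : Om ^ 2 <= Om ^ ndigits s * Om ^ 2 by rewrite leq_pmull.
have -> : (4 * (5 * moves_per_job s + 6) + 3 * s + 70) * (Om ^ ndigits s * Om ^ 2) =
  4 * Om * Om ^ ndigits s * (Om * (5 * moves_per_job s + 6)) +
  (3 * s + 70) * (Om ^ ndigits s * Om ^ 2).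
  by rewrite -mulnn; ring.
have t3 : (3 * s + 70) * Om <= (3 * s + 70) * (Om ^ ndigits s * Om ^ 2).
  by rewrite leq_mul2l (leq_trans OO Oq) orbT.
by move: t1 t2 t3; lia.
Qed.

Definition bits_coef := (s + 7 + ndigits s + 3) * (s + 3) + 1.

Lemma bitlen_value_bound : bitlen value_bound <= bits_coef * Om ^ 2.
Proof.
have O0 := word_size_gt0.
rewrite /value_bound /magnitude -expnM /bitlen trunc_expnK // /bits_coef.
have : Om * (1 + s + 2 * Om) <= (s + 3) * Om ^ 2 by rewrite -mulnn; nia.
have : 0 < Om ^ 2 by rewrite expn_gt0 O0.
by move: (s + 7 + ndigits s + 3) => a; nia.
Qed.

Lemma encode_set_of A : encode_set (@set_of_code s A) = mkseq (bit A) s.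
Proof.
rewrite -map_enum_ord; apply: eq_map => i; rewrite inE.
by have := bit_le1 A i; case: (bit A i) => [|[|]].
Qed.

Lemma encodes_repl_map (Qs : seq (nat * nat)) :
  encodes_repl [seq (@set_of_code s q.1, ((rx q.2).-1%:R / D%:R : rat)%R) | q <- Qs]
    (flatten [seq mkseq (bit q.1) s ++ [:: (rx q.2).-1; D] | q <- Qs]).
Proof.
elim: Qs => [|q Qs IH] //=.
exists [:: (rx q.2).-1; D], (flatten [seq mkseq (bit q.1) s ++ [:: (rx q.2).-1; D] | q <- Qs]).
split=> //; first by exists (rx q.2).-1, D; rewrite D_of_gt0.
by rewrite encode_set_of -!catA.
Qed.

Lemma word_size_le (u : seq nat) B : {in u, forall x, x <= B} ->
  word_size u <= size u * bitlen B.
Proof.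
rewrite /word_size; elim: u => [|x u IH] h; first by rewrite big_nil.
rewrite big_cons /= mulSn leq_add ?leq_bitlen ?h ?mem_head //.
by apply: IH => y yu; apply: h; rewrite inE yu orbT.
Qed.

Lemma solve_instance : exists (y : solution s (njobs I)) (out : seq nat) (t : nat),
  [/\ computes_in (c_solve s) w out t,
      t <= (steps_coef * cmd_weight (c_solve s) + 1) * bits_coef * Om ^ (ndigits s + 4),
      encodes_solution y out & optimal y].
Proof.
have [nI size_w _ _ _] := decode.
have zO := size_le_word w; have O0 := word_size_gt0.
have [||||||||||t0 [m' [ex t0_le [m [x [Js [Qs [bm snd_x bf [fin val] rd]]]]] bm']]] :=
  @wp_solve s w value_bound size_w.
- by move=> a; apply: (@leq_value_bound 1); rewrite ?expn1 ?cell_le_X //; lia.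
- by move=> k kn; apply: (@leq_value_bound 1); rewrite ?expn1 ?D_upto_le //; lia.
- by apply: (leq_value_bound P_of_le); lia.
- by apply: (leq_value_bound table_le); lia.
- by apply: (leq_value_bound nmoves_le); lia.
- by move=> l x x' y lL; apply: (leq_value_bound (entry_cost_le x x' y lL)); lia.
- by move=> x; apply: (@leq_value_bound 4); [apply/time_le/dg_le_n|lia].
- by move=> e _; apply: (leq_value_bound (rx_of_le e)); lia.
- exact: cls_of_lt.
- exact: P_of_gt0.
set b := fun i => m (buf_cell w i) in rd.
set len := 2 * n + 1 + _ in rd.
have [bJ bc bQ] := bf.
(* The buffer stores predecessors; starting times are positive after the shift, so the successor
   recovers them. *)
pose st e := (b (2 * (e - 1))).+1.
have szQ := sound_size_repl snd_x.
have stE e t : (e, t) \in Js -> st e = t.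
  move=> h; have [b1 _] := bJ _ _ h; rewrite /st /b b1.
  have [_ HJ _ _ _] := snd_x; have [en _ [r1 _] _ _] := HJ _ _ h.
  by have := rx_of_gt0 s en; move: r1; case: t {h b1} => //; lia.
have d5 : dg n x 5 = n.
  by apply/eqP; apply: contraNT fin => h; rewrite /final_value (negbTE h).
have len_z : len <= z.
  have : (s + 2) * size Qs <= (s + 2) * n by rewrite leq_mul2l szQ orbT.
  by rewrite /len; move: size_w; nia.
exists (read_solution rx I D st Qs), (mkseq b len), (t0 + word_size (mkseq b len)).
split.
- by exists m', t0.
- have h1 : word_size (mkseq b len) <= Om * bitlen value_bound.
    apply: (@leq_trans (size (mkseq b len) * bitlen value_bound)).
      by apply: word_size_le => v /mapP [i _ ->]; apply: bm.
    by rewrite size_mkseq leq_mul2r (leq_trans len_z zO) orbT.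
  have h2 := solve_steps_le; have h3 := bitlen_value_bound.
  set cw := cmd_weight _ in t0_le *.
  have h4 : Om <= Om ^ (ndigits s + 2).
    by rewrite -[X in X <= _]expn1 leq_pexp2l //; lia.
  (* The number of steps times the weight [cw] and the bit length of the largest value bounds the
     execution; the extra summand pays for the size of the output. *)
  apply: (@leq_trans ((steps_coef * Om ^ (ndigits s + 2) * cw + Om ^ (ndigits s + 2)) *
     (bits_coef * Om ^ 2))).
    rewrite mulnDl; apply: leq_add.
      apply: leq_trans t0_le _; rewrite mulnA; apply: leq_mul => //.
      by rewrite leq_mul2r h2 orbT.
    by apply: leq_trans h1 _; apply: leq_mul.
  have -> : ndigits s + 4 = (ndigits s + 2) + 2 by lia.
  rewrite (expnD _ (ndigits s + 2)) leq_eqVlt; apply/orP; left; apply/eqP.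
  by ring.
- exists (fun j : 'I_(njobs I) => [:: b (2 * j); b (2 * j + 1)]),
    (flatten [seq mkseq (bit q.1) s ++ [:: (rx q.2).-1; D] | q <- Qs]); split.
  + move=> j; exists (b (2 * j)), (b (2 * j + 1)); split=> //.
      have [|t h] := sound_all snd_x d5 (e := j.+1); first by rewrite nI /= ltn_ord.
      have [_ ] := bJ _ _ h; rewrite subn1 /= -/(b _) => ->.
      exact: D_of_gt0.
    have [|t h] := sound_all snd_x d5 (e := j.+1); first by rewrite nI /= ltn_ord.
    have [_ ] := bJ _ _ h; rewrite subn1 /= -/(b _) => ->.
    by rewrite /st subn1.
  + exact: encodes_repl_map.
  + rewrite /len mkseq_add mkseq_add -catA; congr (_ ++ _).
      rewrite mulnC mkseq_flatten -nI (map_enum_ord (fun j => [:: b (2 * j); b (2 * j + 1)])).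
      congr flatten; apply: eq_map => j.
      by rewrite /mkseq /= addn0 mulnC.
    rewrite /= addn0 {1}/b bc size_map; congr (_ :: _).
    rewrite [(s + 2) * _]mulnC mkseq_flatten; congr flatten.
    have mapQ (g : nat * nat -> seq nat) :
        [seq g q | q <- Qs] = mkseq (fun c => g (nth (0, 0) Qs c)) (size Qs).
      by rewrite -{1}(mkseq_nth (0, 0) Qs) /mkseq -map_comp.
    rewrite mapQ; apply/eq_in_map => c.
    rewrite mem_iota add0n => /andP [_ cQ] /=.
    have [q1 q2 q3] := bQ c cQ.
    rewrite mkseq_add; congr (_ ++ _).
      apply/eq_in_map => i; rewrite mem_iota add0n => /andP [_ is_].
      by rewrite -q1 // /b /slot; congr (m (buf_cell w _)); lia.
    rewrite /mkseq /= -q2 -q3 /b /slot.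
    by congr [:: m (buf_cell w _); m (buf_cell w _)]; lia.
- apply: (optimal_read_solution erefl (@rx_of_gt0 s w) cls_of_lt P_of_gt0 D_of_gt0 nI
    valid_I scale_proc_of scale_release_of cls_of_req scale_joint_of scale_res_of
    snd_x fin val stE).
Qed.

End Decode.

Theorem theorem9 (s : nat) :
  solvable_in_polynomial_time
    (fun I : instance s => valid_instance I /\ equal_proc I)
    (fun (I : instance s) (w : seq nat) => encodes_instance I w)
    (fun (I : instance s) (x : solution s (njobs I)) (w : seq nat) =>
       encodes_solution x w)
    (fun (I : instance s) (x : solution s (njobs I)) => optimal x).
Proof.
(* The program, the coefficient and the exponent depend on [s] only, which is what a constant number
   of resources provides. *)
set a := (steps_coef s * cmd_weight (c_solve s) + 1) * bits_coef s.
exists (c_solve s), a, (ndigits s + 4) => I w [valid_I equal_I] enc_I.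
have [y [out [t [comp t_le enc_y opt]]]] := solve_instance valid_I equal_I enc_I.
exists y, out, t; split=> //.
exact: leq_trans t_le (leq_addr _ _).
Qed.
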